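(* Let $n\ge2$ and $s\in(0,\tfrac12)$. Let $E\subset\mathbb{R}^n$ be of the form $E=\{x=(x',x_n)\in\mathbb{R}^{n-1}\times\mathbb{R}:\ x_n<u(x')\}$ for some function $u:\mathbb{R}^{n-1}\to\mathbb{R}$, with $\partial E=\{x_n=u(x')\}$. Suppose that $\partial E$ is globally of class $C^2$ and that $H^s_E(x)=0$ for every $x\in\partial E$. Let $\nu(x)=(\nu_1(x),\dots,\nu_n(x))$ be the exterior unit normal of $E$ at $x\in\partial E$. Then $$\nu_n(x)\neq0\qquad\text{for every }x\in\partial E .$$
   Context: The nonlocal ($s$-)mean curvature of $E$ at $p\in\partial E$ is, in the principal value sense, $$H^s_E(p):=\lim_{\rho\searrow0}\int_{\mathbb{R}^n\setminus B_\rho(p)}\frac{\chi_{E^c}(x)-\chi_E(x)}{|x-p|^{n+2s}}\,dx ,$$ where $E^c=\mathbb{R}^n\setminus E$. ''$\partial E$ is globally of class $C^2$'' means that $\partial E$ is a $C^2$ hypersurface of $\mathbb{R}^n$ with uniform bounds, i.e. there are $r,M>0$ such that for every $p\in\partial E$, after a rigid motion taking $p$ to the origin, $E\cap B_r$ is the subgraph in $B_r$ of a $C^2$ function with $C^2$ norm at most $M$. The function $u$ itself is not assumed to be differentiable (a priori, $\partial E$ could have vertical tangent hyperplanes). *)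

(* Defs.v *)
From HB Require Import structures.
From mathcomp Require Import all_boot all_order all_algebra.
From mathcomp Require Import all_classical all_reals all_analysis.
Set Implicit Arguments.
Unset Strict Implicit.
Unset Printing Implicit Defensive.
Import Order.TTheory GRing.Theory Num.Theory.
Import numFieldNormedType.Exports.
Local Open Scope classical_set_scope.
Local Open Scope ring_scope.

(* The splitting x = (x', x_n) of R^n = R^(n-1) x R; the dimension is written
   n.+1 below, so that x' lives in 'rV[R]_n. *)
Section Coordinates.
Context {R : Type} {n : nat}.

Definition lastc (x : 'rV[R]_n.+1) : R := x ord0 ord_max.

Definition initc (x : 'rV[R]_n.+1) : 'rV[R]_n :=
  \row_(i < n) x ord0 (lift ord_max i).

Definition snoc (z : 'rV[R]_n * R) : 'rV[R]_n.+1 :=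
  \row_(i < n.+1) if unlift ord_max i is Some j then z.1 ord0 j else z.2.

Lemma lastc_snoc z : lastc (snoc z) = z.2.
Proof. by rewrite /lastc mxE unlift_none. Qed.

Lemma initc_snoc z : initc (snoc z) = z.1.
Proof. by apply/rowP => i; rewrite !mxE liftK. Qed.

End Coordinates.

(* Euclidean structure; the library's `|x| on 'rV[R]_n is the sup norm, which
   induces the same topology but not the same balls. *)
Section Euclidean.
Context {R : realType} {n : nat}.
Implicit Types x y : 'rV[R]_n.

Definition dotp x y : R := \sum_(i < n) x ord0 i * y ord0 i.

Definition enorm x : R := Num.sqrt (dotp x x).

Definition eball (p : 'rV[R]_n) (r : R) : set 'rV[R]_n :=
  [set x | enorm (x - p) < r].

Definition boundary (E : set 'rV[R]_n) : set 'rV[R]_n :=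
  closure E `\` interior E.

End Euclidean.

(* 'rV[R]_n carries the product sigma-algebra, generated by the coordinates
   (the Borel sigma-algebra of R^n). *)
Section RowMeasurable.
Context (R : realType) (n : nat).

Definition coord_row (i : 'I_n) (x : 'rV[R]_n) : measurableTypeR R :=
  x ord0 i.

Let row_set0 : g_sigma_preimage coord_row set0.
Proof. exact: sigma_algebra0. Qed.

Let row_setC A : g_sigma_preimage coord_row A ->
  g_sigma_preimage coord_row (~` A).
Proof. exact: sigma_algebraC. Qed.

Let row_bigcup (F : (set 'rV[R]_n)^nat) :
  (forall i, g_sigma_preimage coord_row (F i)) ->
  g_sigma_preimage coord_row (\bigcup_i (F i)).
Proof. exact: sigma_algebra_bigcup. Qed.

HB.instance Definition _ :=
  @isMeasurable.Build (measure_tuple_display default_measure_display)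
    'rV[R]_n (g_sigma_preimage coord_row) row_set0 row_setC row_bigcup.

Lemma measurable_coord_row (i : 'I_n) : measurable_fun setT (coord_row i).
Proof.
move=> _ Y mY; rewrite setTI; apply: sub_sigma_algebra => /=.
rewrite -bigcup_seq/=; exists i => /=; first by rewrite mem_index_enum.
by exists Y => //; rewrite setTI.
Qed.

Lemma measurable_fun_rowP d (T : measurableType d) (f : T -> 'rV[R]_n) :
  (forall i, measurable_fun setT (coord_row i \o f)) ->
  measurable_fun setT f.
Proof.
move=> mf _ Y mY.
suff: image_set_system setT f measurable Y by [].
move: Y mY; apply: smallest_sub.
  by apply: sigma_algebra_image; exact: sigma_algebra_measurable.
move=> B /=; rewrite -bigcup_seq/= => -[i _ [Y mY <-]].
by rewrite /image_set_system/= !setTI; have := mf i measurableT _ mY; rewrite setTI.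
Qed.

End RowMeasurable.

(* Lebesgue measure on R^n, by induction on n: Dirac mass on the one-point
   space R^0, then the product with one-dimensional Lebesgue measure,
   transported along (x', x_n) |-> x. *)
Section LebesgueStep.
Context (R : realType) (n : nat).
Variable mu : {sigma_finite_measure set 'rV[R]_n -> \bar R}.

Let snocR (z : 'rV[R]_n * measurableTypeR R) : 'rV[R]_n.+1 := snoc z.

Definition lebesgue_step : set 'rV[R]_n.+1 -> \bar R :=
  pushforward (product_measure1 mu (@lebesgue_measure R)) snocR.

Let measurable_snoc : measurable_fun setT snocR.
Proof.
apply: measurable_fun_rowP => i.
case: (unliftP ord_max i) => [j|] ->.
  rewrite (_ : _ \o _ = coord_row j \o fst); last first.
    by apply/funext => z; rewrite /coord_row /snocR /= mxE liftK.
  by apply: measurableT_comp; [exact: measurable_coord_row|].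
rewrite (_ : _ \o _ = snd) //.
by apply/funext => z; rewrite /coord_row /snocR /= mxE unlift_none.
Qed.

Let measurable_unsnoc : measurable_fun setT
  (fun x : 'rV[R]_n.+1 => (initc x, lastc x) : 'rV[R]_n * measurableTypeR R).
Proof.
apply: measurable_fun_pair; last exact: measurable_coord_row.
apply: measurable_fun_rowP => i.
rewrite (_ : _ \o _ = coord_row (lift ord_max i)).
  exact: measurable_coord_row.
by apply/funext => x; rewrite /coord_row /= mxE.
Qed.

Let preimage_snoc A : measurable A -> measurable (snocR @^-1` A).
Proof. by move=> mA; rewrite -[X in measurable X]setTI; exact: measurable_snoc. Qed.

Let step0 : lebesgue_step set0 = 0%E.
Proof. by rewrite /lebesgue_step /pushforward preimage_set0 measure0. Qed.

Let step_ge0 A : (0 <= lebesgue_step A)%E.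
Proof. exact: measure_ge0. Qed.

Let step_semi_sigma_additive : semi_sigma_additive lebesgue_step.
Proof.
move=> F mF tF mUF; rewrite /lebesgue_step /pushforward preimage_bigcup.
apply: measure_semi_sigma_additive.
- by move=> k; exact: preimage_snoc.
- apply/trivIsetP => /= i j _ _ ij; rewrite -preimage_setI.
  by move/trivIsetP : tF => /(_ _ _ _ _ ij) ->//; rewrite preimage_set0.
- by rewrite -preimage_bigcup; exact: preimage_snoc.
Qed.

HB.instance Definition _ := isMeasure.Build _ _ _
  lebesgue_step step0 step_ge0 step_semi_sigma_additive.

Let step_sigma_finite : sigma_finite setT lebesgue_step.
Proof.
have /sigma_finiteP[F [FT ndF mF]] := sigma_finiteT mu.
have /sigma_finiteP[G [GT ndG mG]] := sigma_finiteT (@lebesgue_measure R).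
pose unsnoc (x : 'rV[R]_n.+1) : 'rV[R]_n * measurableTypeR R :=
  (initc x, lastc x).
exists (fun k => unsnoc @^-1` (F k `*` G k)).
  rewrite -preimage_bigcup (_ : \bigcup_k _ = setT) ?preimage_setT//.
  rewrite -setXTT FT GT predeqE => -[x y]; split.
    by move=> [k _ []/= ? ?]; split; exists k.
  move=> [/= [k _ Fkx] [l _ Gly]]; exists (maxn k l) => //; split.
    by move: x Fkx; exact/subsetPset/ndF/leq_maxl.
  by move: y Gly; exact/subsetPset/ndG/leq_maxr.
move=> k; have [mFk Fk] := mF k; have [mGk Gk] := mG k; split.
  rewrite -[X in measurable X]setTI; apply: measurable_unsnoc => //.
  exact: measurableX.
rewrite /lebesgue_step /pushforward (_ : _ @^-1` _ = F k `*` G k); last first.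
  by apply/seteqP; split => -[x t]; rewrite /unsnoc/= initc_snoc lastc_snoc.
by rewrite product_measure1E// lte_mul_pinfty// ge0_fin_numE.
Qed.

HB.instance Definition _ := Measure_isSigmaFinite.Build _ _ _
  lebesgue_step step_sigma_finite.

End LebesgueStep.

Fixpoint lebesgueRn (R : realType) (n : nat) :
    {sigma_finite_measure set 'rV[R]_n -> \bar R} :=
  match n return {sigma_finite_measure set 'rV[R]_n -> \bar R} with
  | 0 => [the {sigma_finite_measure set 'rV[R]_0 -> \bar R} of
           dirac (0 : 'rV[R]_0)]
  | m.+1 => [the {sigma_finite_measure set 'rV[R]_m.+1 -> \bar R} of
              lebesgue_step (lebesgueRn R m)]
  end.

Section NonlocalMeanCurvature.
Local Open Scope ereal_scope.
Context {R : realType} {n : nat}.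

Definition truncated_nmc (s : R) (E : set 'rV[R]_n) (p : 'rV[R]_n) (rho : R) :
    \bar R :=
  \int[lebesgueRn R n]_(x in ~` eball p rho)
    ((\1_(~` E) x - \1_E x) / enorm (x - p) `^ (n%:R + 2 * s))%:E%R.

(* H^s_E(p) exists in the principal value sense and equals h *)
Definition has_nmc (s : R) (E : set 'rV[R]_n) (p : 'rV[R]_n) (h : R) : Prop :=
  truncated_nmc s E p rho @[rho --> (0%R : R)^'+] --> h%:E.

End NonlocalMeanCurvature.

Section GloballyC2.
Context {R : realType}.

(* g has continuous partial derivatives of order <= 2 on the open set U *)
Definition C2_on m (U : set 'rV[R]_m) (g : 'rV[R]_m -> R) : Prop :=
  forall y, U y -> {for y, continuous g} /\
    forall i : 'I_m,
      [/\ derivable g y 'e_i, {for y, continuous ('D_'e_i g)} &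
        forall j : 'I_m, derivable ('D_'e_i g) y 'e_j /\
          {for y, continuous ('D_'e_j ('D_'e_i g))}].

(* the C^2 norm is the maximum of the suprema over U of the partial
   derivatives of order <= 2 *)
Definition C2_norm_le m (U : set 'rV[R]_m) (g : 'rV[R]_m -> R) (M : R) : Prop :=
  forall y, U y -> `|g y| <= M /\
    forall i : 'I_m, `|'D_'e_i g y| <= M /\
      forall j : 'I_m, `|'D_'e_j ('D_'e_i g) y| <= M.

Definition subgraph m (g : 'rV[R]_m -> R) : set 'rV[R]_m.+1 :=
  [set x | lastc x < g (initc x)].

Definition graph m (g : 'rV[R]_m -> R) : set 'rV[R]_m.+1 :=
  [set x | lastc x = g (initc x)].

(* rigid motions taking p to the origin: x |-> (x - p) Q with Q orthogonal *)
Definition rigid n (Q : 'M[R]_n) (p x : 'rV[R]_n) : 'rV[R]_n := (x - p) *m Q.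

Definition boundary_globally_C2 m (E : set 'rV[R]_m.+1) : Prop :=
  exists r M : R, [/\ 0 < r, 0 < M &
    forall p, boundary E p ->
      exists (Q : 'M[R]_m.+1) (g : 'rV[R]_m -> R),
        [/\ Q *m Q^T = 1%:M,
            C2_on (eball 0 r) g,
            C2_norm_le (eball 0 r) g M &
            (rigid Q p @` E) `&` eball 0 r = subgraph g `&` eball 0 r]].

End GloballyC2.

Section Normal.
Context {R : realType} {n : nat}.

(* w is the velocity at p of a curve lying on S *)
Definition tangent (S : set 'rV[R]_n) (p w : 'rV[R]_n) : Prop :=
  exists gamma : R -> 'rV[R]_n,
    [/\ gamma 0 = p, \forall t \near (0 : R), S (gamma t) &
        is_derive (0 : R) 1 gamma w].

Definition exterior_unit_normal (E : set 'rV[R]_n) (p nu : 'rV[R]_n) : Prop :=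
  [/\ enorm nu = 1,
      forall w, tangent (boundary E) p w -> dotp nu w = 0 &
      \forall t \near (0 : R)^'+, (~` E) (p + t *: nu) /\ E (p - t *: nu)].

End Normal.

(* Main.v *)
(* Suppose that the normal at p is horizontal. For small t > 0 the translate
   E - t e_n is contained in E and, e_n being tangent at p, its boundary passes
   within O(t^2) of p. Sliding E - t e_n horizontally until it touches E near p,
   with a quadratic penalty to localize the contact, yields boundary points q and
   q2 = q + t e_n + O(t^2) such that near the origin E - q2 is contained in
   E - q up to a shear of size O(t^2); the shear changes the singular integral
   only by O(t^2), by cancellation between x and -x. Away from the contact, on
   the other hand, E differs from E - t e_n by a set with vertical fibres of
   length t, which contributes at least c t. Hence the mean curvatures at q and
   q2 differ by at least c t - C t^2 > 0, although both vanish. *)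
Require Import Defs.
From mathcomp Require Import ring lra.
From mathcomp Require Import all_boot all_order all_algebra.
From mathcomp Require Import all_classical all_reals all_analysis.
From mathcomp Require Import measurable_realfun.
Set Implicit Arguments.
Unset Strict Implicit.
Unset Printing Implicit Defensive.
Import Order.TTheory GRing.Theory Num.Theory.
Import numFieldNormedType.Exports.
Local Open Scope classical_set_scope.
Local Open Scope ring_scope.

(** * Lebesgue measure on R^n *)

(** The obstacle is that a = n + 2s exceeds n: the kernel |x|^(-a) is not absolutely integrable at
    the contact, so an inclusion that holds only up to a shear cannot be exploited by size estimates
    alone. The shear is k (q(x) + l(x)) along a coordinate axis, with k of order t^2, q quadratic
    and l linear; the linear part arises because the penalty, centred at p, has a slope at the
    contact point. The quadratic part changes the kernel by about |x|^(1-a), integrable since a < n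
    + 1. The linear part costs |x|^(-a), which has to be integrated only over the thin layer where E
    and its reflection through the contact point fail to be complementary; this layer has measure
    O(r^(n+1)) in a ball of radius r. Both facts rest on s < 1/2. Since shears preserve volume, the
    deformation is put on the kernel and not on E; to allow this, the kernel is levelled off at
    height rho^(-a) instead of being cut to zero, and all constants are uniform in rho. The
    coefficient of the penalty is of order t^2 because the slide needed at p is, and this keeps the
    contact within a fixed radius of p. *)

Section RowMeasurability.
Context {R : realType}.

Lemma measurable_coord n (i : 'I_n) :
  measurable_fun setT (fun x : 'rV[R]_n => x ord0 i).
Proof. exact: measurable_coord_row. Qed.

Lemma measurable_rowP d (T : measurableType d) n (f : T -> 'rV[R]_n) :
  (forall i, measurable_fun setT (fun x => f x ord0 i)) ->
  measurable_fun setT f.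
Proof. by move=> mf; apply: measurable_fun_rowP => i; exact: mf. Qed.

Lemma snoc_lift n (z : 'rV[R]_n * R) i : snoc z ord0 (lift ord_max i) = z.1 ord0 i.
Proof. by rewrite mxE liftK. Qed.

Lemma snoc_max n (z : 'rV[R]_n * R) : snoc z ord0 ord_max = z.2.
Proof. by rewrite mxE unlift_none. Qed.

Lemma snocK n (x : 'rV[R]_n.+1) : snoc (initc x, lastc x) = x.
Proof.
apply/rowP => i; case: (unliftP ord_max i) => [j|] ->.
  by rewrite snoc_lift mxE.
by rewrite snoc_max.
Qed.

Lemma measurable_snoc n :
  measurable_fun setT (snoc : 'rV[R]_n * measurableTypeR R -> 'rV[R]_n.+1).
Proof.
apply: measurable_rowP => i; case: (unliftP ord_max i) => [j|] ->.
  under eq_fun do rewrite snoc_lift.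
  exact: measurableT_comp (measurable_coord j) measurable_fst.
under eq_fun do rewrite snoc_max.
exact: measurable_snd.
Qed.

Lemma measurable_addrow d (T : measurableType d) n (f g : T -> 'rV[R]_n) :
  measurable_fun setT f -> measurable_fun setT g ->
  measurable_fun setT (fun x => f x + g x).
Proof.
move=> mf mg; apply: measurable_rowP => i; under eq_fun do rewrite mxE.
by apply: measurable_funD; apply: measurableT_comp (measurable_coord i) _.
Qed.

Lemma measurable_scalerow d (T : measurableType d) n (h : T -> R) (v : 'rV[R]_n) :
  measurable_fun setT h -> measurable_fun setT (fun x => h x *: v).
Proof.
move=> mh; apply: measurable_rowP => i; under eq_fun do rewrite mxE.
by apply: measurable_funM => //; exact: measurable_cst.
Qed.

Lemma measurable_opprow n : measurable_fun setT (fun x : 'rV[R]_n => - x).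
Proof.
apply: measurable_rowP => i; under eq_fun do rewrite mxE.
by apply: measurableT_comp => //; exact: measurable_coord.
Qed.

Lemma measurable_dotp d (T : measurableType d) n (f g : T -> 'rV[R]_n) :
  measurable_fun setT f -> measurable_fun setT g ->
  measurable_fun setT (fun x => dotp (f x) (g x)).
Proof.
move=> mf mg; rewrite /dotp; apply: measurable_sum => i.
by apply: measurable_funM; apply: measurableT_comp (measurable_coord i) _.
Qed.

Lemma measurable_enorm n : measurable_fun setT (enorm : 'rV[R]_n -> R).
Proof.
have ms := continuous_measurable_fun (@sqrt_continuous R).
apply: (measurableT_comp ms).
by apply: measurable_dotp; exact: measurable_id.
Qed.

End RowMeasurability.

Section Invariance.
Context {R : realType}.
Local Notation lam := (@lebesgue_measure R).

Definition preserving n (f : 'rV[R]_n -> 'rV[R]_n) : Prop :=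
  measurable_fun setT f /\
  forall A, measurable A -> lebesgueRn R n (f @^-1` A) = lebesgueRn R n A.

Lemma measurable_preimage d1 d2 (T1 : measurableType d1) (T2 : measurableType d2)
    (f : T1 -> T2) A :
  measurable_fun setT f -> measurable A -> measurable (f @^-1` A).
Proof. by move=> mf mA; rewrite -[X in measurable X]setTI; exact: mf. Qed.

Lemma measurable_snoc_preimage n (A : set 'rV[R]_n.+1) : measurable A ->
  measurable ((snoc : 'rV[R]_n * measurableTypeR R -> _) @^-1` A).
Proof. by apply: measurable_preimage; exact: measurable_snoc. Qed.

Lemma lebesgueRnS1 n (A : set 'rV[R]_n.+1) :
  lebesgueRn R n.+1 A =
  (\int[lebesgueRn R n]_x lam (fun c => A (snoc (x, c))))%E.
Proof.
apply: eq_integral => x _ /=; congr lebesgue_measure.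
by apply/funext => c; rewrite xsectionE.
Qed.

(** The recursive construction measures vertical fibres; slicing by hyperplanes of constant last
    coordinate follows from uniqueness of the product measure. An induction on the dimension needs
    it whenever the last coordinate is frozen. *)
Lemma lebesgueRnS2 n (A : set 'rV[R]_n.+1) : measurable A ->
  lebesgueRn R n.+1 A =
  (\int[lam]_c lebesgueRn R n (fun x => A (snoc (x, c))))%E.
Proof.
move=> mA; have mS := measurable_snoc_preimage mA.
rewrite [LHS](product_measure_unique (m' := product_measure2 (lebesgueRn R n) lam)) //.
  apply: eq_integral => x _ /=; congr (lebesgueRn R n _).
  by apply/funext => c; rewrite ysectionE.
by move=> B C mB mC; exact: product_measure2E.
Qed.

Lemma lebesgue_measureD (A : set R) (c : R) : measurable A ->
  lam (fun x => A (x + c)) = lam A.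
Proof.
move=> mA; have mD : measurable_fun setT (fun x : measurableTypeR R => x + c : measurableTypeR R).
  by apply: measurable_funD; [exact: measurable_id|exact: measurable_cst].
suff : pushforward lam (fun x : measurableTypeR R => x + c : measurableTypeR R) A = lam A by [].
apply/esym/lebesgue_measure_unique => //= _ [[a b]] _ <-.
rewrite /pushforward.
rewrite (_ : _ @^-1` _ = `]a - c, b - c]%classic); last first.
  by apply/seteqP; split => x /=; rewrite !in_itv/= ltrBlDr lerBrDr.
rewrite !lebesgue_measure_itv/= !lte_fin ltrD2r.
by case: ifP => // _; rewrite -!EFinD; congr EFin; ring.
Qed.

Lemma ge0_integral_preserving n (f : 'rV[R]_n -> 'rV[R]_n) (g : 'rV[R]_n -> \bar R) :
  preserving f -> measurable_fun setT g -> (forall x, 0 <= g x)%E ->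
  (\int[lebesgueRn R n]_x g (f x) = \int[lebesgueRn R n]_x g x)%E.
Proof.
move=> [mf pf] mg g0.
rewrite -[LHS](@ge0_integral_pushforward _ _ _ _ R f mf (lebesgueRn R n) setT g) //.
by apply: eq_measure_integral => A mA _; exact: pf.
Qed.

Lemma measurable_lam_section n (A : set 'rV[R]_n.+1) : measurable A ->
  measurable_fun setT (fun x : 'rV[R]_n => lam (fun c => A (snoc (x, c)))).
Proof.
move=> mA; have := measurable_fun_xsection lam (measurable_snoc_preimage mA).
congr (measurable_fun _ _); apply/funext => x /=; congr lebesgue_measure.
by apply/funext => c; rewrite xsectionE.
Qed.

Lemma preserving_snoc n (g : 'rV[R]_n -> 'rV[R]_n) (k : R -> R) (f : 'rV[R]_n.+1 -> 'rV[R]_n.+1) :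
  preserving g -> (forall A, measurable A -> lam (k @^-1` A) = lam A) ->
  measurable_fun setT f ->
  (forall x c, f (snoc (x, c)) = snoc (g x, k c)) -> preserving f.
Proof.
move=> pg pk mf fE; split => // A mA; rewrite !lebesgueRnS1.
rewrite -[RHS](ge0_integral_preserving pg) //; last exact: measurable_lam_section.
apply: eq_integral => x _ /=; have := pk (fun c => A (snoc (g x, c))).
rewrite /preimage/= => <-.
  by congr lebesgue_measure; apply/funext => c; rewrite /= fE.
have := measurable_xsection (g x) (measurable_snoc_preimage mA).
by congr measurable; apply/funext => c; rewrite xsectionE.
Qed.

Lemma preserving0 (f : 'rV[R]_0 -> 'rV[R]_0) : preserving f.
Proof.
have -> : f = id by apply/funext => x; apply/rowP => -[].
by split => //; exact: measurable_id.
Qed.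

Lemma preserving_translation n (v : 'rV[R]_n) : preserving (fun x => x + v).
Proof.
elim: n v => [|n IH] v; first exact: preserving0.
apply: (@preserving_snoc _ (fun x => x + initc v) (fun c => c + lastc v)) => //.
- by move=> A mA; exact: lebesgue_measureD.
- by apply: measurable_addrow; [exact: measurable_id|exact: measurable_cst].
move=> x c; apply/rowP => i; rewrite [LHS]mxE.
by case: (unliftP ord_max i) => [j|] ->; rewrite ?snoc_lift ?snoc_max//= !mxE.
Qed.

Lemma preserving_opp n : preserving (fun x : 'rV[R]_n => - x).
Proof.
elim: n => [|n IH]; first exact: preserving0.
apply: (@preserving_snoc _ (fun x => - x) (fun c => - c)) => //.
- by move=> A mA; exact: lebesgue_measureN.
- exact: measurable_opprow.
move=> x c; apply/rowP => i; rewrite [LHS]mxE.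
by case: (unliftP ord_max i) => [j|] ->; rewrite ?snoc_lift ?snoc_max//= mxE.
Qed.

(** Induction on the dimension: if ['e_i] is not the last axis, freezing the last coordinate leaves
    a shear one dimension lower; if it is, [h] is constant on each vertical fibre, which is merely
    translated. *)
Lemma preserving_shear n (i : 'I_n) (h : 'rV[R]_n -> R) :
  measurable_fun setT h -> (forall x c, h (x + c *: 'e_i) = h x) ->
  preserving (fun x => x + h x *: 'e_i).
Proof.
elim: n i h => [[]//|n IH] i h mh hE.
have mf k (j : 'I_k) (h' : 'rV[R]_k -> R) : measurable_fun setT h' ->
    measurable_fun setT (fun x : 'rV[R]_k => x + h' x *: 'e_j).
  by move=> mh'; apply: measurable_addrow;
    [exact: measurable_id|exact: measurable_scalerow].
split; first exact: mf.
move=> A mA.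
have mfA : measurable ((fun x : 'rV[R]_n.+1 => x + h x *: 'e_i) @^-1` A).
  by apply: measurable_preimage => //; exact: mf.
case: (unliftP ord_max i) => [j|] ij; subst i.
  rewrite !lebesgueRnS2//; apply: eq_integral => c _.
  have mhc : measurable_fun setT (fun x : 'rV[R]_n => h (snoc (x, c))).
    apply: (measurableT_comp mh); apply: (measurableT_comp (@measurable_snoc R n)).
    exact: pair2_measurable.
  have addE x a : snoc (x, c) + a *: 'e_(lift ord_max j) = snoc (x + a *: 'e_j, c).
    apply/rowP => i; rewrite !mxE.
    case: (unliftP ord_max i) => [j'|] ->; rewrite ?snoc_lift ?snoc_max ?mxE/=.
      by rewrite (inj_eq (@lift_inj _ ord_max)).
    by rewrite eq_liftF mulr0 addr0.
  have hcE x a : h (snoc (x + a *: 'e_j, c)) = h (snoc (x, c)).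
    by rewrite -addE hE.
  have [_ /(_ (fun x => A (snoc (x, c))))] := IH j _ mhc hcE.
  rewrite /preimage/= => <-.
    by congr (lebesgueRn R n _); apply/funext => x /=; rewrite addE.
  have := measurable_ysection c (measurable_snoc_preimage mA).
  by congr measurable; apply/funext => x; rewrite ysectionE.
rewrite !lebesgueRnS1//; apply: eq_integral => x _.
have addE c a : snoc (x, c) + a *: 'e_ord_max = snoc (x, c + a).
  apply/rowP => i; rewrite !mxE.
  case: (unliftP ord_max i) => [j'|] ->; rewrite ?snoc_lift ?snoc_max ?mxE/=.
    by rewrite lift_eqF mulr0 addr0.
  by rewrite eqxx mulr1.
have hcE c : h (snoc (x, c)) = h (snoc (x, 0)).
  by rewrite -{1}(add0r c) -addE hE.
rewrite -[RHS](lebesgue_measureD (h (snoc (x, 0)))).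
  by congr lebesgue_measure; apply/funext => c; rewrite /preimage/= hcE addE.
have := measurable_xsection x (measurable_snoc_preimage mA).
by congr measurable; apply/funext => c; rewrite xsectionE.
Qed.

Lemma measurable_forall_ord d (T : measurableType d) n (P : 'I_n -> set T) :
  (forall i, measurable (P i)) -> measurable [set x | forall i, P i x].
Proof.
move=> mP; rewrite (_ : mkset _ = \bigcap_(i in [set: 'I_n]) P i); last first.
  by apply/seteqP; split => x /= h; [move=> i _; exact: h|move=> i; exact: h].
by apply: fin_bigcap_measurable.
Qed.

Lemma measurable_box n (a b : 'I_n -> R) :
  measurable [set x : 'rV[R]_n | forall i, a i <= x ord0 i <= b i].
Proof.
apply: (@measurable_forall_ord _ 'rV[R]_n _ (fun i x => a i <= x ord0 i <= b i)) => i.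
rewrite (_ : (fun _ => _) = (fun x : 'rV[R]_n => x ord0 i : measurableTypeR R) @^-1` `[a i, b i]%classic).
  by apply: measurable_preimage; [exact: measurable_coord|exact: measurable_itv].
by apply/funext => x; rewrite /preimage/= in_itv/=.
Qed.

Lemma lebesgueRn_box n (a b : 'I_n -> R) : (forall i, a i <= b i) ->
  lebesgueRn R n [set x | forall i, a i <= x ord0 i <= b i] =
  (\prod_(i < n) (b i - a i))%:E.
Proof.
elim: n a b => [|n IH] a b ab.
  rewrite big_ord0 /= /dirac /= indicE mem_set//=; by case.
rewrite lebesgueRnS1.
pose a' (i : 'I_n) := a (lift ord_max i); pose b' (i : 'I_n) := b (lift ord_max i).
pose B := [set x : 'rV[R]_n | forall i, a' i <= x ord0 i <= b' i].
have mB : measurable B by exact: measurable_box.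
rewrite (eq_integral (fun x => (b ord_max - a ord_max)%:E * (\1_B x)%:E)%E).
  rewrite ge0_integralZl//; last first.
  - by rewrite lee_fin subr_ge0.
  - by apply/measurable_EFinP; exact: measurable_indic.
  rewrite integral_indic// setIT.
  transitivity ((b ord_max - a ord_max)%:E * (\prod_(i < n) (b' i - a' i))%:E)%E.
    by congr (_ * _)%E; apply: IH => i; exact: ab.
  by rewrite big_ord_recr/= -EFinM mulrC; congr (_ * _)%:E; apply: eq_bigr => i _;
    rewrite /a' /b'; congr (b _ - a _); apply/val_inj; rewrite /= /bump leqNgt ltn_ord.
move=> x _; rewrite indicE; case: (boolP (x \in B)) => [|/negP] xB.
  rewrite mule1 (_ : (fun c => _) = `[a ord_max, b ord_max]%classic).
    by rewrite lebesgue_measure_itv/= lte_fin; case: ltP => // h;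
      rewrite (_ : b _ - _ = 0)//; apply/eqP; rewrite subr_eq0 eq_le h ab.
  apply/seteqP; split => c /=; rewrite in_itv/=.
    by move=> /(_ ord_max); rewrite snoc_max.
  move=> h i; case: (unliftP ord_max i) => [j|] ->; rewrite ?snoc_lift ?snoc_max//=.
  by move/set_mem : xB; exact.
rewrite mule0 (_ : (fun c => _) = set0) ?measure0//.
apply/seteqP; split => c //= h; apply: xB; apply/mem_set => i.
by have := h (lift ord_max i); rewrite snoc_lift.
Qed.

Lemma measurable_slab n (l : 'rV[R]_n) (r w : R) :
  measurable [set x : 'rV[R]_n | (forall j, `|x ord0 j| <= r) /\ `|dotp l x| <= w].
Proof.
apply: measurableI.
  apply: (@measurable_forall_ord _ 'rV[R]_n _ (fun j x => `|x ord0 j| <= r)) => j.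
  rewrite (_ : (fun _ => _) = (fun x : 'rV[R]_n => x ord0 j : measurableTypeR R) @^-1` `[-r, r]%classic).
    by apply: measurable_preimage; [exact: measurable_coord|exact: measurable_itv].
  by apply/funext => x; rewrite /preimage/= in_itv/= ler_norml.
rewrite (_ : (fun _ => _) = (fun x : 'rV[R]_n => dotp l x : measurableTypeR R) @^-1` `[-w, w]%classic).
  apply: measurable_preimage; last exact: measurable_itv.
  by apply: measurable_dotp; [exact: measurable_cst|exact: measurable_id].
by apply/funext => x; rewrite /preimage/= in_itv/= ler_norml.
Qed.

(* The shear along 'e_i which straightens [dotp l x] into [l_i * x_i] turns the slab into a box. *)
Lemma lebesgueRn_slab_le n (i : 'I_n) (l : 'rV[R]_n) (r w : R) :
  0 <= r -> 0 <= w -> l ord0 i != 0 ->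
  (lebesgueRn R n [set x : 'rV[R]_n | (forall j, (`|x ord0 j| <= r)%R) /\ (`|dotp l x| <= w)%R]
    <= ((2 * r) ^+ n.-1 * (2 * w / `|l ord0 i|))%:E)%E.
Proof.
move=> r0 w0 li0.
pose h (x : 'rV[R]_n) := - (\sum_(j < n | j != i) l ord0 j * x ord0 j) / l ord0 i.
have mh : measurable_fun setT h.
  apply: measurable_funM; last exact: measurable_cst.
  apply: measurableT_comp => //.
  rewrite (_ : (fun x : 'rV[R]_n => _) = fun x : 'rV[R]_n =>
      \sum_(j < n) if j != i then l ord0 j * x ord0 j else 0); last first.
    by apply/funext => x; rewrite big_mkcond.
  apply: measurable_sum => j; case: (j != i); last exact: measurable_cst.
  by apply: measurable_funM; [exact: measurable_cst|exact: measurable_coord].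
have hE x c : h (x + c *: 'e_i) = h x.
  congr (- _ / _); apply: eq_bigr => j ji.
  by rewrite !mxE (negbTE ji) mulr0 addr0.
set S := mkset _.
have mS : measurable S by exact: measurable_slab.
have [mf /(_ _ mS) <-] := preserving_shear mh hE.
pose b (j : 'I_n) := if j == i then w / `|l ord0 i| else r.
have b0 j : 0 <= b j by rewrite /b; case: ifP => // _; rewrite divr_ge0.
apply: (@le_trans _ _ (lebesgueRn R n [set x | forall j, - b j <= x ord0 j <= b j])).
  apply: le_measure; rewrite ?inE.
  - exact: measurable_preimage.
  - exact: measurable_box.
  move=> x [/= xr xw] j; rewrite -ler_norml /b; case: eqP => [->|/eqP ji].
    rewrite ler_pdivlMr ?normr_gt0// -normrM.
    suff -> : x ord0 i * l ord0 i = dotp l (x + h x *: 'e_i) by [].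
    rewrite /dotp (bigD1 i)//= !mxE eqxx mulr1.
    rewrite (eq_bigr (fun j => l ord0 j * x ord0 j)); last first.
      by move=> k ki; rewrite !mxE (negbTE ki) mulr0 addr0.
    by rewrite /h; field.
  by have := xr j; rewrite !mxE (negbTE ji) mulr0 addr0.
rewrite lebesgueRn_box; last by move=> j; rewrite ge0_cp.
rewrite lee_fin (bigD1 i)//= /b eqxx.
rewrite (eq_bigr (fun=> 2 * r)); last by move=> j /negbTE ->; ring.
rewrite prodr_const cardC1 card_ord mulrC.
by rewrite le_eqVlt; apply/orP; left; apply/eqP; congr (_ * _); ring.
Qed.

End Invariance.

(** * The truncated kernels *)

Section Enorm.
Context {R : realType}.

Lemma dotpC n (x y : 'rV[R]_n) : dotp x y = dotp y x.
Proof. by apply: eq_bigr => i _; rewrite mulrC. Qed.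

Lemma dotpDl n (x y z : 'rV[R]_n) : dotp (x + y) z = dotp x z + dotp y z.
Proof. by rewrite -big_split; apply: eq_bigr => i _; rewrite mxE mulrDl. Qed.

Lemma dotpDr n (x y z : 'rV[R]_n) : dotp x (y + z) = dotp x y + dotp x z.
Proof. by rewrite dotpC dotpDl !(dotpC x). Qed.

Lemma dotpZl n c (x z : 'rV[R]_n) : dotp (c *: x) z = c * dotp x z.
Proof. by rewrite /dotp mulr_sumr; apply: eq_bigr => i _; rewrite mxE mulrA. Qed.

Lemma dotpZr n c (x z : 'rV[R]_n) : dotp x (c *: z) = c * dotp x z.
Proof. by rewrite dotpC dotpZl dotpC. Qed.

Lemma dotp_delta n (x : 'rV[R]_n) i : dotp x 'e_i = x ord0 i.
Proof.
rewrite /dotp (bigD1 i)//= mxE !eqxx mulr1 big1 ?addr0// => j ji.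
by rewrite mxE (negbTE ji) mulr0.
Qed.

Lemma dotp_ge0 n (x : 'rV[R]_n) : 0 <= dotp x x.
Proof. by apply: sumr_ge0 => i _; rewrite -expr2 sqr_ge0. Qed.

Lemma enorm_ge0 n (x : 'rV[R]_n) : 0 <= enorm x.
Proof. exact: sqrtr_ge0. Qed.

Lemma enormN n (x : 'rV[R]_n) : enorm (- x) = enorm x.
Proof. by rewrite /enorm -scaleN1r dotpZl dotpZr !mulN1r opprK. Qed.

Lemma sqr_enorm n (x : 'rV[R]_n) : enorm x ^+ 2 = dotp x x.
Proof. by rewrite sqr_sqrtr// dotp_ge0. Qed.

Lemma coord_le_enorm n (x : 'rV[R]_n) i : `|x ord0 i| <= enorm x.
Proof.
rewrite -sqrtr_sqr ler_sqrt ?dotp_ge0// /dotp (bigD1 i)//= -expr2 lerDl.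
by apply: sumr_ge0 => j _; rewrite -expr2 sqr_ge0.
Qed.

Lemma enorm_le_coord n (x : 'rV[R]_n) r : 0 <= r ->
  (forall i, `|x ord0 i| <= r) -> enorm x <= n%:R * r.
Proof.
move=> r0 xr; case: n x xr => [|n] x xr.
  by rewrite /enorm /dotp big_ord0 sqrtr0 mul0r.
rewrite -(@ger0_norm _ (_ * r)) ?mulr_ge0// -sqrtr_sqr ler_sqrt ?sqr_ge0//.
apply: (@le_trans _ _ (\sum_(i < n.+1) r ^+ 2)).
  apply: ler_sum => i _; rewrite -expr2 -real_normK ?num_real//.
  by rewrite lerXn2r ?nnegrE.
rewrite sumr_const card_ord -[leLHS]mulr_natl exprMn ler_wpM2r ?sqr_ge0//.
by rewrite expr2 ler_peMr// ler1n.
Qed.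

Lemma enorm_shift n (x : 'rV[R]_n) i c : enorm (x + c *: 'e_i) <= enorm x + `|c|.
Proof.
rewrite -(@ger0_norm _ (_ + `|c|)) ?addr_ge0 ?enorm_ge0//.
rewrite -sqrtr_sqr ler_sqrt ?sqr_ge0// dotpDl !dotpDr !dotpZl !dotpZr.
rewrite (dotpC 'e_i) !dotp_delta mxE !eqxx/= sqrrD sqr_enorm real_normK ?num_real//.
have : c * x ord0 i <= enorm x * `|c|.
  by rewrite (le_trans (ler_norm _))// normrM mulrC ler_wpM2r// coord_le_enorm.
by rewrite mulr1 mulr2n; lra.
Qed.

Lemma enorm_shift_dist n (x : 'rV[R]_n) i c :
  `|enorm (x + c *: 'e_i) - enorm x| <= `|c|.
Proof.
have := enorm_shift (x + c *: 'e_i) i (- c); have := enorm_shift x i c.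
by rewrite -addrA -scalerDl subrr scale0r addr0 normrN ler_norml; lra.
Qed.

End Enorm.

Section Kernel.
Context {R : realType}.

(** The kernel |x|^(-a), levelled off to a constant in the ball of radius rho. Without a jump at |x|
    = rho, shifts of the argument can be estimated. *)
Definition kern n (a rho : R) (x : 'rV[R]_n) : R := Num.max (enorm x) rho `^ (- a).

(** Convexity of the power: with w = v / u the claim reduces to 1 - a (w - 1) <= w^(-a), which
    follows from exp z >= 1 + z and ln w <= w - 1. *)
Lemma powR_tangent (a u v : R) : 0 <= a -> 0 < u -> u <= v ->
  u `^ (- a) - v `^ (- a) <= a * (v - u) * u `^ (- a - 1).
Proof.
move=> a0 u0 uv; have v0 : 0 < v by exact: lt_le_trans uv.
have vu0 : 0 < v / u by rewrite divr_gt0.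
have -> : v `^ (- a) = u `^ (- a) * (v / u) `^ (- a).
  rewrite -powRM ?(ltW u0) ?(ltW vu0)//; congr (_ `^ _).
  by field; rewrite gt_eqF.
have -> : u `^ (- a - 1) = u `^ (- a) / u.
  by rewrite powRB ?powRr1 ?(ltW u0)// [u == 0]gt_eqF// implybT.
have E : 1 - a * (v / u - 1) <= (v / u) `^ (- a).
  rewrite /powR gt_eqF//; apply: le_trans (expR_ge1Dx _).
  have : ln (v / u) <= v / u - 1.
    by rewrite -{1}(subrK 1 (v / u)) addrC le_ln1Dx//; lra.
  by move/(ler_wpM2l a0); lra.
have U : 0 <= u `^ (- a) by exact: powR_ge0.
have -> : a * (v - u) * (u `^ (- a) / u) = u `^ (- a) * (a * (v / u - 1)).
  by field; rewrite gt_eqF.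
by have := ler_wpM2l U E; lra.
Qed.

Lemma powRN_anti (p q b : R) : 0 < p -> p <= q -> 0 <= b -> q `^ (- b) <= p `^ (- b).
Proof.
move=> p0 pq b0; rewrite !powRN lef_pV2 ?posrE ?powR_gt0//; last exact: lt_le_trans pq.
by apply: ge0_ler_powR; rewrite ?nnegrE// ?ltW// (lt_le_trans p0).
Qed.

Lemma powR_lip (a u v w : R) : 0 <= a -> 0 < w -> w <= u -> w <= v ->
  `|u `^ (- a) - v `^ (- a)| <= a * `|u - v| * w `^ (- a - 1).
Proof.
move=> a0; wlog uv : u v / u <= v.
  by move=> h w0 wu wv; case: (leP u v) => uv; [exact: h|
     rewrite distrC (distrC u); apply: h => //; exact: ltW].
move=> w0 wu wv; have u0 : 0 < u by exact: lt_le_trans wu.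
have v0 := lt_le_trans w0 wv.
rewrite (distrC u) (@ger0_norm _ (v - u)) ?subr_ge0//.
rewrite ger0_norm ?subr_ge0; last exact: powRN_anti.
apply: (le_trans (powR_tangent a0 u0 uv)).
rewrite ler_wpM2l ?mulr_ge0 ?subr_ge0//.
by rewrite -opprD; apply: powRN_anti => //; rewrite addr_ge0.
Qed.

Lemma kern_ge0 n a rho (x : 'rV[R]_n) : 0 <= kern a rho x.
Proof. exact: powR_ge0. Qed.

Lemma kernN n a rho (x : 'rV[R]_n) : kern a rho (- x) = kern a rho x.
Proof. by rewrite /kern enormN. Qed.

Lemma kern_anti n a r1 r2 (x : 'rV[R]_n) : 0 <= a -> 0 < r1 -> r1 <= r2 ->
  kern a r2 x <= kern a r1 x.
Proof.
move=> a0 r10 r12; apply: powRN_anti => //; first by rewrite lt_max r10 orbT.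
by rewrite ge_max !le_max lexx r12 orbT.
Qed.

(** A shift by at most half of max(|x|, rho) leaves at least half of it, so the derivative of the
    power along the way exceeds its value at x by a factor of at most 2^(a+1). *)
Lemma kern_shift n (a rho : R) (x : 'rV[R]_n) i c : 0 <= a -> 0 < rho ->
  `|c| <= Num.max (enorm x) rho / 2 ->
  `|kern a rho (x + c *: 'e_i) - kern a rho x| <=
    a * 2 `^ (a + 1) * `|c| * kern (a + 1) rho x.
Proof.
move=> a0 r0; rewrite /kern; set U := Num.max (enorm x) rho => cU.
set V := Num.max (enorm (x + c *: 'e_i)) rho.
have U0 : 0 < U by rewrite lt_max r0 orbT.
have := enorm_shift_dist x i c; rewrite ler_norml => /andP[d1 d2].
have UV : `|V - U| <= `|c|.
  rewrite ler_norml /U /V; case: (leP (enorm x)) => ?; case: (leP (enorm (x + c *: 'e_i))) => ?; lra.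
have VU : U / 2 <= V.
  by move: UV; rewrite ler_norml; lra.
have -> : - (a + 1) = - a - 1 :> R by lra.
apply: (le_trans (powR_lip a0 (w := U / 2) _ VU _)); [lra|lra|].
rewrite powRM ?(ltW U0)// -(powR_inv1 (ler0n _ 2)) -powRrM.
have -> : -1 * (- a - 1) = a + 1 :> R by lra.
rewrite (mulrC (U `^ _)) !mulrA ler_wpM2r ?powR_ge0//.
by rewrite -!mulrA ler_wpM2l// mulrC ler_wpM2l// powR_ge0.
Qed.

Lemma measurable_kern n a rho : measurable_fun setT (@kern n a rho).
Proof.
apply: (measurableT_comp (measurable_powR (- a))).
by apply: measurable_maxr; [exact: measurable_enorm|exact: measurable_cst].
Qed.

End Kernel.

(** * Dyadic summation of the kernels at the origin and at infinity *)

Section Dyadic.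
Context {R : realType}.
Local Notation mu n := (lebesgueRn R n).

Lemma eball0E n r : eball (0 : 'rV[R]_n) r = [set x | enorm x < r].
Proof. by apply/seteqP; split => x; rewrite /eball/= subr0. Qed.

Lemma measurable_eball0 n r : measurable (eball (0 : 'rV[R]_n) r).
Proof.
rewrite eball0E (_ : mkset _ = (enorm : 'rV[R]_n -> measurableTypeR R) @^-1` `]-oo, r[%classic).
  by apply: measurable_preimage; [exact: measurable_enorm|exact: measurable_itv].
by apply/seteqP; split => x; rewrite /preimage/= in_itv.
Qed.

Lemma lebesgueRn_eball_le n r : 0 <= r ->
  (mu n (eball (0%R : 'rV[R]_n) r) <= ((2 * r) ^+ n)%:E)%E.
Proof.
move=> r0; pose B := [set x : 'rV[R]_n | forall i : 'I_n, - r <= x ord0 i <= r].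
apply: (@le_trans _ _ (mu n B)).
  apply: le_measure; rewrite ?inE; [exact: measurable_eball0|exact: measurable_box|].
  move=> x; rewrite eball0E /= => xr i.
  by rewrite -ler_norml (le_trans (coord_le_enorm x i))// ltW.
have -> : mu n B = (\prod_(i < n) (r - - r))%:E.
  by apply: (@lebesgueRn_box R n (fun=> - r) (fun=> r)) => i; rewrite ge0_cp.
by rewrite prodr_const card_ord lee_fin (_ : r - - r = 2 * r)//; ring.
Qed.

Lemma geometric_bound (G : nat -> \bar R) (A B th : R) :
  0 <= th -> th < 1 -> 0 <= B -> (G 0%N <= A%:E)%E ->
  (forall k, (G k.+1 <= G k + (B * th ^+ k)%:E)%E) ->
  forall k, (G k <= (A + B / (1 - th))%:E)%E.
Proof.
move=> th0 th1 B0 G0 GS k.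
have th1' : 1 - th != 0 by rewrite subr_eq0 eq_sym lt_eqF.
suff H : (G k <= (A + B * (1 - th ^+ k) / (1 - th))%:E)%E.
  apply: (le_trans H); rewrite lee_fin lerD2l ler_pM2r ?invr_gt0 ?subr_gt0//.
  by rewrite ler_piMr// gerBl exprn_ge0.
elim: k => [|k IH]; first by rewrite expr0 subrr mulr0 mul0r addr0.
apply: (le_trans (GS k)); apply: (le_trans (leeD2r _ IH)).
rewrite -EFinD lee_fin exprS le_eqVlt; apply/orP; left; apply/eqP.
by field.
Qed.

Lemma powR_half_lt1 (g : R) : 0 < g -> 2^-1 `^ g < 1.
Proof.
move=> g0; rewrite [ltRHS](_ : 1 = 1 `^ g); last by rewrite powR1.
by apply: gt0_ltr_powR => //; rewrite ?nnegrE ?invr_ge0// invf_lt1// ltr1n.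
Qed.

(* Summation over the dyadic shells [R0/2^(k+1) <= |x| < R0/2^k]. *)
Lemma kern_near_bound n (C al be R0 : R) :
  0 <= C -> 0 <= be -> be < al -> 0 < R0 ->
  exists H : R, 0 <= H /\ forall (V : set 'rV[R]_n) rho,
    measurable V -> 0 < rho -> rho <= R0 ->
    (forall r, 0 < r -> r <= R0 -> (mu n (V `&` eball 0%R r) <= (C * r `^ al)%:E)%E) ->
    (\int[mu n]_(x in V `&` eball 0%R R0) (kern be rho x)%:E <= H%:E)%E.
Proof.
move=> C0 be0 beal R00; pose g := al - be; have g0 : 0 < g by rewrite subr_gt0.
pose th : R := 2^-1 `^ g.
have th0 : 0 <= th by exact: powR_ge0.
have th1 : th < 1 by exact: powR_half_lt1.
pose A := C * R0 `^ g; pose B := C * 2 `^ be * R0 `^ g.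
have A0 : 0 <= A by rewrite mulr_ge0// powR_ge0.
have B0 : 0 <= B by rewrite !mulr_ge0// powR_ge0.
exists (A + B / (1 - th)); split; first by rewrite addr_ge0// divr_ge0// subr_ge0 ltW.
move=> V rho mV rho0 rhoR hV.
have mVB r : measurable (V `&` eball (0 : 'rV[R]_n) r).
  by apply: measurableI => //; exact: measurable_eball0.
pose rr k := R0 / 2 ^+ k.
have rr0 k : 0 < rr k by rewrite divr_gt0// exprn_gt0.
have rrR k : rr k <= R0.
  by rewrite ler_pdivrMr ?exprn_gt0// ler_peMr ?(ltW R00)// exprn_ege1// ler1n.
pose G k := (\int[mu n]_(x in V `&` eball 0%R R0) (kern be (rr k) x)%:E)%E.
have mk r D : measurable_fun D (fun x : 'rV[R]_n => (kern be r x)%:E).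
  by apply: measurable_funTS; apply/measurable_EFinP; exact: measurable_kern.
have HG : forall k, (G k <= (A + B / (1 - th))%:E)%E.
  apply: geometric_bound => //.
    apply: (@le_trans _ _ (\int[mu n]_(x in V `&` eball 0%R R0) (R0 `^ (- be))%:E)%E).
      apply: ge0_le_integral => //.
      - by move=> x _; rewrite lee_fin kern_ge0.
      move=> x _; rewrite lee_fin /rr expr0 divr1 powRN_anti// le_max lexx.
      by rewrite orbT.
    rewrite integral_cst//; apply: (@le_trans _ _ ((R0 `^ (- be))%:E * (C * R0 `^ al)%:E)%E).
      by apply: lee_wpmul2l; [rewrite lee_fin powR_ge0|apply: hV].
    rewrite -EFinM lee_fin /A mulrCA -powRD ?(gt_eqF R00) ?implybT//.
    by rewrite addrC.
  move=> k; rewrite /G.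
  (* Lowering the level from [rr k] to [rr k.+1] changes the kernel only in the ball of radius
     [rr k], where the new value is at most the power -be of [rr k.+1]. *)
  apply: (@le_trans _ _ (\int[mu n]_(x in V `&` eball 0%R R0)
      ((kern be (rr k) x)%:E + (rr k.+1 `^ (- be))%:E * (\1_(V `&` eball 0%R (rr k)) x)%:E))%E).
    have m1 : measurable_fun (V `&` eball (0 : 'rV[R]_n) R0) (fun x => (rr k.+1 `^ (- be))%:E * (\1_(V `&` eball 0%R (rr k)) x)%:E)%E.
      apply: measurable_funTS; apply/measurable_EFinP.
      apply: measurable_funM; first exact: measurable_cst.
      exact: measurable_indic.
    apply: ge0_le_integral => //.
    - by move=> x _; rewrite lee_fin kern_ge0.
    - exact: emeasurable_funD.
    move=> x [Vx _]; rewrite -EFinM -EFinD lee_fin indicE.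
    have rS : rr k.+1 <= rr k.
      by rewrite ler_pM2l// lef_pV2 ?posrE ?exprn_gt0// ler_eXn2l// ltr1n.
    case: (boolP (x \in _)) => [|/negP h].
      rewrite mulr1 => _; apply: (@le_trans _ _ (rr k.+1 `^ (- be))).
        by rewrite powRN_anti// le_max lexx orbT.
      by rewrite lerDr kern_ge0.
    have rx : rr k <= enorm x.
      by rewrite leNgt; apply/negP => xr; apply: h; rewrite inE eball0E.
    by rewrite mulr0 addr0 /kern !max_l// (le_trans rS).
  have m1 : measurable_fun (V `&` eball (0 : 'rV[R]_n) R0) (fun x => (\1_(V `&` eball 0%R (rr k)) x)%:E : \bar R).
    apply: measurable_funTS; apply/measurable_EFinP; exact: measurable_indic.
  rewrite ge0_integralD//; last 3 first.
  - by move=> x _; rewrite lee_fin kern_ge0.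
  - by move=> x _; rewrite -EFinM lee_fin mulr_ge0 ?powR_ge0.
  - by apply: emeasurable_funM => //; exact: measurable_cst.
  rewrite leeD2l// ge0_integralZl//; last by rewrite lee_fin powR_ge0.
  rewrite integral_indic//.
  apply: (@le_trans _ _ ((rr k.+1 `^ (- be))%:E * (C * rr k `^ al)%:E)%E).
    apply: lee_wpmul2l; first by rewrite lee_fin powR_ge0.
    apply: le_trans (hV (rr k) (rr0 k) (rrR k)).
    by apply: le_measure; rewrite ?inE//; exact: measurableI.
  rewrite -EFinM lee_fin.
  have E j : rr j `^ g = R0 `^ g * th ^+ j.
    elim: j => [|j IH]; first by rewrite /rr expr0 divr1 mulr1.
    rewrite exprSr mulrA -IH /th -powRM ?invr_ge0// ?(ltW (rr0 _))//.
    by congr (_ `^ _); rewrite /rr exprSr invfM mulrA.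
  rewrite /B -!mulrA -E mulrCA ler_wpM2l//.
  have -> : rr k.+1 `^ (- be) = 2 `^ be * rr k `^ (- be).
    have -> : rr k.+1 = 2^-1 * rr k by rewrite /rr exprS invfM mulrCA.
    rewrite powRM ?invr_ge0 ?(ltW (rr0 _))//; congr (_ * _).
    by rewrite -(powR_inv1 (ler0n _ 2)) -powRrM mulN1r opprK.
  by rewrite -mulrA -powRD ?(gt_eqF (rr0 _)) ?implybT// addrC.
(* The kernel decreases as its level grows, so any dyadic level below [rho] dominates. *)
have [k rk] : exists k, rr k <= rho.
  have [k hk] := ltr_add_invr (y := 0) (x := rho / R0) (divr_gt0 rho0 R00).
  exists k; rewrite /rr mulrC -ler_pdivlMr//.
  rewrite add0r in hk; rewrite (le_trans _ (ltW hk))//.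
  rewrite lef_pV2 ?posrE ?exprn_gt0// -natrX ler_nat.
  exact: ltn_expl.
apply: le_trans (HG k); apply: ge0_le_integral => //.
- by move=> x _; rewrite lee_fin kern_ge0.
by move=> x _; rewrite lee_fin kern_anti.
Qed.

(** Outward dyadic summation: the ball of radius rho 2^(k+1) has volume of order (rho 2^k)^n, and
    outside the ball of radius rho 2^k the kernel is at most (rho 2^k)^(-a). The shells form a
    geometric series of ratio 2^(n-a), and monotone convergence exhausts the space. *)
Lemma kern_integrable n (a rho : R) : n%:R < a -> 0 < rho ->
  (mu n).-integrable setT (EFin \o @kern R n a rho).
Proof.
move=> na rho0; have a0 : 0 <= a by rewrite (le_trans _ (ltW na))// ler0n.
have mk D : measurable_fun D (fun x : 'rV[R]_n => (kern a rho x)%:E).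
  by apply: measurable_funTS; apply/measurable_EFinP; exact: measurable_kern.
apply/integrableP; split; first exact: mk.
rewrite (eq_integral (fun x => (kern a rho x)%:E)); last first.
  by move=> x _; rewrite /= ger0_norm// kern_ge0.
pose g := a - n%:R; have g0 : 0 < g by rewrite subr_gt0.
pose th : R := 2^-1 `^ g.
have th0 : 0 <= th by exact: powR_ge0.
have th1 : th < 1 by exact: powR_half_lt1.
pose rr k := rho * 2 ^+ k.
have rr0 k : 0 < rr k by rewrite mulr_gt0// exprn_gt0.
pose A := rho `^ (- a) * (2 * rho) ^+ n; pose B := 4 ^+ n * rho `^ (- g).
have B0 : 0 <= B by rewrite !mulr_ge0// ?powR_ge0// exprn_ge0.
pose G k := (\int[mu n]_(x in eball 0%R (rr k)) (kern a rho x)%:E)%E.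
have mB := @measurable_eball0 n.
have HG : forall k, (G k <= (A + B / (1 - th))%:E)%E.
  apply: geometric_bound => //.
    apply: (@le_trans _ _ (\int[mu n]_(x in eball 0%R (rr 0%N)) (rho `^ (- a))%:E)%E).
      apply: ge0_le_integral => //.
      - by move=> x _; rewrite lee_fin kern_ge0.
      by move=> x _; rewrite lee_fin powRN_anti// le_max lexx orbT.
    rewrite integral_cst//; apply: (@le_trans _ _ ((rho `^ (- a))%:E * ((2 * rr 0%N) ^+ n)%:E)%E).
      by apply: lee_wpmul2l; [rewrite lee_fin powR_ge0|apply: lebesgueRn_eball_le; exact: ltW].
    by rewrite -EFinM lee_fin /A /rr expr0 mulr1.
  move=> k; rewrite /G.
  have rS : rr k <= rr k.+1.
    by rewrite ler_pM2l// ler_eXn2l// ltr1n.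
  have m1 D S : measurable S -> measurable_fun D (fun x : 'rV[R]_n => (\1_S x)%:E : \bar R).
    by move=> mS; apply: measurable_funTS; apply/measurable_EFinP; exact: measurable_indic.
  have m2 D c : measurable_fun D (fun x : 'rV[R]_n => c : \bar R) by exact: measurable_cst.
  apply: (@le_trans _ _ (\int[mu n]_(x in eball 0%R (rr k.+1))
      ((kern a rho x)%:E * (\1_(eball 0%R (rr k)) x)%:E + (rr k `^ (- a))%:E))%E).
    apply: ge0_le_integral => //.
    - by move=> x _; rewrite lee_fin kern_ge0.
    - by apply: emeasurable_funD => //; apply: emeasurable_funM => //; exact: m1.
    move=> x _; rewrite -EFinM -EFinD lee_fin indicE.
    case: (boolP (x \in _)) => [|/negP h].
      by rewrite mulr1 => _; rewrite lerDl powR_ge0.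
    have rx : rr k <= enorm x.
      by rewrite leNgt; apply/negP => xr; apply: h; rewrite inE eball0E.
    by rewrite mulr0 add0r powRN_anti// le_max rx.
  rewrite ge0_integralD//; last 3 first.
  - by move=> x _; rewrite -EFinM lee_fin mulr_ge0 ?kern_ge0.
  - by apply: emeasurable_funM => //; exact: m1.
  - by move=> x _; rewrite lee_fin powR_ge0.
  have -> : (\int[mu n]_(x in eball 0%R (rr k.+1))
      ((kern a rho x)%:E * (\1_(eball 0%R (rr k)) x)%:E) = \int[mu n]_(x in eball 0%R (rr k)) (kern a rho x)%:E)%E.
    have -> : eball (0 : 'rV[R]_n) (rr k) = eball 0 (rr k.+1) `&` eball 0 (rr k).
      apply/esym/setIidr; rewrite !eball0E => x /= /lt_le_trans; exact.
    rewrite integral_mkcondr; apply: eq_integral => x /set_mem xk.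
    rewrite patchE indicE in_setI (mem_set xk)/=.
    by case: ifP => _; rewrite ?mule1 ?mule0.
  rewrite leeD2l// integral_cst//.
  apply: (@le_trans _ _ ((rr k `^ (- a))%:E * ((2 * rr k.+1) ^+ n)%:E)%E).
    apply: lee_wpmul2l; first by rewrite lee_fin powR_ge0.
    by apply: lebesgueRn_eball_le; exact: ltW.
  rewrite -EFinM lee_fin.
  have E j : rr j `^ (- g) = rho `^ (- g) * th ^+ j.
    elim: j => [|j IH]; first by rewrite /rr expr0 !mulr1.
    rewrite exprSr mulrA -IH /th.
    have -> : 2^-1 `^ g = 2 `^ (- g) :> R.
      by rewrite -(powR_inv1 (ler0n _ 2)) -powRrM mulN1r.
    rewrite -powRM// ?(ltW (rr0 _))//.
    by congr (_ `^ _); rewrite /rr exprSr mulrA.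
  rewrite /B -!mulrA -E.
  have -> : 2 * rr k.+1 = 4 * rr k by rewrite /rr exprS; ring.
  rewrite exprMn mulrCA ler_wpM2l ?exprn_ge0//.
  by rewrite -powR_mulrn ?(ltW (rr0 _))// -powRD ?(gt_eqF (rr0 _)) ?implybT// /g opprB addrC.
have U : \bigcup_k eball (0 : 'rV[R]_n) (rr k) = setT.
  apply/seteqP; split => // x _.
  have [k hk] : exists k : nat, enorm x / rho < k%:R.
    by exists (Num.bound (enorm x / rho)); apply: archi_boundP; rewrite divr_ge0 ?enorm_ge0 ?ltW.
  exists k => //; rewrite eball0E/= /rr mulrC -ltr_pdivrMr//.
  by rewrite (lt_le_trans hk)// -natrX ler_nat ltnW// ltn_expl.
have nd : nondecreasing_seq (fun k => eball (0 : 'rV[R]_n) (rr k)).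
  move=> i j ij; rewrite subsetEset !eball0E => x /= /lt_le_trans; apply.
  by rewrite ler_pM2l// ler_weXn2l// ler1n.
have cvgG : G k @[k --> \oo] --> (\int[mu n]_x (kern a rho x)%:E)%E.
  rewrite -U; apply: ge0_nondecreasing_set_cvg_integral => //.
  by move=> i x _; rewrite lee_fin kern_ge0.
apply: le_lt_trans (ltry (A + B / (1 - th))).
rewrite -(cvg_lim _ cvgG)//; apply: lime_le; first exact: cvgP cvgG.
exact: nearW.
Qed.

End Dyadic.

(** * Integrals against sides of a set *)

Section Integration.
Context {R : realType} {n : nat}.
Local Notation V := 'rV[R]_n.
Local Notation mu := (lebesgueRn R n).
Local Notation integ f := (mu.-integrable setT (EFin \o (f : V -> R))).
Local Notation mfun f := (measurable_fun setT (f : V -> R)).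

Lemma integ_mfun (f : V -> R) : integ f -> mfun f.
Proof. by move=> /integrableP[/measurable_EFinP]. Qed.

Lemma integ_le (f g : V -> R) : mfun f -> integ g -> (forall x, `|f x| <= g x) -> integ f.
Proof.
move=> mf ig fg; apply: le_integrable ig => //; first exact/measurable_EFinP.
by move=> x _ /=; rewrite lee_fin (le_trans (fg x))// ler_norm.
Qed.

Lemma integD (f g : V -> R) : integ f -> integ g -> integ (fun x => f x + g x).
Proof. exact: integrableD. Qed.

Lemma integB (f g : V -> R) : integ f -> integ g -> integ (fun x => f x - g x).
Proof. exact: integrableB. Qed.

Lemma integZ (c : R) (f : V -> R) : integ f -> integ (fun x => c * f x).
Proof. exact: integrableZl. Qed.

Lemma integ_norm (f : V -> R) : integ f -> integ (fun x => `|f x|).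
Proof. by move=> /integrable_norm. Qed.

Lemma integM (h f : V -> R) : mfun h -> (forall x, `|h x| <= 1) -> integ f ->
  integ (fun x => h x * f x).
Proof.
move=> mh h1 fi; apply: integ_le (integ_norm fi) _.
  by apply: measurable_funM => //; exact: integ_mfun.
by move=> x; rewrite normrM ler_piMl.
Qed.

Lemma integ_preserving T (f : V -> R) : preserving T -> integ f -> integ (fun x => f (T x)).
Proof.
move=> pT /integrableP[mf fi]; have [mT _] := pT; apply/integrableP; split.
  exact: measurableT_comp mf mT.
have := ge0_integral_preserving pT (g := fun x => `|(f x)%:E|%E).
move=> /= ->//.
exact: (measurableT_comp (@abse_measurable R setT) mf).
Qed.

Lemma Rintegral_preserving T (f : V -> R) : preserving T -> integ f ->
  \int[mu]_x f (T x) = \int[mu]_x f x.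
Proof.
move=> pT fi; have [mT pTE] := pT; have fTi := integ_preserving pT fi.
congr fine.
have mf : measurable_fun setT (EFin \o f) by apply/measurable_EFinP; exact: integ_mfun.
rewrite -[LHS](integral_pushforward mT mf fTi measurableT).
by apply: eq_measure_integral => A mA _; exact: pTE.
Qed.

Lemma le_Rint (f g : V -> R) : integ f -> integ g -> (forall x, f x <= g x) ->
  \int[mu]_x f x <= \int[mu]_x g x.
Proof. by move=> fi gi fg; apply: le_Rintegral. Qed.

Lemma norm_Rintegral_le (f g : V -> R) (D : set V) (H : R) :
  integ f -> measurable D -> mfun g -> (forall x, 0 <= g x) ->
  (forall x, D x -> `|f x| <= g x) -> (forall x, ~ D x -> f x = 0) ->
  (\int[mu]_(x in D) (g x)%:E <= H%:E)%E ->
  `|\int[mu]_x f x| <= H.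
Proof.
move=> fi mD mg g0 fg f0 gH; rewrite -lee_fin EFin_normr_Rintegral//.
apply: (@le_trans _ _ (\int[mu]_x `|(f x)%:E|)%E).
  by apply: le_abse_integral => //; apply/measurable_EFinP; exact: integ_mfun.
apply: le_trans gH; rewrite [leRHS]integral_mkcond.
apply: ge0_le_integral => //.
- by apply: measurableT_comp => //; apply/measurable_EFinP; exact: integ_mfun.
- apply/(measurable_restrictT _ mD); apply: measurable_funTS; exact/measurable_EFinP.
move=> x _ /=; rewrite patchE; case: (boolP (x \in D)) => [/set_mem|/negP] xD.
  by rewrite lee_fin fg.
by rewrite f0 ?normr0// => /mem_set.
Qed.

Definition side (E : set V) (x : V) : R := \1_(~` E) x - \1_E x.

Lemma side_in (E : set V) x : E x -> side E x = - 1.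
Proof.
by move=> Ex; rewrite /side !indicE in_setC (mem_set Ex)/= sub0r.
Qed.

Lemma side_out (E : set V) x : ~ E x -> side E x = 1.
Proof.
by move=> Ex; rewrite /side !indicE in_setC (memNset Ex)/= subr0.
Qed.

Lemma norm_side (E : set V) x : `|side E x| <= 1.
Proof.
by case: (pselect (E x)) => h; rewrite ?(side_in h) ?(side_out h) ?normrN normr1.
Qed.

Lemma measurable_side (E : set V) : measurable E -> mfun (side E).
Proof.
move=> mE; apply: measurable_funB; apply: measurable_indic => //.
exact: measurableC.
Qed.

Lemma integ_side (E : set V) (f : V -> R) : measurable E -> integ f -> integ (fun x => side E x * f x).
Proof.
by move=> mE fi; apply: integM => //; [exact: measurable_side|exact: norm_side].
Qed.

(* Outside W the set B and its reflection -B are complementary, so that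
   an even weight only sees the part of B inside W. *)
Lemma side_even_bound (B W : set V) (f g : V -> R) (R0 H : R) :
  measurable B -> measurable W -> integ f -> (forall x, f (- x) = f x) ->
  (forall x, R0 <= enorm x -> f x = 0) ->
  (forall x, enorm x < R0 -> ~ W x -> side B (- x) = - side B x) ->
  mfun g -> (forall x, 0 <= g x) -> (forall x, enorm x < R0 -> `|f x| <= g x) ->
  (\int[mu]_(x in W `&` eball 0%R R0) (g x)%:E <= H%:E)%E ->
  `|\int[mu]_x (side B x * f x)| <= H.
Proof.
move=> mB mW fi fev f0 BW mg g0 fg gH.
have sfi := integ_side mB fi.
have pO := @preserving_opp R n.
have sNi := integ_preserving pO sfi.
have -> : \int[mu]_x (side B x * f x) = \int[mu]_x (2^-1 * (side B x * f x + side B (- x) * f (- x))).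
  rewrite RintegralZl//; last exact: integD.
  rewrite RintegralD// (Rintegral_preserving pO sfi).
  by field.
apply: (@norm_Rintegral_le _ g (W `&` eball 0 R0)) => //.
- by apply: integZ; exact: integD.
- by apply: measurableI => //; exact: measurable_eball0.
- move=> x [_]; rewrite eball0E /= => xR.
  rewrite fev -mulrDl !normrM.
  apply: le_trans (fg x xR); rewrite (@ger0_norm _ 2^-1) ?invr_ge0//.
  have : `|side B x + side B (- x)| <= 2.
    by rewrite (le_trans (ler_normD _ _))// (le_trans (lerD (norm_side _ _) (norm_side _ _))).
  have : 0 <= `|f x| by [].
  by nra.
move=> x /not_andP[Wx|xR]; last first.
  rewrite fev f0 ?mulr0 ?addr0 ?mulr0// leNgt; apply/negP => h; apply: xR.
  by rewrite eball0E.
case: (ltP (enorm x) R0) => xR; last by rewrite fev f0 ?mulr0 ?addr0 ?mulr0.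
by rewrite fev BW// mulNr subrr mulr0.
Qed.

End Integration.

(** * Effect of a shear on the singular part of the kernel *)

Section KernelComparison.
Context {R : realType}.

Lemma kern_mul_enorm n (a rho : R) (x : 'rV[R]_n) : 0 < rho ->
  enorm x * kern (a + 1) rho x <= kern a rho x.
Proof.
move=> r0; have U0 : 0 < Num.max (enorm x) rho by rewrite lt_max r0 orbT.
apply: (@le_trans _ _ (Num.max (enorm x) rho * kern (a + 1) rho x)).
  by rewrite ler_wpM2r ?kern_ge0// le_max lexx.
rewrite /kern -{1}(powRr1 (ltW U0)) -powRD ?(gt_eqF U0) ?implybT//.
by rewrite le_eqVlt; apply/orP; left; apply/eqP; congr (_ `^ _); ring.
Qed.

Lemma kern_eq n (a r1 r2 : R) (x : 'rV[R]_n) : r1 <= enorm x -> r2 <= enorm x ->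
  kern a r1 x = kern a r2 x.
Proof. by move=> h1 h2; rewrite /kern !max_l. Qed.

Lemma integ_sideB n (A B : set 'rV[R]_n) (f : 'rV[R]_n -> R) :
  measurable A -> measurable B -> (lebesgueRn R n).-integrable setT (EFin \o f) ->
  (lebesgueRn R n).-integrable setT (EFin \o (fun x => (side A x - side B x) * f x)).
Proof.
move=> mA mB fi.
rewrite (_ : (fun x => _) = (fun x => side A x * f x - side B x * f x)).
  by apply: integB; exact: integ_side.
by apply/funext => x; rewrite mulrBl.
Qed.

Lemma norm_diff_le (u v u' v' K K' : R) :
  `|u - v| <= K -> `|u' - v'| <= K' -> K' <= K ->
  `|(u - u') - (v - v')| <= 2 * K.
Proof. by rewrite !ler_norml; lra. Qed.

(** The singular part of the kernel, [kern a d] being the tail: for rho <= d it vanishes where |x|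
    >= d. Subtracting the levelled-off tail, rather than cutting at |x| = d, creates no jump, so the
    shift estimate survives. *)
Definition nkern n (a rho d : R) (x : 'rV[R]_n) : R := kern a rho x - kern a d x.

Lemma nkern_ge0 n a rho d (x : 'rV[R]_n) :
  0 <= a -> 0 < rho -> rho <= d -> 0 <= nkern a rho d x.
Proof. by move=> a0 r0 rd; rewrite subr_ge0 kern_anti. Qed.

Lemma nkern_out n a rho d (x : 'rV[R]_n) :
  rho <= d -> d <= enorm x -> nkern a rho d x = 0.
Proof.
move=> rd dx; apply/eqP; rewrite subr_eq0; apply/eqP.
by apply: kern_eq => //; exact: le_trans dx.
Qed.

Lemma nkernN n a rho d (x : 'rV[R]_n) : nkern a rho d (- x) = nkern a rho d x.
Proof. by rewrite /nkern !kernN. Qed.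

Lemma integ_nkern n (a rho d : R) : n%:R < a -> 0 < rho -> rho <= d ->
  (lebesgueRn R n).-integrable setT (EFin \o @nkern n a rho d).
Proof.
move=> na r0 rd; apply: integB; apply: kern_integrable => //.
exact: lt_le_trans rd.
Qed.

Lemma nkern_shift n (a rho d : R) (x : 'rV[R]_n) i c :
  0 <= a -> 0 < rho -> rho <= d -> `|c| <= Num.max (enorm x) rho / 2 ->
  `|nkern a rho d (x + c *: 'e_i) - nkern a rho d x| <=
    2 * (a * 2 `^ (a + 1)) * (`|c| * kern (a + 1) rho x).
Proof.
move=> a0 r0 rd hc; have d0 := lt_le_trans r0 rd.
have h1 := kern_shift i a0 r0 hc.
have hc' : `|c| <= Num.max (enorm x) d / 2.
  by apply: (le_trans hc); rewrite ler_pM2r// ge_max !le_max lexx rd orbT.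
have h2 := kern_shift i a0 d0 hc'.
have h3 : kern (a + 1) d x <= kern (a + 1) rho x.
  by apply: kern_anti => //; rewrite addr_ge0.
rewrite -(mulrA 2) (mulrA (a * _)); apply: norm_diff_le h1 h2 _.
by rewrite ler_wpM2l// !mulr_ge0// powR_ge0.
Qed.

Lemma kern_quarter_shift n (i : 'I_n) (x : 'rV[R]_n) (c : R) :
  `|c| <= 4^-1 * enorm x -> enorm x / 2 <= enorm (x + c *: 'e_i).
Proof.
move=> hc; have := enorm_shift_dist x i c; rewrite ler_norml => /andP[h _].
by have := enorm_ge0 x; lra.
Qed.

Lemma integral_kern_scale n (D : set 'rV[R]_n) (c H be rho : R) : measurable D -> 0 <= c ->
  (\int[lebesgueRn R n]_(x in D) (kern be rho x)%:E <= H%:E)%E ->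
  (\int[lebesgueRn R n]_(x in D) (c * kern be rho x)%:E <= (c * H)%:E)%E.
Proof.
move=> mD c0 hH; under eq_integral do rewrite EFinM.
rewrite ge0_integralZl//.
- by rewrite EFinM; apply: lee_wpmul2l; rewrite ?lee_fin.
- by apply: measurable_funTS; apply/measurable_EFinP; exact: measurable_kern.
- by move=> x _; rewrite lee_fin kern_ge0.
Qed.

Lemma measurable_scale_kern n (c be rho : R) :
  measurable_fun setT (fun x : 'rV[R]_n => c * kern be rho x).
Proof. by apply: measurable_funM; [exact: measurable_cst|exact: measurable_kern]. Qed.

Lemma preserving_linear_shear n (i : 'I_n) (k : R) (l : 'rV[R]_n -> R) :
  measurable_fun setT l -> (forall x c, l (x + c *: 'e_i) = l x) ->
  preserving (fun x => x + (k * l x) *: 'e_i).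
Proof.
move=> ml li; apply: preserving_shear; last by move=> x z; rewrite li.
by apply: measurable_funM => //; exact: measurable_cst.
Qed.

(* The increment of the kernel along the odd linear shear is even in x, so the
   cancellation between x and -x leaves only the thin set W. *)
Lemma near_linear n (i : 'I_n) (a d L H k rho : R) (B W : set 'rV[R]_n) (l : 'rV[R]_n -> R) :
  n%:R < a -> 0 < rho -> rho <= d -> 0 <= L ->
  measurable B -> measurable W -> 0 <= k -> k * L <= 4^-1 ->
  measurable_fun setT l -> (forall x c, l (x + c *: 'e_i) = l x) ->
  (forall x, l (- x) = - l x) -> (forall x, `|l x| <= L * enorm x) ->
  (forall x, enorm x < 2 * d -> ~ W x -> side B (- x) = - side B x) ->
  (\int[lebesgueRn R n]_(x in W `&` eball 0%R (2 * d)) (kern a rho x)%:E <= H%:E)%E ->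
  `|\int[lebesgueRn R n]_x (side B x *
     (nkern a rho d (x + (k * l x) *: 'e_i) - nkern a rho d x))|
   <= 2 * (a * 2 `^ (a + 1)) * (k * L) * H.
Proof.
move=> na r0 rd L0 mB mW k0 kL ml li lN lL BW hH.
have a0 : 0 <= a by rewrite (le_trans _ (ltW na)).
have d0 := lt_le_trans r0 rd.
have Ni := integ_nkern na r0 rd.
have pT := preserving_linear_shear k ml li.
have fi := integB (integ_preserving pT Ni) Ni.
set c := 2 * _ * (k * L).
have c0 : 0 <= c by rewrite /c !mulr_ge0// powR_ge0.
have mWB : measurable (W `&` eball (0 : 'rV[R]_n) (2 * d)).
  by apply: measurableI => //; exact: measurable_eball0.
have kl x : `|k * l x| <= k * L * enorm x.
  by rewrite normrM ger0_norm// -mulrA ler_wpM2l.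
have kl4 x : `|k * l x| <= 4^-1 * enorm x.
  by apply: le_trans (kl x) _; rewrite ler_wpM2r// enorm_ge0.
apply: (side_even_bound (W := W) (R0 := 2 * d) (g := fun x => c * kern a rho x)).
- exact: mB.
- exact: mW.
- exact: fi.
- move=> x; rewrite lN.
  have -> : - x + (k * - l x) *: 'e_i = - (x + (k * l x) *: 'e_i).
    by rewrite mulrN scaleNr opprD.
  by rewrite !nkernN.
(* For |x| >= 2d the sheared point still has norm at least d, so both kernels vanish there; hence
   the radius 2d. *)
- move=> x dx; have h1 : d <= enorm x by clear - dx d0; lra.
  have h2 : d <= enorm (x + (k * l x) *: 'e_i).
    by apply: (le_trans _ (kern_quarter_shift i (kl4 x))); clear - dx; lra.
  by rewrite (nkern_out _ rd h1) (nkern_out _ rd h2) subrr.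
- exact: BW.
- exact: measurable_scale_kern.
- by move=> x; rewrite mulr_ge0// kern_ge0.
- move=> x _.
  have hc : `|k * l x| <= Num.max (enorm x) rho / 2.
    apply: (le_trans (kl4 x)).
    have : enorm x <= Num.max (enorm x) rho by rewrite le_max lexx.
    by have := enorm_ge0 x; clear; lra.
  apply: (le_trans (nkern_shift i a0 r0 rd hc)); rewrite /c -(mulrA _ (k * L)) ler_wpM2l// ?mulr_ge0 ?powR_ge0//.
  apply: (@le_trans _ _ (k * L * (enorm x * kern (a + 1) rho x))).
    by rewrite mulrA ler_wpM2r// kern_ge0.
  by rewrite ler_wpM2l ?mulr_ge0// kern_mul_enorm.
exact: integral_kern_scale.
Qed.

(** A quadratic shift needs no cancellation: it changes the kernel by about k |x|^2 |x|^(-a-1),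
    which the weight [kern (a - 1)] dominates. The bound on k (2d + L) keeps each of the two shifts
    below a quarter of |x| in the ball of radius 2d. *)
Lemma near_quadratic n (i : 'I_n) (a d L H k rho : R) (B : set 'rV[R]_n)
    (q l : 'rV[R]_n -> R) :
  n%:R < a -> 0 < rho -> rho <= d -> 0 <= L ->
  measurable B -> 0 <= k -> k * (2 * d + L) <= 4^-1 ->
  measurable_fun setT q -> measurable_fun setT l ->
  (forall x c, q (x + c *: 'e_i) = q x) -> (forall x c, l (x + c *: 'e_i) = l x) ->
  (forall x, `|l x| <= L * enorm x) -> (forall x, `|q x| <= enorm x ^+ 2) ->
  (\int[lebesgueRn R n]_(x in eball 0%R (2 * d)) (kern (a - 1) rho x)%:E <= H%:E)%E ->
  `|\int[lebesgueRn R n]_x (side B x *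
     (nkern a rho d (x + (k * (q x + l x)) *: 'e_i) -
      nkern a rho d (x + (k * l x) *: 'e_i)))|
   <= 2 * (a * 2 `^ (a + 1)) * 2 `^ (a + 1) * k * H.
Proof.
move=> na r0 rd L0 mB k0 kd mq ml qi li lL qL hH.
have a0 : 0 <= a by rewrite (le_trans _ (ltW na)).
have d0 := lt_le_trans r0 rd.
have k2d : k * (2 * d) <= 4^-1.
  by apply: le_trans kd; rewrite ler_wpM2l// lerDl.
have kL : k * L <= 4^-1.
  by apply: le_trans kd; rewrite ler_wpM2l// lerDr mulr_ge0// ltW.
have Ni := integ_nkern na r0 rd.
have pT := preserving_linear_shear k ml li.
have pS : preserving (fun x => x + (k * (q x + l x)) *: 'e_i).
  apply: (@preserving_linear_shear _ i k (fun x => q x + l x)); first exact: measurable_funD.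
  by move=> x c; rewrite qi li.
have fi := integ_side mB (integB (integ_preserving pS Ni) (integ_preserving pT Ni)).
set c := 2 * _; set p2 := 2 `^ (a + 1).
have c0 : 0 <= c by rewrite /c !mulr_ge0// powR_ge0.
have p20 : 0 <= p2 by exact: powR_ge0.
have kl4 x : `|k * l x| <= 4^-1 * enorm x.
  rewrite normrM ger0_norm//; apply: le_trans (ler_wpM2l k0 (lL x)) _.
  by rewrite mulrA ler_wpM2r// enorm_ge0.
apply: (norm_Rintegral_le (D := eball 0 (2 * d)) (g := fun x => c * p2 * k * kern (a - 1) rho x)).
- exact: fi.
- exact: measurable_eball0.
- exact: measurable_scale_kern.
- by move=> x; rewrite !mulr_ge0// kern_ge0.
- move=> x; rewrite eball0E /= => xd.
  have e0 := enorm_ge0 x.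
  rewrite normrM; set y := x + (k * l x) *: 'e_i.
  have -> : x + (k * (q x + l x)) *: 'e_i = y + (k * q x) *: 'e_i.
    by rewrite /y mulrDr scalerDl -addrA (addrC (k * q x *: _)).
  apply: (@le_trans _ _ (1 * `|nkern a rho d (y + (k * q x) *: 'e_i) - nkern a rho d y|)).
    by rewrite ler_wpM2r// norm_side.
  have kq : `|k * q x| <= k * (enorm x ^+ 2).
    by rewrite normrM ger0_norm// ler_wpM2l.
  have kq' : k * (enorm x ^+ 2) <= 4^-1 * enorm x.
    rewrite expr2 mulrA ler_wpM2r//; apply: le_trans k2d.
    by rewrite ler_wpM2l// ltW.
  have Tx : enorm x / 2 <= enorm y by exact: kern_quarter_shift.
  have hc : `|k * q x| <= Num.max (enorm y) rho / 2.
    apply: (le_trans kq); apply: (le_trans kq').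
    have : enorm y <= Num.max (enorm y) rho by rewrite le_max lexx.
    by clear - Tx; lra.
  rewrite mul1r; apply: (le_trans (nkern_shift i a0 r0 rd hc)).
  (* The linear shear at most halves the norm, whence the second factor 2^(a+1). *)
  have kT : kern (a + 1) rho y <= p2 * kern (a + 1) rho x.
    have U0 : 0 < Num.max (enorm x) rho by rewrite lt_max r0 orbT.
    have a10 : 0 <= a + 1 by rewrite addr_ge0.
    apply: (@le_trans _ _ ((2^-1 * Num.max (enorm x) rho) `^ (- (a + 1)))).
      apply: powRN_anti => //; first by rewrite mulr_gt0// invr_gt0.
      rewrite mulrC ler_pdivrMr// ge_max; apply/andP; split.
        by rewrite -ler_pdivrMr// le_max Tx.
      rewrite -ler_pdivrMr// le_max; apply/orP; right.
      by clear - r0; lra.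
    rewrite powRM ?(ltW U0) ?invr_ge0// -(powR_inv1 (ler0n _ 2)) -powRrM.
    by rewrite mulN1r opprK.
  have kk : enorm x ^+ 2 * kern (a + 1) rho x <= kern (a - 1) rho x.
    rewrite expr2 -mulrA; apply: le_trans (ler_wpM2l e0 (kern_mul_enorm a x r0)) _.
    by have := kern_mul_enorm (a - 1) x r0; rewrite subrK.
  rewrite -!(mulrA c) ler_wpM2l//.
  apply: (@le_trans _ _ (k * enorm x ^+ 2 * (p2 * kern (a + 1) rho x))).
    by apply: ler_pM => //; rewrite kern_ge0.
  rewrite (_ : _ * _ = p2 * k * (enorm x ^+ 2 * kern (a + 1) rho x)).
    by rewrite ler_wpM2l// mulr_ge0.
  by move: (enorm x ^+ 2) (kern _ _ _) => u v; clear; ring.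
- move=> x nx; rewrite [X in _ * X](_ : _ = 0) ?mulr0//.
  have xd : 2 * d <= enorm x.
    by rewrite leNgt; apply/negP => h; apply: nx; rewrite eball0E.
  have e0 := enorm_ge0 x.
  have h2 : d <= enorm (x + (k * l x) *: 'e_i).
    by apply: (le_trans _ (kern_quarter_shift i (kl4 x))); clear - xd; lra.
  rewrite (nkern_out _ rd h2) nkern_out ?subrr//.
  (* [q] and [l] take the same values at [x] and at its image [y]. *)
  set y := x + _; rewrite leNgt; apply/negP => yd.
  have qS : q y = q x by rewrite qi.
  have lS : l y = l x by rewrite li.
  have y0 := enorm_ge0 y.
  have hk : `|k * (q x + l x)| <= 4^-1 * d.
    rewrite -qS -lS normrM ger0_norm//.
    apply: (@le_trans _ _ (k * (enorm y ^+ 2 + L * enorm y))).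
      by rewrite ler_wpM2l// (le_trans (ler_normD _ _))// lerD.
    apply: (@le_trans _ _ (k * (d * d + L * d))).
      by rewrite ler_wpM2l// expr2 lerD// ?ler_pM// ?ltW// ler_wpM2l// ltW.
    rewrite -mulrDl mulrA ler_wpM2r ?(ltW d0)//.
    by apply: le_trans kd; rewrite ler_wpM2l// lerD2r; clear - d0; lra.
  have := enorm_shift_dist x i (k * (q x + l x)); rewrite -/y ler_norml => /andP[h _].
  by clear - h hk xd yd d0; lra.
by apply: integral_kern_scale => //; [exact: measurable_eball0|rewrite !mulr_ge0].
Qed.

(** Near the origin A lies in the sheared copy [SB] of B, and enlarging a set only lowers its
    [side]; so A may be replaced by [SB]. The shear preserves volume and moves onto the kernel,
    where its linear and quadratic parts are treated separately. [H] is uniform in the sets, in k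
    and in rho because a < n + 1 makes both dominating integrals bounded at the origin. *)
Lemma near_estimate n (i : 'I_n) (a d C L : R) :
  n%:R < a -> a < n%:R + 1 -> 0 < d -> 0 <= C -> 0 <= L ->
  exists H : R, 0 <= H /\ forall (A B W : set 'rV[R]_n) (k : R) (q l : 'rV[R]_n -> R) (rho : R),
    measurable A -> measurable B -> measurable W ->
    0 <= k -> k * (2 * d + L) <= 4^-1 -> 0 < rho -> rho <= d ->
    measurable_fun setT q -> measurable_fun setT l ->
    (forall x c, q (x + c *: 'e_i) = q x) ->
    (forall x c, l (x + c *: 'e_i) = l x) ->
    (forall x, l (- x) = - l x) ->
    (forall x, `|l x| <= L * enorm x) -> (forall x, `|q x| <= enorm x ^+ 2) ->
    (forall r, 0 < r -> r <= 2 * d ->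
      (lebesgueRn R n (W `&` eball 0%R r) <= (C * r `^ (n%:R + 1))%:E)%E) ->
    (forall x, enorm x < 2 * d -> ~ W x -> side B (- x) = - side B x) ->
    (forall x, enorm x < d -> A x -> B (x - (k * (q x + l x)) *: 'e_i)) ->
    - (H * k) <=
      \int[lebesgueRn R n]_x ((side A x - side B x) * nkern a rho d x).
Proof.
move=> na an d0 C0 L0.
have n1 : 1 <= n%:R :> R by rewrite ler1n; case: n i {na an} => [[]|].
have a1 : 1 <= a by exact: le_trans (ltW na).
have a0 : 0 <= a by exact: le_trans a1.
have d20 : 0 < 2 * d by rewrite mulr_gt0.
have [H1 [H10 hH1]] := @kern_near_bound R n C (n%:R + 1) a (2 * d) C0 a0 an d20.
(* The volume of a ball is at most 2^n r^n, and a - 1 < n. *)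
have [|||H2 [H20 hH2]] := @kern_near_bound R n (2 ^+ n) n%:R (a - 1) (2 * d) _ _ _ d20.
- by rewrite exprn_ge0.
- by rewrite subr_ge0.
- by rewrite ltrBlDr.
pose c := 2 * (a * 2 `^ (a + 1)).
have c0 : 0 <= c by rewrite /c !mulr_ge0// powR_ge0.
pose c' := c * 2 `^ (a + 1).
have c'0 : 0 <= c' by rewrite mulr_ge0// powR_ge0.
exists (c * L * H1 + c' * H2); split; first by rewrite addr_ge0// !mulr_ge0.
move=> A B W k q l rho mA mB mW k0 kd r0 rd mq ml qi li lN lL qL hW BW AB.
have Ni := integ_nkern na r0 rd.
have kL : k * L <= 4^-1.
  by apply: le_trans kd; rewrite ler_wpM2l// lerDr ltW.
have r2d : rho <= 2 * d by apply: (le_trans rd); clear - d0; lra.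
have B1 := near_linear na r0 rd L0 mB mW k0 kL ml li lN lL BW
  (hH1 W rho mW r0 r2d hW).
have hB : (\int[lebesgueRn R n]_(x in eball 0%R (2 * d)) (kern (a - 1) rho x)%:E <= H2%:E)%E.
  rewrite -[eball _ _]setTI; apply: hH2 => // r r0' _; rewrite setTI.
  apply: le_trans (lebesgueRn_eball_le n (ltW r0')) _.
  by rewrite lee_fin exprMn powR_mulrn// ltW.
have B2 := near_quadratic na r0 rd L0 mB k0 kd mq ml qi li lL qL hB.
pose eta (x : 'rV[R]_n) := k * (q x + l x).
have etai x z : eta (x + z *: 'e_i) = eta x by rewrite /eta qi li.
have meta : measurable_fun setT eta.
  by apply: measurable_funM; [exact: measurable_cst|exact: measurable_funD].
pose S (x : 'rV[R]_n) := x - eta x *: 'e_i.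
have pS' := preserving_shear meta etai.
have mS : measurable_fun setT S.
  apply: measurable_addrow; first exact: measurable_id.
  under eq_fun do rewrite -scaleNr.
  by apply: measurable_scalerow; exact: measurableT_comp.
have SS' x : S (x + eta x *: 'e_i) = x by rewrite /S etai addrK.
pose SB := S @^-1` B.
have mSB : measurable SB by exact: measurable_preimage.
have sSB x : side SB x = side B (S x).
  by case: (pselect (SB x)) => h; [rewrite !side_in|rewrite !side_out].
have pT := preserving_linear_shear k ml li.
have NS' := integ_preserving pS' Ni; have NT := integ_preserving pT Ni.
set N := nkern a rho d in Ni NS' NT B1 B2 *.
have step1 : \int[lebesgueRn R n]_x ((side SB x - side B x) * N x) <=
   \int[lebesgueRn R n]_x ((side A x - side B x) * N x).
  apply: le_Rint => [||x]; try exact: integ_sideB.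
  case: (ltP (enorm x) d) => dx; last by rewrite /N nkern_out// !mulr0.
  rewrite ler_wpM2r ?nkern_ge0// lerD2r.
  case: (pselect (A x)) => Ax; last first.
    by rewrite [leRHS]side_out// (le_trans (ler_norm _))// norm_side.
  by rewrite (side_in Ax) side_in//; exact: AB.
apply: le_trans step1.
have i1 := integ_side mSB Ni; have i2 := integ_side mB Ni.
have i1' := integ_preserving pS' i1.
have i3 := integ_side mB (integB NT Ni).
have i4 := integ_side mB (integB NS' NT).
(* The substitution x + eta(x) e_i turns [SB] back into B; the increment of the kernel is then split
   at the linear shear. *)
have -> : \int[lebesgueRn R n]_x ((side SB x - side B x) * N x) =
  \int[lebesgueRn R n]_x (side B x * (N (x + (k * l x) *: 'e_i) - N x)) +
  \int[lebesgueRn R n]_x (side B x * (N (x + eta x *: 'e_i) - N (x + (k * l x) *: 'e_i))).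
  rewrite -(RintegralD measurableT i3 i4).
  under eq_Rintegral do rewrite mulrBl.
  rewrite (RintegralB measurableT i1 i2) -(Rintegral_preserving pS' i1).
  rewrite -(RintegralB measurableT i1' i2).
  apply: eq_Rintegral => x _; rewrite sSB SS'.
  move: (side B x) (N _) (N (x + (k * l x) *: _)) (N x) => b1 b2 b3 b4; clear.
  by ring.
have cE : (c * L * H1 + c' * H2) * k =
    2 * (a * 2 `^ (a + 1)) * (k * L) * H1 + 2 * (a * 2 `^ (a + 1)) * 2 `^ (a + 1) * k * H2.
  by rewrite /c' /c; move: (2 `^ (a + 1)) => p2; clear; ring.
have lb (u v : R) : `|u| <= v -> - v <= u by rewrite ler_norml => /andP[].
rewrite cE opprD; apply: lerD; [exact: lb B1|exact: lb B2].
Qed.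

End KernelComparison.

(** * The tail of the kernel, and the principal value in terms of the levelled-off kernel *)

Section Truncation.
Context {R : realType} {n : nat}.
Local Notation mu := (lebesgueRn R n).
Local Notation integ f := (mu.-integrable setT (EFin \o (f : 'rV[R]_n -> R))).

(** Only the kernel is shifted, so E need only be measurable: the increment of the tail is at most a
    constant times |h| [kern (a + 1) d], which is at most [kern a d] divided by d, and the latter is
    integrable. *)
Lemma far_estimate (i : 'I_n) (a d : R) : n%:R < a -> 0 < d ->
  exists H : R, 0 <= H /\ forall (E : set 'rV[R]_n) p h,
    measurable E -> `|h| <= d / 2 ->
    `|\int[mu]_x (side E x * (kern a d (x - p + h *: 'e_i) - kern a d (x - p)))| <= H * `|h|.
Proof.
move=> na d0; have a0 : 0 <= a by rewrite (le_trans _ (ltW na)).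
have ki := @kern_integrable R n a d na d0.
pose K := \int[mu]_x kern a d x.
have K0 : 0 <= K by apply: Rintegral_ge0 => x _; exact: kern_ge0.
exists (a * 2 `^ (a + 1) / d * K); split.
  by rewrite mulr_ge0// divr_ge0 ?(ltW d0)// mulr_ge0// powR_ge0.
move=> E p h mE hd.
have pp := @preserving_translation R n (- p).
have pph := @preserving_translation R n (- p + h *: 'e_i).
have k1 := integ_preserving pp ki.
have k2 : integ (fun x => kern a d (x - p + h *: 'e_i)).
  rewrite (_ : (fun x => _) = (fun x => kern a d (x + (- p + h *: 'e_i)))).
    exact: integ_preserving pph ki.
  by apply/funext => x; rewrite addrA.
have ii : integ (fun x => side E x * (kern a d (x - p + h *: 'e_i) - kern a d (x - p))).
  by apply: integ_side => //; exact: integB.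
apply: (le_trans (le_normr_Rintegral _ ii)) => //.
rewrite /K -(Rintegral_preserving pp ki) mulrAC -(RintegralZl _ measurableT k1).
apply: le_Rint => [||x]; [exact: integ_norm|exact: integZ|].
rewrite normrM; set y := x - p.
apply: (@le_trans _ _ (1 * `|kern a d (y + h *: 'e_i) - kern a d y|)).
  by rewrite ler_wpM2r// norm_side.
rewrite mul1r; apply: le_trans (kern_shift i a0 d0 _) _.
  by apply: (le_trans hd); rewrite ler_pM2r// le_max lexx orbT.
rewrite -!mulrA ler_wpM2l// ler_wpM2l ?powR_ge0// mulrCA ler_wpM2l//.
rewrite mulrC ler_pdivlMr//.
have U0 : 0 < Num.max (enorm y) d by rewrite lt_max d0 orbT.
apply: (@le_trans _ _ (kern (a + 1) d y * Num.max (enorm y) d)).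
  by rewrite ler_wpM2l ?kern_ge0// le_max lexx orbT.
rewrite /kern -{2}(powRr1 (ltW U0)) -powRD ?(gt_eqF U0) ?implybT//.
by rewrite le_eqVlt; apply/orP; left; apply/eqP; congr (_ `^ _); ring.
Qed.

(** The kernel as [truncated_nmc] cuts it: zero in the ball where [kern] is constant. *)
Definition okern (a rho : R) (x : 'rV[R]_n) : R :=
  if enorm x < rho then 0 else kern a rho x.

Lemma okernE (a rho : R) x :
  okern a rho x = kern a rho x - rho `^ (- a) * \1_(eball 0 rho) x.
Proof.
rewrite /okern indicE; case: ltP => xr.
  rewrite mem_set ?eball0E//= mulr1 /kern max_r ?subrr//; exact: ltW.
by rewrite memNset ?mulr0 ?subr0// eball0E /= ltNge xr.
Qed.

Lemma integ_ball (rho : R) : 0 < rho -> integ (\1_(eball 0 rho) : 'rV[R]_n -> R).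
Proof.
move=> r0; have mB := @measurable_eball0 R n rho.
apply/integrableP; split; first by apply/measurable_EFinP; exact: measurable_indic.
rewrite (eq_integral (fun x => (\1_(eball 0 rho) x)%:E)); last first.
  by move=> x _; rewrite /= ger0_norm.
rewrite integral_indic// setIT.
exact: le_lt_trans (lebesgueRn_eball_le n (ltW r0)) (ltry _).
Qed.

Lemma integ_okern (a rho : R) : n%:R < a -> 0 < rho -> integ (okern a rho).
Proof.
move=> na r0; rewrite (_ : okern a rho = fun x => kern a rho x - rho `^ (- a) * \1_(eball 0 rho) x).
  by apply: integB; [exact: kern_integrable|apply: integZ; exact: integ_ball].
by apply/funext => x; rewrite okernE.
Qed.

Definition centered (E : set 'rV[R]_n) (p : 'rV[R]_n) : set 'rV[R]_n :=
  [set x | E (x + p)].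

Lemma measurable_centered E p : measurable E -> measurable (centered E p).
Proof.
move=> mE; apply: (measurable_preimage (f := fun x : 'rV[R]_n => x + p)) => //.
by have [] := @preserving_translation R n p.
Qed.

Lemma side_centered (E : set 'rV[R]_n) p x : side (centered E p) x = side E (x + p).
Proof.
by case: (pselect (E (x + p))) => h; [rewrite !side_in|rewrite !side_out].
Qed.

Lemma truncated_nmcE (s : R) (E : set 'rV[R]_n) p rho : 0 < s -> measurable E -> 0 < rho ->
  truncated_nmc s E p rho =
  (\int[mu]_x (side (centered E p) x * okern (n%:R + 2 * s) rho x))%:E.
Proof.
move=> s0 mE r0; set B := centered E p.
pose a := n%:R + 2 * s; have na : n%:R < a by rewrite ltrDl mulr_gt0.
have mB : measurable B by exact: measurable_centered.
have ii := integ_side mB (integ_okern na r0).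
have pp := @preserving_translation R n (- p).
have ii' := integ_preserving pp ii.
rewrite -(Rintegral_preserving pp ii) /Rintegral fineK; last exact: integrable_fin_num.
rewrite /truncated_nmc [LHS]integral_mkcond.
apply: eq_integral => x _.
rewrite patchE /okern.
have -> : side B (x - p) = side E x.
  by rewrite side_centered subrK.
case: ifPn => [/set_mem xp|].
  have xr : rho <= enorm (x - p) by rewrite leNgt; apply/negP.
  by rewrite ltNge xr /= /kern max_l// powRN.
rewrite notin_setE => /contrapT; rewrite /eball /= => ->.
by rewrite mulr0.
Qed.

(* The ball of radius [rho] contributes only [O(rho^(n+1-a))] to the levelled-off
   integral, since there B is balanced up to the thin layer W. *)
Lemma has_nmc_kern (s C R0 : R) (E W : set 'rV[R]_n) p :
  0 < s -> s < 1 / 2 -> measurable E -> measurable W -> 0 <= C -> 0 < R0 ->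
  has_nmc s E p 0 ->
  (forall r, 0 < r -> r <= R0 ->
      (mu (W `&` eball 0%R r) <= (C * r `^ (n%:R + 1))%:E)%E) ->
  (forall x, enorm x < R0 -> ~ W x ->
     side (centered E p) (- x) = - side (centered E p) x) ->
  forall e, 0 < e -> \forall rho \near (0 : R)^'+,
    `|\int[mu]_x (side (centered E p) x * kern (n%:R + 2 * s) rho x)| < e.
Proof.
move=> s0 s12 mE mW C0 R00 Enmc hW; set B := centered E p => BW e e0.
pose a := n%:R + 2 * s; have na : n%:R < a by rewrite ltrDl mulr_gt0.
have mB : measurable B by exact: measurable_centered.
(* This is n + 1 - a, positive because s < 1/2. *)
pose g := 1 - 2 * s; have g0 : 0 < g by rewrite /g; lra.
have e20 : 0 < e / 2 by rewrite divr_gt0.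
have cv : truncated_nmc s E p rho @[rho --> (0:R)^'+] --> (0 : R)%:E by [].
have H1 : \forall rho \near (0 : R)^'+, `|\int[mu]_x (side B x * okern a rho x)| < e / 2.
  have /fine_cvgP[_ /cvgrPdist_lt/(_ _ e20) cv'] := cv.
  near=> rho; have r0 : 0 < rho by near: rho; exact: nbhs_right_gt.
  have : `|0 - fine (truncated_nmc s E p rho)| < e / 2 by near: rho.
  by rewrite truncated_nmcE//= sub0r normrN.
have H2 : \forall rho \near (0 : R)^'+, C * rho `^ g < e / 2.
  pose z := e / 2 / (C + 1).
  have C1 : 0 < C + 1 by rewrite ltr_wpDl.
  have z0 : 0 < z by rewrite divr_gt0.
  have w0 : 0 < z `^ g^-1 by rewrite powR_gt0.
  near=> rho; have r0 : 0 < rho by near: rho; exact: nbhs_right_gt.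
  have rz : rho < z `^ g^-1 by near: rho; exact: nbhs_right_lt.
  have : rho `^ g < z.
    have -> : z = (z `^ g^-1) `^ g by rewrite -powRrM mulVf ?gt_eqF// powRr1 ?ltW.
    by apply: gt0_ltr_powR => //; rewrite nnegrE ltW.
  rewrite /z ltr_pdivlMr// mulrC; apply: le_lt_trans.
  by rewrite ler_wpM2r ?powR_ge0// lerDl.
near=> rho.
have r0 : 0 < rho by near: rho; exact: nbhs_right_gt.
have rR : rho <= R0 by near: rho; exact: nbhs_right_le.
have K1 : `|\int[mu]_x (side B x * okern a rho x)| < e / 2 by near: rho.
have K2 : C * rho `^ g < e / 2 by near: rho.
have bi := integ_ball r0.
pose f2 (x : 'rV[R]_n) := rho `^ (- a) * \1_(eball 0 rho) x.
have f2i : integ f2 by exact: integZ.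
have -> : \int[mu]_x (side B x * kern a rho x) =
    \int[mu]_x (side B x * okern a rho x) + \int[mu]_x (side B x * f2 x).
  rewrite -RintegralD//; try by apply: integ_side => //; exact: integ_okern.
  by apply: eq_Rintegral => x _; rewrite okernE /f2; ring.
have K3 : `|\int[mu]_x (side B x * f2 x)| <= C * rho `^ g.
  have mg : measurable_fun setT (fun _ : 'rV[R]_n => rho `^ (- a)) by exact: measurable_cst.
  apply: (@side_even_bound _ _ B W f2 (fun _ => rho `^ (- a)) rho) => //.
  - by move=> x; rewrite /f2 !indicE !eball0E; congr (_ * (_ : bool)%:R);
      apply/idP/idP; rewrite !inE /= enormN.
  - by move=> x xr; rewrite /f2 indicE memNset ?mulr0// eball0E /= ltNge xr.
  - by move=> x xr; apply: BW; exact: lt_le_trans rR.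
  - move=> x; exact: powR_ge0.
  - by move=> x xr; rewrite /f2 indicE mem_set ?eball0E//= mulr1 ger0_norm// powR_ge0.
  rewrite integral_cst; last by apply: measurableI => //; exact: measurable_eball0.
  apply: (@le_trans _ _ ((rho `^ (- a))%:E * (C * rho `^ (n%:R + 1))%:E)%E).
    apply: lee_wpmul2l; first by rewrite lee_fin powR_ge0.
    exact: hW.
  rewrite -EFinM lee_fin mulrCA ler_wpM2l// -powRD ?(gt_eqF r0) ?implybT//.
  by rewrite le_eqVlt; apply/orP; left; apply/eqP; congr (_ `^ _); rewrite /a /g; ring.
apply: (le_lt_trans (ler_normD _ _)); lra.
Unshelve. all: end_near.
Qed.

End Truncation.

(** * Local structure of a C^2 boundary *)

Section SupNorm.
Context {R : realType}.

Lemma coord_le_norm n (x : 'rV[R]_n) i : `|x ord0 i| <= `|x|.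
Proof.
rewrite [leRHS]/Num.norm /= mx_normrE; apply/bigmax_geP; right.
by exists (ord0, i).
Qed.

Lemma norm_le_coord n (x : 'rV[R]_n) r : 0 <= r -> (forall i, `|x ord0 i| <= r) -> `|x| <= r.
Proof.
move=> r0 h; rewrite [leLHS]/Num.norm /= mx_normrE; apply/bigmax_leP; split => //.
by move=> [j i] _ /=; rewrite (ord1 j).
Qed.

Lemma norm_le_enorm n (x : 'rV[R]_n) : `|x| <= enorm x.
Proof. by apply: norm_le_coord; [exact: enorm_ge0|move=> i; exact: coord_le_enorm]. Qed.

Lemma enorm_le_norm n (x : 'rV[R]_n) : enorm x <= n%:R * `|x|.
Proof. by apply: enorm_le_coord => // i; exact: coord_le_norm. Qed.

Lemma dotp_le_norm n (x y : 'rV[R]_n) : `|dotp x y| <= n%:R * (`|x| * `|y|).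
Proof.
apply: (le_trans (ler_norm_sum _ _ _)).
apply: (@le_trans _ _ (\sum_(i < n) `|x| * `|y|)).
  by apply: ler_sum => i _; rewrite normrM ler_pM ?coord_le_norm.
by rewrite sumr_const card_ord [leRHS]mulr_natl.
Qed.

End SupNorm.

(** * Lipschitz and Taylor estimates from bounds on partial derivatives *)

Section Taylor.
Context {R : realType}.

Lemma is_derive_line (V : normedModType R) (f : V -> R) (w v : V) (t : R) :
  derivable f (w + t *: v) v ->
  is_derive t 1 (fun t => f (w + t *: v)) ('D_v f (w + t *: v)).
Proof.
move=> df.
have E : (fun h : R => h^-1 *: (f (w + (h *: 1 + t) *: v) - f (w + t *: v))) =
   (fun h : R => h^-1 *: (f (h *: v + (w + t *: v)) - f (w + t *: v))).
  apply/funext => h; congr (_ *: (f _ - _)).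
  by rewrite scalerDl [h *: 1]mulr1 addrCA.
apply: DeriveDef; first by rewrite /derivable /= E.
by rewrite /derive /= E.
Qed.

Definition between0 (c t : R) := (0 <= t <= c) || (c <= t <= 0).

Lemma between0_norm c t : between0 c t -> `|t| <= `|c|.
Proof.
case/orP => /andP[h1 h2].
  by rewrite !ger0_norm// (le_trans h1).
by rewrite !ler0_norm ?lerN2// (le_trans h1).
Qed.

Lemma line_MVT (V : normedModType R) (f : V -> R) (w v : V) (c : R) :
  (forall t, between0 c t -> derivable f (w + t *: v) v) ->
  exists2 t, between0 c t & f (w + c *: v) - f w = c * 'D_v f (w + t *: v).
Proof.
move=> df; pose F t := f (w + t *: v).
have dF t : between0 c t -> is_derive t 1 F ('D_v f (w + t *: v)).
  by move=> tc; apply: is_derive_line; exact: df.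
have cF (a b : R) : (forall t, a <= t <= b -> between0 c t) -> {within `[a, b], continuous F}.
  move=> h; apply: continuous_in_subspaceT => t; rewrite inE/= in_itv/= => tab.
  have [dt _] := dF _ (h t tab).
  by apply: differentiable_continuous; apply/derivable1_diffP.
have F0 : f w = F 0 by rewrite /F scale0r addr0.
case: (leP 0 c) => c0.
  have ci t : 0 <= t <= c -> between0 c t by move=> h; apply/orP; left.
  have [||t] := @MVT_segment R F (fun t => 'D_v f (w + t *: v)) 0 c c0.
  - by move=> t; rewrite in_itv/= => /andP[/ltW t0 /ltW tc]; apply: dF; apply: ci; rewrite t0.
  - exact: cF.
  rewrite in_itv/= => /ci tc E; exists t => //.
  by rewrite F0 -[f _]/(F c) E subr0 mulrC.
have ci t : c <= t <= 0 -> between0 c t by move=> h; apply/orP; right.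
have [||t] := @MVT_segment R F (fun t => 'D_v f (w + t *: v)) c 0 (ltW c0).
- by move=> t; rewrite in_itv/= => /andP[/ltW t0 /ltW tc]; apply: dF; apply: ci; rewrite t0.
- exact: cF.
rewrite in_itv/= => /ci tc E; exists t => //.
by rewrite F0 -[f _]/(F c) -[LHS]opprB E sub0r mulrN opprK mulrC.
Qed.

(** A staircase from y to z changing one coordinate at a time, so that the mean value theorem is
    applied along coordinate axes only and partial derivatives suffice. *)
Definition mixrow m (y z : 'rV[R]_m) (k : nat) : 'rV[R]_m :=
  \row_j if (j < k)%N then z ord0 j else y ord0 j.

Lemma mixrowS m (y z : 'rV[R]_m) (k : 'I_m) :
  mixrow y z k.+1 = mixrow y z k + (z ord0 k - y ord0 k) *: 'e_k.
Proof.
apply/rowP => j; rewrite !mxE eqxx /= ltnS leq_eqVlt.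
case: (eqVneq j k) => [->|jk]; first by rewrite eqxx ltnn mulr1 addrC subrK.
by rewrite mulr0 addr0 -[j == k :> nat]/(j == k) (negbTE jk).
Qed.

Lemma mixrow_telescope m (f : 'rV[R]_m -> R) (y z : 'rV[R]_m) :
  f z - f y = \sum_(k < m) (f (mixrow y z k.+1) - f (mixrow y z k)).
Proof.
rewrite -(big_mkord xpredT (fun k => f (mixrow y z k.+1) - f (mixrow y z k))).
rewrite telescope_sumr//; congr (f _ - f _); apply/rowP => j; rewrite mxE//.
by rewrite ltn_ord.
Qed.

Lemma norm_between (y z t r : R) : between0 (z - y) t ->
  `|y| <= r -> `|z| <= r -> `|y + t| <= r.
Proof. by rewrite !ler_norml /between0 => /orP[] /andP[]; lra. Qed.

Lemma mixrow_segment m (y z : 'rV[R]_m) (k : 'I_m) (t r : R) :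
  between0 (z ord0 k - y ord0 k) t -> `|y| <= r -> `|z| <= r ->
  `|mixrow y z k + t *: 'e_k| <= r.
Proof.
move=> tb yr zr; have r0 : 0 <= r by exact: le_trans yr.
have yc j : `|y ord0 j| <= r by apply: le_trans yr; exact: coord_le_norm.
have zc j : `|z ord0 j| <= r by apply: le_trans zr; exact: coord_le_norm.
apply: norm_le_coord => // j; rewrite !mxE eqxx /=.
case: (eqVneq j k) => [->|jk]; first by rewrite ltnn mulr1; exact: norm_between tb _ _.
by rewrite mulr0 addr0; case: ifP.
Qed.

Lemma mixrow_dist m (y z : 'rV[R]_m) (k : 'I_m) (t : R) :
  between0 (z ord0 k - y ord0 k) t -> `|mixrow y z k + t *: 'e_k - y| <= `|z - y|.
Proof.
move=> tb; apply: norm_le_coord => // j; rewrite !mxE eqxx /=.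
have := coord_le_norm (z - y) j; rewrite !mxE => zy.
case: (eqVneq j k) => [jk|jk].
  rewrite jk ltnn mulr1 addrAC subrr add0r; rewrite jk in zy.
  exact: le_trans (between0_norm tb) zy.
by rewrite mulr0 addr0; case: ifP => _ //; rewrite subrr normr0.
Qed.

Lemma lipschitz_of_partials m (f : 'rV[R]_m -> R) (r M : R) (y z : 'rV[R]_m) :
  (forall x, `|x| <= r -> forall i, derivable f x 'e_i /\ `|'D_'e_i f x| <= M) ->
  `|y| <= r -> `|z| <= r -> `|f z - f y| <= m%:R * (M * `|z - y|).
Proof.
move=> hf yr zr; rewrite mixrow_telescope.
apply: (le_trans (ler_norm_sum _ _ _)).
apply: (@le_trans _ _ (\sum_(k < m) M * `|z - y|)); last first.
  by rewrite sumr_const card_ord [leRHS]mulr_natl.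
apply: ler_sum => k _; rewrite mixrowS.
have [t tb|t tb ->] := @line_MVT _ f (mixrow y z k) 'e_k (z ord0 k - y ord0 k).
  by have [] := hf _ (mixrow_segment tb yr zr) k.
have [_ hM] := hf _ (mixrow_segment tb yr zr) k.
rewrite normrM mulrC ler_pM//.
by have := coord_le_norm (z - y) k; rewrite !mxE.
Qed.

(** On each step of the staircase the mean value theorem yields a partial derivative at an
    intermediate point; the bound on second partials puts it within m M |z - y| of the one at y. The
    other factor m counts the steps. *)
Lemma taylor_of_partials m (f : 'rV[R]_m -> R) (r M : R) (y z : 'rV[R]_m) :
  (forall x, `|x| <= r -> forall i, derivable f x 'e_i /\
     forall j, derivable ('D_'e_i f) x 'e_j /\ `|'D_'e_j ('D_'e_i f) x| <= M) ->
  0 <= M -> `|y| <= r -> `|z| <= r ->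
  `|f z - f y - dotp (\row_i 'D_'e_i f y) (z - y)| <= m%:R * (m%:R * M * `|z - y| ^+ 2).
Proof.
move=> hf M0 yr zr; rewrite mixrow_telescope /dotp -sumrB.
apply: (le_trans (ler_norm_sum _ _ _)).
apply: (@le_trans _ _ (\sum_(k < m) m%:R * M * `|z - y| ^+ 2)); last first.
  by rewrite sumr_const card_ord [leRHS]mulr_natl.
apply: ler_sum => k _; rewrite mixrowS !mxE.
have [t tb|t tb ->] := @line_MVT _ f (mixrow y z k) 'e_k (z ord0 k - y ord0 k).
  by have [] := hf _ (mixrow_segment tb yr zr) k.
set x := mixrow y z k + t *: 'e_k.
have xr : `|x| <= r by exact: mixrow_segment.
have L : `|'D_'e_k f x - 'D_'e_k f y| <= m%:R * (M * `|x - y|).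
  apply: (@lipschitz_of_partials m ('D_'e_k f) r M y x _ yr xr) => w wr i.
  by have [_ h] := hf w wr k; exact: h.
have xy : `|x - y| <= `|z - y| by exact: mixrow_dist.
rewrite (mulrC ('D_'e_k f y)) -mulrBr normrM.
have c0 : `|z ord0 k - y ord0 k| <= `|z - y|.
  by have := coord_le_norm (z - y) k; rewrite !mxE.
apply: (@le_trans _ _ (`|z - y| * (m%:R * (M * `|z - y|)))).
  by apply: ler_pM => //; apply: (le_trans L); rewrite ler_wpM2l// ler_wpM2l.
by rewrite expr2 le_eqVlt; apply/orP; left; apply/eqP; ring.
Qed.

End Taylor.

Section Rotations.
Context {R : realType}.

Lemma dotpE n (x y : 'rV[R]_n) : dotp x y = (x *m y^T) ord0 ord0.
Proof. by rewrite mxE; apply: eq_bigr => i _; rewrite mxE. Qed.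

Lemma dotp_mulmx n (Q : 'M[R]_n) (x y : 'rV[R]_n) : dotp (x *m Q) y = dotp x (y *m Q^T).
Proof. by rewrite !dotpE trmx_mul trmxK mulmxA. Qed.

Lemma enorm_orthogonal n (Q : 'M[R]_n) (x : 'rV[R]_n) :
  Q *m Q^T = 1%:M -> enorm (x *m Q) = enorm x.
Proof. by move=> QQ; rewrite /enorm dotp_mulmx -mulmxA QQ mulmx1. Qed.

Lemma dotp_initc n (x y : 'rV[R]_n.+1) :
  dotp x y = dotp (initc x) (initc y) + lastc x * lastc y.
Proof.
rewrite /dotp big_ord_recr /=; congr (_ + _); apply: eq_bigr => i _.
rewrite !mxE; suff -> : widen_ord (leqnSn n) i = lift ord_max i by [].
by apply/val_inj; rewrite /= /bump leqNgt ltn_ord.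
Qed.

Lemma dotpNl n (x y : 'rV[R]_n) : dotp (- x) y = - dotp x y.
Proof. by rewrite -scaleN1r dotpZl mulN1r. Qed.

Lemma dotpBl n (x y z : 'rV[R]_n) : dotp (x - y) z = dotp x z - dotp y z.
Proof. by rewrite dotpDl dotpNl. Qed.

Lemma initcD n (x y : 'rV[R]_n.+1) : initc (x + y) = initc x + initc y.
Proof. by apply/rowP => i; rewrite !mxE. Qed.

Lemma initcN n (x : 'rV[R]_n.+1) : initc (- x) = - initc x.
Proof. by apply/rowP => i; rewrite !mxE. Qed.

Lemma initcZ n c (x : 'rV[R]_n.+1) : initc (c *: x) = c *: initc x.
Proof. by apply/rowP => i; rewrite !mxE. Qed.

Lemma lastcD n (x y : 'rV[R]_n.+1) : lastc (x + y) = lastc x + lastc y.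
Proof. by rewrite /lastc mxE. Qed.

Lemma lastcN n (x : 'rV[R]_n.+1) : lastc (- x) = - lastc x.
Proof. by rewrite /lastc mxE. Qed.

Lemma lastcZ n c (x : 'rV[R]_n.+1) : lastc (c *: x) = c * lastc x.
Proof. by rewrite /lastc mxE. Qed.

Lemma norm_initc_le n (x : 'rV[R]_n.+1) : `|initc x| <= `|x|.
Proof. by apply: norm_le_coord => // i; rewrite mxE coord_le_norm. Qed.

End Rotations.

(** * Defining functions of the boundary *)

Section LocalGraph.
Context {R : realType}.

(* Phi plays the role of x_n - g(x') in rotated coordinates and D of its gradient;
   C^2 enters only through these C^{1,1} bounds, and v is the rotated e_n. *)
Definition defining_function n (E : set 'rV[R]_n) (p : 'rV[R]_n)
    (Phi : 'rV[R]_n -> R) (D : 'rV[R]_n -> 'rV[R]_n) (r0 K : R) : Prop :=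
  [/\ forall x, `|x - p| <= r0 -> (E x <-> Phi x < 0),
      forall x y, `|x - p| <= r0 -> `|y - p| <= r0 ->
        `|Phi y - Phi x - dotp (D x) (y - x)| <= K * `|y - x| ^+ 2,
      forall x y v, `|x - p| <= r0 -> `|y - p| <= r0 ->
        `|dotp (D x - D y) v| <= K * (`|x - y| * `|v|) &
      exists v, forall x s, `|x - p| <= r0 -> `|x + s *: v - p| <= r0 ->
        Phi (x + s *: v) = Phi x + s].

(** The gradient at x is that at p up to K r0, and the quadratic remainder is at most 2 K r0 |y - x|
    since |y - x| <= 2 r0; together they give the 3 K r0. *)
Lemma defining_lipschitz n (E : set 'rV[R]_n) p Phi D r0 K :
  0 < K -> 0 < r0 -> defining_function E p Phi D r0 K ->
  exists2 L, 0 < L & forall x y, `|x - p| <= r0 -> `|y - p| <= r0 ->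
    `|Phi y - Phi x| <= L * `|y - x|.
Proof.
move=> K0 r00 [_ h2 h3 _]; exists (n%:R * `|D p| + 3 * K * r0).
  by rewrite ltr_wpDl ?mulr_ge0// !mulr_gt0.
move=> x y xr yr; have pr : `|p - p| <= r0 by rewrite subrr normr0 ltW.
have T := h2 x y xr yr; have G := h3 x p (y - x) xr pr.
have dd := dotp_le_norm (D p) (y - x).
have yx : `|y - x| <= 2 * r0.
  rewrite -(subrKA p) mulr2n mulrDl !mul1r (le_trans (ler_normD _ _))// lerD//.
  by rewrite distrC.
have xy0 : 0 <= `|y - x| by [].
have E1 : dotp (D x) (y - x) = dotp (D x - D p) (y - x) + dotp (D p) (y - x).
  by rewrite dotpBl subrK.
rewrite E1 in T; move: T G dd yx xy0 xr.
move: (dotp (D x - D p) _) (dotp (D p) _) (Phi y - Phi x) (`|y - x|) (`|x - p|) (`|D p|) => a b c d e f.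
move=> T G dd yx xy0 xr.
have G' : `|a| <= K * (r0 * d).
  by apply: (le_trans G); rewrite ler_wpM2l ?(ltW K0)// ler_wpM2r.
have T' : `|c - (a + b)| <= K * (2 * r0 * d).
  by apply: (le_trans T); rewrite ler_wpM2l ?(ltW K0)// expr2 ler_wpM2r.
have -> : (n%:R * f + 3 * K * r0) * d = n%:R * (f * d) + K * (r0 * d) + K * (2 * r0 * d).
  by clear; ring.
have -> : c = b + a + (c - (a + b)) by clear; ring.
apply: (le_trans (ler_normD _ _)); apply: lerD => //.
by apply: (le_trans (ler_normD _ _)); apply: lerD.
Qed.

(** [Phi] is the signed height over the graph of the chart, and its bounds are those of g carried
    over by an isometry. The tangency clause takes the zero set of [Phi] being in the boundary as a
    hypothesis, since [boundary_definingP] derives that from the defining function itself. *)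
Lemma chart_defining_function m (E : set 'rV[R]_m.+1) p (Q : 'M[R]_m.+1) (g : 'rV[R]_m -> R) r M :
  0 < r -> 0 < M ->
  Q *m Q^T = 1%:M -> C2_on (eball 0 r) g -> C2_norm_le (eball 0 r) g M ->
  (rigid Q p @` E) `&` eball 0 r = subgraph g `&` eball 0 r ->
  exists Phi D r0 K, [/\ 0 < r0, 0 < K, defining_function E p Phi D r0 K &
    (forall x, `|x - p| < r0 -> Phi x = 0 -> boundary E x) ->
    Phi p = 0 -> forall w, dotp (D p) w = 0 -> tangent (boundary E) p w].
Proof.
move=> r0 M0 QQ gC2 gM Eg.
have QQ' : Q^T *m Q = 1%:M by exact: mulmx1C.
pose n : R := m.+1%:R; have n1 : 1 <= n by rewrite ler1n.
have n0 : 0 < n by exact: lt_le_trans n1.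
have mn : m%:R <= n by rewrite ler_nat.
(* Each of the two radii loses a factor of the dimension in passing between the sup norm and the
   Euclidean norm. *)
pose r1 := r / (2 * n); have r10 : 0 < r1 by rewrite divr_gt0// mulr_gt0.
have nr1 : n * r1 = r / 2 by rewrite /r1; field; rewrite gt_eqF.
pose rr := r1 / n; have rr0 : 0 < rr by rewrite divr_gt0.
pose Y (x : 'rV[R]_m.+1) := initc ((x - p) *m Q).
pose Phi (x : 'rV[R]_m.+1) := lastc ((x - p) *m Q) - g (Y x).
pose G (y : 'rV[R]_m) : 'rV[R]_m := \row_i 'D_'e_i g y.
have GE y i : G y ord0 i = 'D_'e_i g y by rewrite mxE.
(* The gradient of [Phi]: the upward normal (-grad g, 1) rotated back. *)
pose D (x : 'rV[R]_m.+1) : 'rV[R]_m.+1 := snoc (- G (Y x), 1) *m Q^T.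
have DE (x v : 'rV[R]_m.+1) : dotp (D x) v = lastc (v *m Q) - dotp (G (Y x)) (initc (v *m Q)).
  rewrite /D dotp_mulmx trmxK dotp_initc initc_snoc lastc_snoc/= mul1r addrC.
  by rewrite dotpNl.
have vQ (v : 'rV[R]_m.+1) : `|initc (v *m Q)| <= n * `|v|.
  apply: (le_trans (norm_initc_le _)); apply: (le_trans (norm_le_enorm _)).
  by rewrite enorm_orthogonal// enorm_le_norm.
have YB (x y : 'rV[R]_m.+1) : Y x - Y y = initc ((x - y) *m Q).
  by rewrite /Y -initcN -initcD -mulNmx -mulmxDl opprB addrA subrK.
have LB (x y : 'rV[R]_m.+1) :
    lastc ((x - p) *m Q) - lastc ((y - p) *m Q) = lastc ((x - y) *m Q).
  by rewrite -lastcN -lastcD -mulNmx -mulmxDl opprB addrA subrK.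
have YBn (x y : 'rV[R]_m.+1) : `|Y x - Y y| <= n * `|x - y| by rewrite YB.
have Yr (x : 'rV[R]_m.+1) : `|x - p| <= rr -> `|Y x| <= r1.
  move=> xr; apply: (le_trans (vQ _)).
  by rewrite -ler_pdivlMl// mulrC.
have ballr1 (y : 'rV[R]_m) : `|y| <= r1 -> eball 0 r y.
  move=> yr; rewrite /eball/= subr0; apply: (le_lt_trans (enorm_le_norm y)).
  have : m%:R * `|y| <= n * r1 by apply: ler_pM.
  by move/le_lt_trans; apply; rewrite nr1 ltr_pdivrMr// ltr_pMr// ltr1n.
have hp (y : 'rV[R]_m) : `|y| <= r1 -> forall i, derivable g y 'e_i /\
    forall j, derivable ('D_'e_i g) y 'e_j /\ `|'D_'e_j ('D_'e_i g) y| <= M.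
  move=> yr i; have yb := ballr1 y yr; have [_ /(_ i)[d1 _ d2]] := gC2 y yb.
  split; first exact: d1.
  move=> j; have [d3 _] := d2 j; split; first exact: d3.
  by have [_ /(_ i)[_ /(_ j)]] := gM y yb.
(* The summand 1 keeps K positive, m = 0 included. *)
pose K := m%:R * (m%:R * M) * n ^+ 2 + 1.
have K0 : 0 < K by rewrite ltr_wpDl// !mulr_ge0// ?exprn_ge0// ltW.
have rn : n * rr = r1 by rewrite /rr mulrC divfK// gt_eqF.
exists Phi, D, rr, K; split => //; first split.
- move=> x xr.
  have xe : eball 0 r ((x - p) *m Q).
    rewrite /eball/= subr0 enorm_orthogonal//; apply: (le_lt_trans (enorm_le_norm _)).
    apply: (@le_lt_trans _ _ (n * rr)); first by rewrite ler_wpM2l// ltW.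
    rewrite rn; apply: (@le_lt_trans _ _ (n * r1)); last by rewrite nr1 ltr_pdivrMr// ltr_pMr// ltr1n.
    by rewrite ler_peMl// ltW.
  have <- : subgraph g ((x - p) *m Q) <-> Phi x < 0 by rewrite /subgraph/= subr_lt0.
  split=> h.
    have : (rigid Q p @` E `&` eball 0 r) ((x - p) *m Q) by split => //; exists x.
    by rewrite Eg => -[].
  have : (subgraph g `&` eball 0 r) ((x - p) *m Q) by split.
  rewrite -Eg => -[[z Ez] /(congr1 (mulmx^~ Q^T))].
  rewrite /rigid/= -!mulmxA QQ !mulmx1 => /addIr <- //.
- move=> x y xr yr.
  have := taylor_of_partials hp (ltW M0) (Yr _ xr) (Yr _ yr).
  rewrite -/(G _) => T.
  have -> : Phi y - Phi x - dotp (D x) (y - x) =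
      - (g (Y y) - g (Y x) - dotp (G (Y x)) (Y y - Y x)).
    rewrite DE -YB -LB /Phi.
    by move: (lastc _) (lastc _) (g _) (g _) (dotp _ _) => b c d e f; clear; ring.
  rewrite normrN; apply: (le_trans T).
  apply: (@le_trans _ _ (m%:R * (m%:R * M * (n * `|y - x|) ^+ 2))).
    rewrite ler_wpM2l// ler_wpM2l// ?mulr_ge0// ?(ltW M0)//.
    by rewrite lerXn2r// nnegrE// mulr_ge0// ltW.
  have : 0 <= `|y - x| ^+ 2 by rewrite exprn_ge0.
  by rewrite /K exprMn; move: (`|y - x| ^+ 2) => z z0; lra.
- move=> x y v xr yr.
  have -> : dotp (D x - D y) v = dotp (G (Y y) - G (Y x)) (initc (v *m Q)).
    etransitivity; first exact: dotpBl.
    etransitivity; first exact: (f_equal2 (fun a b => a - b) (DE x v) (DE y v)).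
    etransitivity; last by symmetry; exact: dotpBl.
    by move: (lastc _) (dotp _ _) (dotp _ _) => a b c; clear; ring.
  apply: (le_trans (dotp_le_norm _ _)).
  have : `|G (Y y) - G (Y x)| <= m%:R * (M * `|Y y - Y x|).
    apply: norm_le_coord => [|i]; first by rewrite !mulr_ge0// ltW.
    rewrite mxE [X in _ + X]mxE (GE (Y y)) (GE (Y x)).
    apply: (@lipschitz_of_partials R m ('D_'e_i g) r1 M (Y x) (Y y) _ (Yr _ xr) (Yr _ yr)).
    by move=> w wr j; have [_ h] := hp w wr i; exact: h.
  move=> hG; apply: (@le_trans _ _ (m%:R * (m%:R * (M * (n * `|x - y|)) * (n * `|v|)))).
    rewrite ler_wpM2l//; apply: ler_pM => //; apply: (le_trans hG).
    by rewrite ler_wpM2l// ler_wpM2l ?(ltW M0)// distrC.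
  have : 0 <= `|x - y| * `|v| by rewrite mulr_ge0.
  rewrite (_ : m%:R * _ = m%:R * (m%:R * M) * n ^+ 2 * (`|x - y| * `|v|)); last by ring.
  by rewrite /K; move: (`|x - y| * `|v|) => z z0; lra.
- exists (snoc (0, 1) *m Q^T) => x s _ _.
  have E1 : (x + s *: (snoc (0, 1) *m Q^T) - p) *m Q = (x - p) *m Q + s *: snoc (0, 1).
    by rewrite addrAC mulmxDl -scalemxAl -mulmxA QQ' mulmx1.
  rewrite /Phi /Y E1 lastcD lastcZ lastc_snoc mulr1 initcD initcZ initc_snoc/= scaler0 addr0.
  by rewrite addrAC.
move=> Bd Pp w Dw.
have Yp : Y p = 0 by rewrite /Y subrr mul0mx; apply/rowP => i; rewrite !mxE.
pose y' := initc (w *m Q).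
have wE : w *m Q = snoc (y', dotp (G 0) y').
  rewrite -[LHS]snocK; congr (snoc (_, _)).
  by move: Dw; rewrite DE Yp => /eqP; rewrite subr_eq0 => /eqP.
have g0 : g 0 = 0.
  by move: Pp; rewrite /Phi Yp subrr mul0mx /lastc mxE sub0r => /eqP; rewrite oppr_eq0 => /eqP.
(* Orthogonality to [D p] says that the rotated w is (y', grad g(0) . y'), which is the velocity at
   0 of the line t y' lifted to the graph. *)
pose gam t := p + snoc (t *: y', g (t *: y')) *m Q^T.
have gamQ t : (gam t - p) *m Q = snoc (t *: y', g (t *: y')).
  by rewrite /gam addrAC subrr add0r -mulmxA QQ' mulmx1.
have s0 : snoc (0 : 'rV[R]_m, 0 : R) = 0.
  by apply/rowP => i; case: (unliftP ord_max i) => [j|] ->; rewrite ?snoc_lift ?snoc_max !mxE.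
have gam0 : gam 0 = p by rewrite /gam scale0r g0 s0 mul0mx addr0.
have T t : `|t *: y'| <= r1 -> `|g (t *: y') - t * dotp (G 0) y'| <= K * `|t *: y'| ^+ 2.
  move=> tr.
  have := taylor_of_partials hp (ltW M0) (_ : `|0| <= r1) tr.
  rewrite normr0 => /(_ (ltW r10)); rewrite g0 !subr0 dotpZr => h.
  apply: (le_trans h); have : 0 <= `|t *: y'| ^+ 2 by rewrite exprn_ge0.
  have : m%:R * (m%:R * M) <= m%:R * (m%:R * M) * n ^+ 2.
    by rewrite ler_peMr ?mulr_ge0 ?(ltW M0)// exprn_ege1.
  by rewrite /K; move: (`|t *: y'| ^+ 2) => z; nra.
exists gam; split => //.
  have near_gam : \forall t \near (0 : R), `|gam t - p| < rr.
    pose A := dotp (G 0) y'; pose C := `|y'| + `|A| + K * `|y'| ^+ 2 + 1.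
    have C0 : 0 < C by rewrite ltr_wpDl// !addr_ge0// mulr_ge0 ?exprn_ge0// ltW.
    near=> t.
    have t1 : `|t| < 1 by near: t; apply: (@nbhs0_lt R R^o).
    have tr : `|t| < r1 / C by near: t; apply: (@nbhs0_lt R R^o); rewrite divr_gt0.
    have trr : `|t| < rr / n / C by near: t; apply: (@nbhs0_lt R R^o); rewrite divr_gt0// divr_gt0.
    have ty : `|t *: y'| = `|t| * `|y'| by rewrite normrZ.
    have yC : `|t| * `|y'| <= `|t| * C.
      rewrite ler_wpM2l// /C -!addrA lerDl !addr_ge0// mulr_ge0 ?exprn_ge0//.
      exact: ltW.
    have tyr : `|t *: y'| <= r1.
      rewrite ty (le_trans yC)//; move: tr; rewrite ltr_pdivlMr//; exact: ltW.
    have gt : `|g (t *: y')| <= `|t| * C.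
      have -> : g (t *: y') = t * A + (g (t *: y') - t * A) by rewrite addrC subrK.
      apply: (le_trans (ler_normD _ _)).
      have := T t tyr; rewrite -/A ty exprMn => Tt.
      have : `|t| ^+ 2 <= `|t| by rewrite expr2 ler_piMl// ltW.
      have : `|t * A| = `|t| * `|A| by rewrite normrM.
      have : 0 <= K * `|y'| ^+ 2 by rewrite mulr_ge0 ?exprn_ge0// ltW.
      have : 0 <= `|y'| by [].
      have : 0 <= `|t| by [].
      move: Tt; rewrite /C; move: (`|_ - _|) (`|t * A|) (`|t| ^+ 2) (`|y'| ^+ 2) => u1 u2 u3 u4.
      by move: (`|t|) (`|y'|) (`|A|) => v1 v2 v3; clear; nra.
    rewrite (le_lt_trans (norm_le_enorm _))// -(enorm_orthogonal _ QQ) gamQ.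
    apply: (le_lt_trans (enorm_le_norm _)); rewrite mulrC -ltr_pdivlMr//.
    apply: (@le_lt_trans _ _ (`|t| * C)); last by rewrite -ltr_pdivlMr.
    apply: norm_le_coord => [|i]; first by rewrite mulr_ge0// ltW.
    case: (unliftP ord_max i) => [j|] ->; rewrite ?snoc_lift ?snoc_max//=.
    by rewrite (le_trans (coord_le_norm _ _))// ty.
  near=> t; apply: Bd; first by near: t.
  by rewrite /Phi /Y gamQ lastc_snoc initc_snoc subrr.
have F : (fun h : R => h^-1 *: (gam (h *: 1 + 0) - gam 0)) h @[h --> 0^'] --> w.
  apply/cvgrPdist_le => e e0.
  pose C := K * `|y'| ^+ 2 + 1.
  have KC : 0 <= K * `|y'| ^+ 2 by rewrite mulr_ge0 ?exprn_ge0// ltW.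
  have C0 : 0 < C by rewrite ltr_wpDl.
  near=> h.
  have h0 : h != 0 by near: h; exact: nbhs_dnbhs_neq.
  have hr : `|h| < r1 / (`|y'| + 1) by near: h; apply: (@dnbhs0_lt R R^o); rewrite divr_gt0// ltr_wpDl.
  have he : `|h| < e / C by near: h; apply: (@dnbhs0_lt R R^o); rewrite divr_gt0.
  have hy : `|h *: y'| <= r1.
    rewrite normrZ; move: hr; rewrite ltr_pdivlMr ?ltr_wpDl// => /ltW; apply: le_trans.
    by rewrite ler_wpM2l// lerDl.
  have Th := T h hy.
  have wE' : w = snoc (y', dotp (G 0) y') *m Q^T by rewrite -wE -mulmxA QQ mulmx1.
  pose c := dotp (G 0) y' - h^-1 * g (h *: y').
  have -> : w - h^-1 *: (gam (h *: 1 + 0) - gam 0) = snoc (0, c) *m Q^T.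
    rewrite addr0 [h *: 1]mulr1 gam0 /gam addrAC subrr add0r scalemxAl wE' -mulmxBl.
    congr (_ *m _); apply/rowP => i; rewrite mxE [X in _ + X]mxE [X in - X]mxE.
    case: (unliftP ord_max i) => [j|] ->; rewrite ?snoc_lift ?snoc_max//= !mxE.
    by rewrite mulrA mulVf// mul1r subrr.
  apply: (le_trans (norm_le_enorm _)).
  rewrite enorm_orthogonal ?trmxK//.
  have -> : enorm (snoc (0 : 'rV[R]_m, c)) = `|c|.
    rewrite /enorm dotp_initc initc_snoc lastc_snoc /= -expr2 -sqrtr_sqr.
    by congr Num.sqrt; rewrite -(scale0r 0) dotpZl mul0r add0r.
  have hc : `|h| * `|c| <= K * (`|h| ^+ 2 * `|y'| ^+ 2).
    rewrite -normrM -exprMn -normrZ; apply: le_trans Th.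
    by rewrite distrC /c mulrBr mulrA mulfV// mul1r.
  have hp0 : 0 < `|h| by rewrite normr_gt0.
  have : `|c| <= K * `|y'| ^+ 2 * `|h|.
    rewrite -(ler_pM2l hp0); apply: (le_trans hc).
    by rewrite expr2 le_eqVlt; apply/orP; left; apply/eqP; ring.
  move/le_trans; apply.
  move: he; rewrite ltr_pdivlMr// => /ltW; apply: le_trans.
  by rewrite mulrC ler_wpM2l// lerDl.
apply: DeriveDef; first by apply/cvg_ex; exists w.
exact: cvg_lim F.
Unshelve. all: end_near.
Qed.

End LocalGraph.

Section BoundaryNearPoint.
Context {R : realType}.

Lemma nbhs_row_norm n (x : 'rV[R]_n) (A : set 'rV[R]_n) :
  nbhs x A <-> exists2 e, 0 < e & forall y, `|y - x| < e -> A y.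
Proof.
split => [/nbhs_ballP[e e0 h]|[e e0 h]].
  by exists e => // y yx; apply: h; rewrite -ball_normE /= distrC.
apply/nbhs_ballP; exists e => // y; rewrite -ball_normE /= distrC; exact: h.
Qed.

Lemma lipschitz_continuous (f : R -> R) (L : R) : 0 < L ->
  (forall x y, `|f y - f x| <= L * `|y - x|) -> continuous f.
Proof.
move=> L0 fL x; apply/cvgrPdist_lt => e e0; near=> y.
have : `|x - y| < e / L by near: y; apply: cvgr_dist_lt => //; exact: divr_gt0.
by rewrite ltr_pdivlMr// mulrC; apply: le_lt_trans; rewrite distrC (distrC x).
Unshelve. all: end_near.
Qed.

Lemma lipschitz_IVT (f : R -> R) (L a b : R) : 0 < L -> a <= b ->
  (forall x y, a <= x <= b -> a <= y <= b -> `|f y - f x| <= L * `|y - x|) ->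
  f a <= 0 -> 0 <= f b -> exists2 s, a <= s <= b & f s = 0.
Proof.
move=> L0 ab fL fa fb.
(* Clamping to [a, b] extends f to a function continuous on the whole line. *)
pose cl x : R := if x < a then a else if b < x then b else x.
have clab x : a <= cl x <= b.
  by rewrite /cl; case: ltP => xa; [rewrite lexx|case: ltP => xb; rewrite ?lexx ?ab ?xa].
have clE x : a <= x <= b -> cl x = x.
  by move=> /andP[ax xb]; rewrite /cl ltNge ax /= ltNge xb.
have cl1 x y : `|cl y - cl x| <= `|y - x|.
  have := ler_norm (y - x); have := ler_norm (x - y); rewrite (distrC x).
  move: (`|y - x|) => w w1 w2; rewrite ler_norml /cl.
  by case: (ltP y a) => h1; case: (ltP x a) => h2; case: (ltP b y) => h3;
    case: (ltP b x) => h4; apply/andP; split; lra.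
have cf : continuous (f \o cl).
  apply: (lipschitz_continuous L0) => x y /=; apply: (le_trans (fL _ _ (clab x) (clab y))).
  by rewrite ler_wpM2l// ltW.
have fab : f a <= f b by exact: le_trans fb.
have [||s] := @IVT R (f \o cl) a b 0 ab.
- exact: continuous_subspaceT.
- by rewrite /= !clE ?lexx ?ab// min_l// max_r// fa.
rewrite in_itv/= => sab; rewrite clE// => fs; by exists s.
Qed.

(** Where [Phi] is nonzero its sign persists nearby, so x is interior or exterior. A zero x is
    outside E, but moving along -v makes [Phi] negative at once, so x is a limit of points of E. *)
Lemma boundary_definingP n (E : set 'rV[R]_n) p Phi D r0 K x :
  0 < K -> 0 < r0 -> defining_function E p Phi D r0 K -> `|x - p| < r0 ->
  boundary E x <-> Phi x = 0.
Proof.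
move=> K0 r00 dPhi xr; have [L L0 PhiL] := defining_lipschitz K0 r00 dPhi.
have [EP _ _ [v Pv]] := dPhi.
have xr' := ltW xr.
have near_r : forall y, `|y - x| < r0 - `|x - p| -> `|y - p| <= r0.
  move=> y yx; rewrite -(subrKA x) (le_trans (ler_normD _ _))//.
  by rewrite -lerBrDr ltW.
have e0 : 0 < r0 - `|x - p| by rewrite subr_gt0.
split.
  move=> [clx nix]; apply/eqP; rewrite eq_le; apply/andP; split; rewrite leNgt; apply/negP => Px.
    have [|y [Ey [yr]]] := clx [set y | `|y - p| <= r0 /\ Phi y > 0].
      apply/nbhs_row_norm; exists (Num.min (r0 - `|x - p|) (Phi x / L)).
        by rewrite lt_min e0 divr_gt0.
      move=> y; rewrite lt_min => /andP[y1 y2] /=.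
      split; first exact: near_r.
      have := PhiL x y xr' (near_r _ y1); rewrite ler_norml => /andP[h _].
      by move: y2; rewrite ltr_pdivlMr// mulrC => y2; clear - h y2; lra.
    by have /(EP _ yr) := Ey; move=> /lt_trans h /h; rewrite ltxx.
  apply: nix; apply/nbhs_row_norm; exists (Num.min (r0 - `|x - p|) (- Phi x / L)).
    by rewrite lt_min e0 divr_gt0// oppr_gt0.
  move=> y; rewrite lt_min => /andP[y1 y2]; apply/(EP _ (near_r _ y1)).
  have := PhiL x y xr' (near_r _ y1); rewrite ler_norml => /andP[_ h].
  by move: y2; rewrite ltr_pdivlMr// mulrC => y2; clear - h y2; lra.
move=> Px; split.
  move=> B /nbhs_row_norm[e e1 eB].
  pose z := Num.min (r0 - `|x - p|) e / (`|v| + 1).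
  have m0 : 0 < Num.min (r0 - `|x - p|) e by rewrite lt_min e0.
  have v1 : 0 < `|v| + 1 by rewrite ltr_wpDl.
  have z0 : 0 < z by rewrite divr_gt0.
  pose y := x + (- z) *: v.
  have yx : `|y - x| < Num.min (r0 - `|x - p|) e.
    rewrite /y addrAC subrr add0r normrZ normrN (gtr0_norm z0) /z mulrAC.
    by rewrite ltr_pdivrMr// ltr_pM2l// ltrDl.
  move: yx; rewrite lt_min => /andP[yx1 yx2].
  exists y; split; last exact: eB.
  have yr := near_r _ yx1.
  by apply/(EP _ yr); rewrite /y Pv// Px add0r oppr_lt0.
move=> /nbhs_singleton/(EP _ xr'); by rewrite Px ltxx.
Qed.

End BoundaryNearPoint.

(** * Contact with the translated set *)

Section Touching.
Context {R : realType} {n : nat}.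
Implicit Types (E : set 'rV[R]_n) (p x y z : 'rV[R]_n).

Lemma norm_delta (i : 'I_n) : `|'e_i : 'rV[R]_n| = 1.
Proof.
apply/eqP; rewrite eq_le; apply/andP; split.
  by apply: norm_le_coord => // j; rewrite mxE eqxx /= normr_nat lern1 leq_b1.
by have := coord_le_norm ('e_i : 'rV[R]_n) i; rewrite mxE !eqxx normr1.
Qed.

(** [sg] is the sign of the i-th coordinate of the gradient at p, and c a quarter of its size. On
    the small ball this coordinate varies by at most c/2, leaving a slope of at least 3c, of which
    the quadratic remainder takes away at most c. *)
Lemma transversal_direction E p Phi D (r0 K : R) (i : 'I_n) :
  0 < K -> 0 < r0 -> defining_function E p Phi D r0 K -> D p ord0 i != 0 ->
  exists sg c r1, [/\ `|sg| = 1, 0 < c, 0 < r1 < r0,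
    forall x, `|x - p| <= r1 -> c <= `|D x ord0 i| &
    forall x s, 0 <= s -> `|x - p| <= r1 -> `|x + (s * sg) *: 'e_i - p| <= r1 ->
      c * s <= Phi (x + (s * sg) *: 'e_i) - Phi x].
Proof.
move=> K0 r00 [_ h2 h3 _] Ni.
pose c := `|D p ord0 i| / 4; have c0 : 0 < c by rewrite divr_gt0// normr_gt0.
have NE : `|D p ord0 i| = 4 * c by rewrite /c; field.
pose r1 := Num.min (r0 / 2) (c / (2 * K)).
have r10 : 0 < r1 by rewrite lt_min divr_gt0// divr_gt0// mulr_gt0.
have r1r : r1 < r0.
  by apply: (@le_lt_trans _ _ (r0 / 2)); [rewrite ge_min lexx|rewrite ltr_pdivrMr// ltr_pMr// ltr1n].
have Kr1 : 2 * K * r1 <= c.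
  by rewrite mulrC -ler_pdivlMr ?mulr_gt0// ge_min lexx orbT.
pose sg : R := Num.sg (D p ord0 i).
have sg1 : `|sg| = 1 by rewrite /sg normr_sg Ni.
have sgN : sg * D p ord0 i = 4 * c by rewrite -NE /sg -normrEsg.
have Dx x : `|x - p| <= r1 -> `|D x ord0 i - D p ord0 i| <= c / 2.
  move=> xr; have pr : `|p - p| <= r0 by rewrite subrr normr0 ltW.
  have xr0 : `|x - p| <= r0 by apply: (le_trans xr); exact: ltW.
  have := h3 x p 'e_i xr0 pr; rewrite dotpBl !dotp_delta norm_delta mulr1.
  move/le_trans; apply; apply: (@le_trans _ _ (K * r1)).
    by rewrite ler_wpM2l// ltW.
  by clear - Kr1; lra.
exists sg, c, r1; split=> //; first by rewrite r10.
  move=> x /Dx h; have := ler_normD (D x ord0 i) (D p ord0 i - D x ord0 i).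
  rewrite addrC subrK NE distrC; move: h; move: (`|D x ord0 i - D p ord0 i|) (`|D x ord0 i|) => u v.
  by clear - c0; lra.
move=> x s s0 xr; set v := (s * sg) *: 'e_i => yr.
have xr0 : `|x - p| <= r0 by apply: (le_trans xr); exact: ltW.
have yr0 : `|x + v - p| <= r0 by apply: (le_trans yr); exact: ltW.
have := h2 x (x + v) xr0 yr0.
have xv : x + v - x = v by rewrite addrAC subrr add0r.
have vn : `|v| = s by rewrite normrZ norm_delta mulr1 normrM sg1 mulr1 ger0_norm.
have sr : s <= 2 * r1.
  rewrite -vn -xv -(subrKA p) mulrDl !mul1r (le_trans (ler_normD _ _))// lerD//.
  by rewrite distrC.
rewrite xv vn dotpZr dotp_delta => T.
have Ks : K * s ^+ 2 <= c * s.
  rewrite expr2 mulrA ler_wpM2r// (le_trans _ Kr1)//.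
  by have := ler_wpM2l (ltW K0) sr; clear; lra.
have G : 3 * c * s <= s * sg * D x ord0 i.
  have : `|sg * (D x ord0 i - D p ord0 i)| <= c / 2 by rewrite normrM sg1 mul1r Dx.
  rewrite mulrBr sgN ler_norml => /andP[h _].
  have h' : 3 * c <= sg * D x ord0 i by clear - h c0; lra.
  by have := ler_wpM2l s0 h'; rewrite mulrA; clear; lra.
have cs : 0 <= c * s by rewrite mulr_ge0// ltW.
by move: T; rewrite ler_norml => /andP[h _]; clear - h G Ks cs; lra.
Qed.

(** The inner product with the i-th coordinate dropped: a penalty built from it does not change when
    a point slides along ['e_i]. *)
Definition dotp' (i : 'I_n) x y : R := \sum_(j < n | j != i) x ord0 j * y ord0 j.

Lemma dotp'C i x y : dotp' i x y = dotp' i y x.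
Proof. by apply: eq_bigr => j _; rewrite mulrC. Qed.

Lemma dotp'Dl i x y z : dotp' i (x + y) z = dotp' i x z + dotp' i y z.
Proof. by rewrite -big_split; apply: eq_bigr => j _; rewrite mxE mulrDl. Qed.

Lemma dotp'Dr i x y z : dotp' i z (x + y) = dotp' i z x + dotp' i z y.
Proof. by rewrite dotp'C dotp'Dl !(dotp'C i z). Qed.

Lemma dotp'N i x y : dotp' i (- x) y = - dotp' i x y.
Proof. by rewrite -sumrN; apply: eq_bigr => j _; rewrite mxE mulNr. Qed.

Lemma dotp'_delta i x c y : dotp' i (x + c *: 'e_i) y = dotp' i x y.
Proof.
by apply: eq_bigr => j ji; rewrite !mxE (negbTE ji) andbF mulr0 addr0.
Qed.

Lemma dotp'_ge0 i x : 0 <= dotp' i x x.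
Proof. by apply: sumr_ge0 => j _; rewrite -expr2 sqr_ge0. Qed.

Lemma dotp'_le_enorm i x : dotp' i x x <= enorm x ^+ 2.
Proof.
rewrite sqr_enorm /dotp (bigD1 i)//= lerDr -expr2; exact: sqr_ge0.
Qed.

Lemma dotp'_le i x y : `|dotp' i x y| <= n%:R * (`|x| * `|y|).
Proof.
apply: (le_trans (ler_norm_sum _ _ _)).
apply: (@le_trans _ _ (\sum_(j < n) `|x| * `|y|)).
  rewrite big_mkcond; apply: ler_sum => j _; case: (j != i); last by rewrite mulr_ge0.
  by rewrite normrM ler_pM ?coord_le_norm.
by rewrite sumr_const card_ord [leRHS]mulr_natl.
Qed.

Lemma coord_le_dotp' i x j : j != i -> x ord0 j ^+ 2 <= dotp' i x x.
Proof.
move=> ji; rewrite /dotp' (bigD1 j)//= -expr2 lerDl.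
by apply: sumr_ge0 => k _; rewrite -expr2 sqr_ge0.
Qed.

Lemma measurable_dotp' i y : measurable_fun setT (fun x => dotp' i x y).
Proof.
rewrite /dotp' (_ : (fun x : 'rV[R]_n => _) = (fun x : 'rV[R]_n =>
   \sum_(j < n) if j != i then x ord0 j * y ord0 j else 0)); last first.
  by apply/funext => x; rewrite big_mkcond.
apply: measurable_sum => j; case: (j != i); last exact: measurable_cst.
by apply: measurable_funM; [exact: measurable_coord|exact: measurable_cst].
Qed.

Lemma measurable_dotp'_sqr i : measurable_fun setT (fun x => dotp' i x x).
Proof.
rewrite /dotp' (_ : (fun x : 'rV[R]_n => _) = (fun x : 'rV[R]_n =>
   \sum_(j < n) if j != i then x ord0 j * x ord0 j else 0)); last first.
  by apply/funext => x; rewrite big_mkcond.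
apply: measurable_sum => j; case: (j != i); last exact: measurable_cst.
by apply: measurable_funM; exact: measurable_coord.
Qed.

Lemma continuous_sum_seq (T : topologicalType) (I : Type) (s : seq I) (F : I -> T -> R) :
  (forall j, continuous (F j)) -> continuous (fun t : T => \sum_(j <- s) F j t).
Proof.
move=> cF; elim: s => [|j s IH] t.
  rewrite (_ : (fun _ => _) = cst 0); first exact: cst_continuous.
  by apply/funext => w; rewrite big_nil.
rewrite (_ : (fun _ => _) = (F j \+ fun w : T => \sum_(k <- s) F k w)).
  by apply: continuousD; [exact: cF|exact: IH].
by apply/funext => w; rewrite big_cons.
Qed.

Lemma continuous_dotp'_sqr i : continuous (fun x => dotp' i x x).
Proof.
rewrite /dotp' (_ : (fun x : 'rV[R]_n => _) = (fun x : 'rV[R]_n =>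
   \sum_(j < n) if j != i then x ord0 j * x ord0 j else 0)); last first.
  by apply/funext => x; rewrite big_mkcond.
apply: continuous_sum_seq => j; case: (j != i); last exact: cst_continuous.
by move=> x; apply: continuousM; exact: coord_continuous.
Qed.

Lemma slide_to_zero p Phi (i : 'I_n) (sg L r1 a b : R) x :
  `|sg| = 1 -> 0 < L ->
  (forall x y, `|x - p| <= r1 -> `|y - p| <= r1 -> `|Phi y - Phi x| <= L * `|y - x|) ->
  a <= b -> (forall s, a <= s <= b -> `|x + (s * sg) *: 'e_i - p| <= r1) ->
  Phi (x + (a * sg) *: 'e_i) <= 0 -> 0 <= Phi (x + (b * sg) *: 'e_i) ->
  exists2 s, a <= s <= b & Phi (x + (s * sg) *: 'e_i) = 0.
Proof.
move=> sg1 L0 PL ab xab Pa Pb.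
apply: (@lipschitz_IVT _ (fun s => Phi (x + (s * sg) *: 'e_i)) L) => // y z yab zab.
apply: (le_trans (PL _ _ (xab y yab) (xab z zab))).
rewrite opprD addrACA subrr add0r -scalerBl normrZ norm_delta mulr1.
by rewrite -mulrBl normrM sg1 mulr1.
Qed.

End Touching.

(** * Existence of the contact point and the inclusion it gives *)

Section TouchingPoint.
Context {R : realType} {n : nat}.
Implicit Types (E : set 'rV[R]_n) (p x y z : 'rV[R]_n).

Lemma closed_boundary E : closed (boundary E).
Proof.
by apply: closedI; [exact: closed_closure|apply: open_closedC; exact: open_interior].
Qed.

Lemma closed_norm_le p (r : R) : closed [set x | `|x - p| <= r].
Proof.
rewrite (_ : mkset _ = (fun x => `|x - p|) @^-1` [set y | y <= r])//.
apply: preimage_closed; last exact: closed_le.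
move=> x _; apply: continuous_comp; last exact: norm_continuous.
have := @cvgB R _ _ (nbhs x) _ id (cst p) x p; apply; [exact: cvg_id|exact: cvg_cst].
Qed.

Lemma compact_norm_le p (r : R) : compact [set x | `|x - p| <= r].
Proof.
apply: bounded_closed_compact; last exact: closed_norm_le.
exists (r + `|p|); split; first exact: num_real.
move=> M hM x /= xr; apply: (le_trans _ (ltW hM)).
by rewrite -{1}(subrK p x) (le_trans (ler_normD _ _))// lerD2r.
Qed.

Lemma continuous_slide (e : 'rV[R]_n) (i : 'I_n) (sg t : R) :
  continuous (fun z : 'rV[R]_n * R => z.1 + t *: e - (z.2 * sg) *: 'e_i).
Proof.
move=> z; apply: cvgB.
  by apply: cvgD; [exact: cvg_fst|exact: cvg_cst].
apply: cvgZr_tmp; apply: cvgM; [exact: cvg_snd|exact: cvg_cst].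
Qed.

(** A pair (q, s) of [A] records that q lies on the boundary of E and also on that of E - t e slid
    by s along sg e_i. Boundaries are closed and both components are confined, so these pairs form a
    compact set. *)
Lemma penalized_minimum E p (e : 'rV[R]_n) (i : 'I_n) (sg t r2 s0 k : R) (z0 : 'rV[R]_n * R) :
  let A := [set z : 'rV[R]_n * R | [/\ `|z.1 - p| <= r2, 0 <= z.2 <= s0,
      boundary E z.1 & boundary E (z.1 + t *: e - (z.2 * sg) *: 'e_i)]] in
  A z0 -> exists2 z, A z & forall w, A w ->
    z.2 + k * dotp' i (z.1 - p) (z.1 - p) <= w.2 + k * dotp' i (w.1 - p) (w.1 - p).
Proof.
move=> A Az0; pose J (z : 'rV[R]_n * R) := z.2 + k * dotp' i (z.1 - p) (z.1 - p).
have cA : compact A.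
  apply: (@subclosed_compact _ _ ([set x | `|x - p| <= r2] `*` `[0, s0]%classic)).
  - rewrite (_ : A = (fst @^-1` [set x | `|x - p| <= r2]) `&` (snd @^-1` `[0, s0]%classic)
      `&` (fst @^-1` boundary E) `&`
      ((fun z : 'rV[R]_n * R => z.1 + t *: e - (z.2 * sg) *: 'e_i) @^-1` boundary E)).
      apply: closedI; [apply: closedI; [apply: closedI|]|].
      + by apply: preimage_closed; [move=> *; exact: cvg_fst|exact: closed_norm_le].
      + by apply: preimage_closed; [move=> *; exact: cvg_snd|exact: itv_closed].
      + by apply: preimage_closed; [move=> *; exact: cvg_fst|exact: closed_boundary].
      + by apply: preimage_closed; [move=> *; exact: continuous_slide|exact: closed_boundary].
    apply/seteqP; split => z.
      move=> [h1 h2 h3 h4]; split; last exact: h4.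
      split; last exact: h3.
      by split; [exact: h1|rewrite /preimage/= in_itv].
    move=> [[[h1 h2] h3] h4]; split; [exact: h1| |exact: h3|exact: h4].
    by move: h2; rewrite /preimage/= in_itv.
  - by apply: compact_setX; [exact: compact_norm_le|exact: segment_compact].
  by move=> z [z1 z2 _ _]; split => //=; rewrite in_itv.
have cJ : continuous J.
  move=> z; apply: cvgD; first exact: cvg_snd.
  apply: cvgM; first exact: cvg_cst.
  apply: (@continuous_comp _ _ _ (fun z : 'rV[R]_n * R => z.1 - p) (fun x => dotp' i x x)).
    by apply: cvgB; [exact: cvg_fst|exact: cvg_cst].
  exact: continuous_dotp'_sqr.
have [||z zA zmin] := @compact_EVT_min _ R J A _ cA.
- by exists z0.
- exact: continuous_subspaceT.
exists z; first by rewrite inE in zA.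
by move=> w Aw; apply: zmin; rewrite inE.
Qed.

Lemma dotp'_sqrD (i : 'I_n) x y :
  dotp' i (x + y) (x + y) = dotp' i x x + dotp' i y y + 2 * dotp' i y x.
Proof. by rewrite dotp'Dl !dotp'Dr (dotp'C i x y); ring. Qed.

Lemma norm_slide x p (e : 'rV[R]_n) (i : 'I_n) (sg t s : R) : `|sg| = 1 -> `|e| <= 1 ->
  `|x + t *: e - (s * sg) *: 'e_i - p| <= `|x - p| + `|t| + `|s|.
Proof.
move=> sg1 e1.
have -> : x + t *: e - (s * sg) *: 'e_i - p = x - p + t *: e - (s * sg) *: 'e_i.
  by rewrite addrAC (addrAC x).
apply: (le_trans (ler_normB _ _)); apply: lerD.
  apply: (le_trans (ler_normD _ _)); rewrite lerD2l normrZ.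
  by rewrite ler_piMr.
by rewrite normrZ norm_delta mulr1 normrM sg1 mulr1.
Qed.

Lemma norm_slide1 x p (i : 'I_n) (sg s : R) : `|sg| = 1 ->
  `|x + (s * sg) *: 'e_i - p| <= `|x - p| + `|s|.
Proof.
move=> sg1; rewrite addrAC (le_trans (ler_normD _ _))// lerD2l.
by rewrite normrZ norm_delta mulr1 normrM sg1 mulr1.
Qed.

(* Sliding E - t e along the transversal direction until it touches E, with a
   quadratic penalty keeping the contact point q close to p; minimality of the
   sliding distance turns into a one-sided inclusion of E seen from the two
   contact points, up to a shear of quadratic size. *)
Lemma touching_point E p Phi (i : 'I_n) (sg c L r1 : R) (e : 'rV[R]_n) :
  `|sg| = 1 -> 0 < c -> 0 < L -> 0 < r1 -> `|e| <= 1 ->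
  (forall x, `|x - p| <= r1 -> (E x <-> Phi x < 0)) ->
  (forall x, `|x - p| <= r1 -> (boundary E x <-> Phi x = 0)) ->
  (forall x y, `|x - p| <= r1 -> `|y - p| <= r1 -> `|Phi y - Phi x| <= L * `|y - x|) ->
  (forall x s, 0 <= s -> `|x - p| <= r1 -> `|x + (s * sg) *: 'e_i - p| <= r1 ->
      c * s <= Phi (x + (s * sg) *: 'e_i) - Phi x) ->
  (forall t x, 0 <= t -> E (x + t *: e) -> E x) ->
  Phi p = 0 ->
  exists d t0 r4 s0 k0, [/\ 0 < d, 0 < t0, 0 < r4, 0 < s0 & 0 < k0 /\
    forall t tau k, 0 < t -> t <= t0 -> 0 <= tau -> tau <= s0 ->
      Phi (p + t *: e - (tau * sg) *: 'e_i) = 0 ->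
      0 < k -> k <= k0 -> tau <= k * r4 ^+ 2 ->
      exists q s, [/\ `|q - p| <= r1 / 4, 0 <= s <= tau,
        boundary E q, boundary E (q + t *: e - (s * sg) *: 'e_i) &
        forall x, `|x| <= d -> E (x + (q + t *: e - (s * sg) *: 'e_i)) ->
          E (x - (k * (sg * dotp' i x x + sg * 2 * dotp' i x (q - p))) *: 'e_i + q)]].
Proof.
move=> sg1 c0 L0 r10 e1 EP BP PL mono Et Pp.
(* A boundary point that agrees with p up to d in the coordinates other than i agrees up to (L/c) d
   in the i-th. [La] adds the two, and d makes the sum r1/8. *)
pose La := 1 + L / c; have La0 : 0 < La by rewrite ltr_wpDr// divr_ge0// ltW.
have La1 : 1 <= La by rewrite lerDl divr_ge0// ltW.
pose d := r1 / (8 * La); have d0 : 0 < d by rewrite divr_gt0// mulr_gt0.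
have dLa : La * d = r1 / 8 by rewrite /d; field; rewrite gt_eqF.
have Ld0 : 0 <= L / c * d by rewrite mulr_ge0 ?(ltW d0)// divr_ge0// ltW.
pose s0 := r1 / 4; have s00 : 0 < s0 by rewrite divr_gt0.
(* The second bound gives L t <= c s0: a slide of length s0 is enough to undo the effect of the
   translation on [Phi]. *)
pose t0 := Num.min s0 (c * s0 / L).
have t00 : 0 < t0 by rewrite lt_min s00 divr_gt0// mulr_gt0.
(* A bound for the bracket X + 2 XQ of the shear below, so that k <= k0 keeps the shear under
   r1/2. *)
pose kk := n%:R * (d * d) + n%:R * 2 * (d * (r1 / 4)) + 1.
have d0' := ltW d0.
have r140 : 0 <= r1 / 4 by rewrite divr_ge0// ltW.
have kk0 : 0 < kk.
  rewrite /kk ltr_wpDl//; apply: addr_ge0.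
    exact: mulr_ge0 (ler0n _ _) (mulr_ge0 d0' d0').
  exact: mulr_ge0 (mulr_ge0 (ler0n _ _) (ler0n _ _)) (mulr_ge0 d0' r140).
pose k0 := r1 / 2 / kk; have k00 : 0 < k0 by rewrite divr_gt0// divr_gt0.
exists d, t0, d, s0, k0; split => //; split => // t tau k tp tt0 tau0 taus0 Ptau kp kk0' tauk.
have ts0 : t <= s0 by rewrite (le_trans tt0)// ge_min lexx.
have Lt : L * t <= c * s0.
  by rewrite mulrC -ler_pdivlMr// (le_trans tt0)// ge_min lexx orbT.
have pr : `|p - p| <= r1 by rewrite subrr normr0 ltW.
have slide_r x s : `|x - p| <= r1 / 4 -> 0 <= s <= s0 ->
    `|x + t *: e - (s * sg) *: 'e_i - p| <= r1.
  move=> xr /andP[sp ss]; apply: (le_trans (norm_slide x p i t s sg1 e1)).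
  rewrite (gtr0_norm tp) (ger0_norm sp); clear - xr ss ts0 r10.
  by move: xr ss ts0; rewrite /s0; lra.
pose A := [set z : 'rV[R]_n * R | [/\ `|z.1 - p| <= r1 / 4, 0 <= z.2 <= s0,
      boundary E z.1 & boundary E (z.1 + t *: e - (z.2 * sg) *: 'e_i)]].
have p4 : `|p - p| <= r1 / 4 by rewrite subrr normr0 divr_ge0// ltW.
have Ap : A (p, tau).
  split => /=; rewrite ?p4 ?tau0//; first by apply/(BP p pr).
  by apply/BP => //; apply: slide_r; rewrite ?p4 ?tau0.
have [[q s] [/= qr /andP[sp ss] Bq Bq2] qmin] := @penalized_minimum E p e i sg t (r1 / 4) s0 k (p, tau) Ap.
have qr1 : `|q - p| <= r1 by apply: (le_trans qr); clear - r10; lra.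
have Pq : Phi q = 0 by apply/(BP q qr1).
(* The competitor (p, tau) carries no penalty, so the slide and the penalty of the minimizer are
   both at most tau; as tau <= k d^2, this confines q in the coordinates other than i. *)
have [qmin1 sk] : dotp' i (q - p) (q - p) <= d ^+ 2 /\ s <= tau.
  have := qmin _ Ap; rewrite /= subrr.
  have -> : dotp' i (0 : 'rV[R]_n) 0 = 0 by rewrite /dotp' big1// => j _; rewrite mxE mulr0.
  rewrite mulr0 addr0 => h.
  have Q0 := dotp'_ge0 i (q - p).
  split; last by apply: le_trans h; rewrite lerDl mulr_ge0// ltW.
  rewrite -(ler_pM2l kp); apply: le_trans tauk; apply: le_trans h.
  by rewrite lerDr.
have qj j : j != i -> `|(q - p) ord0 j| <= d.
  move=> ji; rewrite -(@ler_pXn2r _ 2) ?nnegrE// real_normK ?num_real//.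
  exact: le_trans (coord_le_dotp' (q - p) ji) qmin1.
(* Give q the i-th coordinate of p: there [Phi] is at most L d in size, so by monotonicity q was
   moved by at most (L/c) d. The resulting r1/8 is half the allowed r1/4, which leaves room for
   competitors around q. *)
have q3 : `|q - p| <= r1 / 8.
  pose z := - (q - p) ord0 i * sg.
  have sgsg : sg * sg = 1.
    by have := sg1; rewrite -[sg * sg]expr2 -real_normK ?num_real// => ->; rewrite expr1n.
  have yE : q + (z * sg) *: 'e_i - p = q - p - (q - p) ord0 i *: 'e_i.
    by rewrite /z -mulrA sgsg mulr1 scaleNr addrAC.
  have yd : `|q + (z * sg) *: 'e_i - p| <= d.
    rewrite yE; apply: norm_le_coord => [|j]; first exact: ltW.
    rewrite [X in `|X|](_ : _ = (q - p) ord0 j - (q - p) ord0 i * (j == i)%:R); last first.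
      by rewrite !mxE eqxx.
    case: (eqVneq j i) => [->|ji]; first by rewrite mulr1 subrr normr0 ltW.
    by rewrite mulr0 subr0 qj.
  have dr1 : d <= r1.
    by rewrite -(ler_pM2l La0) dLa; clear - La1 r10; nra.
  have yr := le_trans yd dr1.
  have Py : `|Phi (q + (z * sg) *: 'e_i)| <= L * d.
    have := PL p _ pr yr; rewrite Pp subr0 => h; apply: (le_trans h).
    by rewrite ler_wpM2l// ltW.
  have cz : c * `|z| <= L * d.
    apply: le_trans Py; case: (leP 0 z) => z0.
      have := mono q z z0 qr1 yr; rewrite Pq subr0 (ger0_norm z0).
      by move/le_trans; apply; exact: ler_norm.
    have z0' : 0 <= - z by rewrite oppr_ge0 ltW.
    have back : q + (z * sg) *: 'e_i + (- z * sg) *: 'e_i = q.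
      by rewrite mulNr scaleNr addrK.
    have := mono (q + (z * sg) *: 'e_i) (- z) z0' yr; rewrite back => /(_ qr1).
    rewrite Pq sub0r (ltr0_norm z0) => /le_trans; apply.
    by rewrite -normrN ler_norm.
  have zd : `|z| <= L / c * d by rewrite mulrAC ler_pdivlMr// mulrC.
  have zi : `|(q - p) ord0 i| = `|z| by rewrite /z normrM sg1 mulr1 normrN.
  rewrite -dLa /La mulrDl mul1r; apply: norm_le_coord => [|j].
    exact: addr_ge0.
  case: (eqVneq j i) => [->|ji]; first by rewrite zi (le_trans zd)// lerDr.
  by rewrite (le_trans (qj j ji))// lerDl.
exists q, s; split => //; first by rewrite sp.
move=> x xd EA.
pose a := q + x; pose S := L / c * d.
have S0 : 0 <= S by [].
have dS : d + S = r1 / 8 by rewrite -dLa /La mulrDl mul1r.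
have ar : `|a - p| <= r1 / 8 + d.
  by rewrite /a addrAC (le_trans (ler_normD _ _))// lerD.
have dr8 : d <= r1 / 8 by rewrite -dS lerDl.
have ar1 : `|a - p| <= r1 by apply: (le_trans ar); clear - dr8 r10; lra.
have Pa : `|Phi a| <= L * d.
  have := PL q a qr1 ar1; rewrite Pq subr0 => h; apply: (le_trans h).
  by rewrite /a addrAC subrr add0r ler_wpM2l// ltW.
have aS r : - S <= r <= S -> `|a + (r * sg) *: 'e_i - p| <= r1 / 4.
  move=> rS; apply: (le_trans (norm_slide1 a p i r sg1)).
  have : `|r| <= S by rewrite ler_norml.
  by clear - ar dS; lra.
have r14 : r1 / 4 <= r1 by clear - r10; lra.
have cS : c * S = L * d by rewrite /S; field; rewrite gt_eqF.
have SS : - S <= S by rewrite ge0_cp.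
have aSr : `|a + (S * sg) *: 'e_i - p| <= r1 by apply: le_trans r14; apply: aS; rewrite SS lexx.
have aNSr : `|a + (- S * sg) *: 'e_i - p| <= r1 by apply: le_trans r14; apply: aS; rewrite SS lexx.
(* Construction of a competitor: q + x is slid to a boundary point a', then a' + t e is slid back to
   the boundary over a length w. *)
have [|||r rS Pr] := @slide_to_zero _ _ p Phi i sg L r1 (- S) S a sg1 L0 PL SS.
- by move=> r rS; apply: le_trans r14; exact: aS.
- have back : a + (- S * sg) *: 'e_i + (S * sg) *: 'e_i = a by rewrite mulNr scaleNr subrK.
  have := mono _ S S0 aNSr; rewrite back => /(_ ar1); rewrite cS.
  move: Pa; rewrite ler_norml => /andP[_ h1 h2]; clear - h1 h2; lra.
- have := mono a S S0 ar1 aSr; rewrite cS.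
  move: Pa; rewrite ler_norml => /andP[h1 _ h2]; clear - h1 h2; lra.
pose a' := a + (r * sg) *: 'e_i.
have a'r : `|a' - p| <= r1 / 4 by exact: aS.
have a'r1 := le_trans a'r r14.
have Ba' : boundary E a' by apply/BP.
have a'n : ~ E a' by move/(EP _ a'r1); rewrite Pr ltxx.
have slide_r' (z : R) : 0 <= z <= s0 -> `|a' + t *: e - (z * sg) *: 'e_i - p| <= r1.
  by move=> zs; exact: slide_r.
have a'tr : `|a' + t *: e - p| <= r1.
  by have := slide_r' 0; rewrite mul0r scale0r subr0; apply; rewrite lexx ltW.
have Pa't : 0 <= Phi (a' + t *: e).
  by rewrite leNgt; apply/negP => /(EP _ a'tr)/(Et _ _ (ltW tp)).
have Pa't' : Phi (a' + t *: e) <= L * t.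
  have a'E : a' + t *: e - a' = t *: e by rewrite addrAC subrr add0r.
  have := PL a' _ a'r1 a'tr; rewrite a'E [Phi a']Pr subr0 normrZ (gtr0_norm tp).
  move/(le_trans (ler_norm _))/le_trans; apply.
  by rewrite ler_wpM2l ?(ltW L0)// ler_piMr// ltW.
have NS0 : - s0 <= 0 by rewrite oppr_le0 ltW.
have conv (z : R) : a' + t *: e + (z * sg) *: 'e_i = a' + t *: e - (- z * sg) *: 'e_i.
  by rewrite mulNr scaleNr opprK.
have [|||z zs Pz] := @slide_to_zero _ _ p Phi i sg L r1 (- s0) 0 (a' + t *: e) sg1 L0 PL NS0.
- move=> z /andP[z1 z2]; rewrite conv; apply: slide_r'.
  by rewrite oppr_ge0 z2 lerNl z1.
- have back : a' + t *: e + (- s0 * sg) *: 'e_i + (s0 * sg) *: 'e_i = a' + t *: e.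
    by rewrite mulNr scaleNr subrK.
  have hr : `|a' + t *: e + (- s0 * sg) *: 'e_i - p| <= r1.
    by rewrite conv opprK; apply: slide_r'; rewrite lexx ltW.
  have := mono _ s0 (ltW s00) hr; rewrite back => /(_ a'tr) h.
  by clear - h Lt Pa't'; lra.
- by rewrite mul0r scale0r addr0.
rewrite conv in Pz; move: zs => /andP[z1 z2].
have w0 : 0 <= - z by rewrite oppr_ge0.
have ws0 : - z <= s0 by rewrite lerNl.
pose w := - z; rewrite -/w in Pz w0 ws0.
have Aw : A (a', w).
  split; [exact: a'r|by rewrite /= w0|exact: Ba'|].
  have h : `|a' + t *: e - (w * sg) *: 'e_i - p| <= r1 by apply: slide_r'; rewrite w0.
  by apply/(BP _ h).
have := qmin _ Aw; rewrite /=.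
have a'pE : a' - p = (q - p + x) + (r * sg) *: 'e_i by rewrite /a' /a addrAC (addrAC q).
rewrite a'pE dotp'_delta (dotp'C _ (q - p + x)) dotp'_delta.
rewrite (dotp'_sqrD i (q - p) x).
set Q := dotp' i (q - p) (q - p); set X := dotp' i x x; set XQ := dotp' i x (q - p) => hmin.
(* Minimality against (a', w) reads s - err <= w, the error being the change of the penalty from q
   to q + x. *)
pose err := k * (X + 2 * XQ).
have wse : s - err <= w by rewrite /err; clear - hmin; lra.
(* If r + err <= 0, then x + q + t e - s sg e_i would lie at or beyond the boundary point a' + t e -
   w sg e_i in the direction in which [Phi] increases, contradicting [EA]. *)
have rse : 0 < r + err.
  rewrite ltNge; apply/negP => re.
  have ws : 0 <= w - r - s by clear - re wse; lra.
  have q2E : x + (q + t *: e - (s * sg) *: 'e_i) =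
      a' + t *: e - (w * sg) *: 'e_i + ((w - r - s) * sg) *: 'e_i.
    rewrite /a' /a -[in RHS]addrA -[in RHS]scaleNr -[in RHS]scalerDl.
    rewrite (addrAC (q + x)) -[in RHS]addrA -[in RHS]scalerDl.
    have -> : r * sg + (- (w * sg) + (w - r - s) * sg) = - (s * sg) by ring.
    by rewrite scaleNr (addrC q x) !addrA.
  have xq2r : `|x + (q + t *: e - (s * sg) *: 'e_i) - p| <= r1.
    have -> : x + (q + t *: e - (s * sg) *: 'e_i) = a + t *: e - (s * sg) *: 'e_i.
      by rewrite /a !addrA (addrC q x).
    apply: slide_r; last by rewrite sp.
    by apply: (le_trans ar); clear - dr8; lra.
  have := mono (a' + t *: e - (w * sg) *: 'e_i) (w - r - s) ws.
  rewrite -q2E => /(_ (slide_r' w _) xq2r); rewrite w0 ws0 => /(_ isT).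
  rewrite Pz subr0; move/(EP _ xq2r): EA => h1 h2.
  have := le_lt_trans h2 h1; rewrite ltNge mulr_ge0// ltW//.
have errE : k * (sg * X + sg * 2 * XQ) = err * sg by rewrite /err; ring.
rewrite errE.
have xE : x - (err * sg) *: 'e_i + q = a - (err * sg) *: 'e_i.
  by rewrite /a addrAC (addrC q x).
have err_le : `|err| <= r1 / 2.
  rewrite /err normrM (gtr0_norm kp).
  apply: (@le_trans _ _ (k * kk)); last by rewrite -ler_pdivlMr.
  rewrite ler_wpM2l ?(ltW kp)//.
  have h1 : `|X| <= n%:R * (d * d).
    apply: (le_trans (dotp'_le _ _ _)); rewrite ler_wpM2l//; exact: ler_pM.
  have h2 : `|XQ| <= n%:R * (d * (r1 / 4)).
    apply: (le_trans (dotp'_le _ _ _)); rewrite ler_wpM2l//; exact: ler_pM.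
  apply: (le_trans (ler_normD _ _)); rewrite normrM (ger0_norm (ler0n _ 2)).
  by rewrite /kk; clear - h1 h2; lra.
have yr : `|a - (err * sg) *: 'e_i - p| <= r1.
  have := norm_slide1 a p i (- err) sg1; rewrite mulNr scaleNr normrN => h.
  by apply: (le_trans h); clear - ar err_le dr8 r10; lra.
rewrite xE; apply/(EP _ yr).
(* The sheared point precedes a' by r + err > 0 in the direction in which [Phi] increases, hence
   lies in E. *)
have back : a - (err * sg) *: 'e_i + ((r + err) * sg) *: 'e_i = a'.
  by rewrite mulrDl scalerDl addrCA subrK addrC.
have := mono _ (r + err) (ltW rse) yr; rewrite back => /(_ a'r1).
rewrite Pr sub0r => h.
by rewrite -oppr_gt0; apply: lt_le_trans h; rewrite mulr_gt0.
Qed.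

End TouchingPoint.

(** * Comparison of the mean curvatures *)

Section OpenMeasurable.
Context {R : realType}.

(** The sigma-algebra is generated by the coordinates; open sets are reached as countable unions of
    closed cubes with rational centre and half-side 1/(k + 1). *)
Lemma measurable_open n (U : set 'rV[R]_n) : open U -> measurable U.
Proof.
move=> oU.
pose Q (ck : 'rV[rat]_n * nat) : set 'rV[R]_n :=
  [set x | forall i, ratr (ck.1 ord0 i) - ck.2.+1%:R^-1 <= x ord0 i <=
                     ratr (ck.1 ord0 i) + ck.2.+1%:R^-1].
have mQ ck : measurable (Q ck) by exact: measurable_box.
pose F ck := [set x | Q ck x /\ Q ck `<=` U].
rewrite (_ : U = \bigcup_ck F ck).
  apply: countable_bigcupT_measurable; first exact: countableP.
  move=> ck; have [QU|QU] := pselect (Q ck `<=` U).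
    rewrite (_ : F ck = Q ck)//; apply/seteqP; split => [x []//|x Qx]; by split.
  by rewrite (_ : F ck = set0)//; apply/seteqP; split => // x [].
apply/seteqP; split => [x Ux|x [ck _ [Qx /(_ x Qx)]]//].
have /nbhs_row_norm[e e0 eU] := open_nbhs_nbhs (conj oU Ux).
have e20 : 0 < e / 2 by rewrite divr_gt0.
have [dl [k [dlE dl0 hk]]] : exists (dl : R) (k : nat), [/\ dl = k.+1%:R^-1, 0 < dl & dl < e / 2].
  have [k hk] := ltr_add_invr e20; rewrite add0r in hk.
  by exists k.+1%:R^-1, k; split => //; rewrite invr_gt0.
have hq i : exists q : rat, `|x ord0 i - ratr q| < dl.
  have [|q] := @rat_in_itvoo R (x ord0 i - dl) (x ord0 i + dl).
    by clear - dl0; lra.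
  by rewrite in_itv/= => /andP[q1 q2]; exists q; rewrite ltr_norml; clear - q1 q2; lra.
pose c : 'rV[rat]_n := \row_i projT1 (cid (hq i)).
have hc i : `|x ord0 i - ratr (c ord0 i)| < dl.
  by rewrite mxE; case: (cid _).
exists (c, k) => //; split.
  move=> i; rewrite -dlE /=; have := hc i; rewrite ltr_norml => /andP[h1 h2].
  by clear - h1 h2; lra.
move=> y Qy; apply: eU; apply: (@le_lt_trans _ _ (2 * dl)); last by clear - hk; lra.
apply: norm_le_coord => [|i]; first by rewrite mulr_ge0// ltW.
rewrite [X in `|X|](_ : _ = y ord0 i - x ord0 i); last by rewrite !mxE.
have := Qy i; rewrite -dlE; have := hc i; rewrite ler_norml ltr_norml /=.
by move=> /andP[h1 h2] /andP[h3 h4]; clear - h1 h2 h3 h4; lra.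
Qed.

End OpenMeasurable.

(** * The thin layer where the set and its reflection are not complementary *)

Section Layer.
Context {R : realType} {n : nat}.

(** With l the gradient at q, these are the points where the quadratic remainder may outweigh the
    linear term of the defining function. *)
Definition layer (l : 'rV[R]_n) (K : R) : set 'rV[R]_n :=
  [set x | `|dotp l x| <= K * enorm x ^+ 2].

Lemma measurable_layer l K : measurable (layer l K).
Proof.
pose f x := K * enorm x ^+ 2 - `|dotp l x| : R.
rewrite (_ : layer l K = (f : 'rV[R]_n -> measurableTypeR R) @^-1` `[0, +oo[%classic).
  apply: measurable_preimage; last exact: measurable_itv.
  apply: measurable_funB.
    apply: measurable_funM; first exact: measurable_cst.
    by apply: measurable_funX; exact: measurable_enorm.
  apply: measurableT_comp => //.
  by apply: measurable_dotp; [exact: measurable_cst|exact: measurable_id].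
by apply/seteqP; split => x; rewrite /layer /preimage/= in_itv/= andbT subr_ge0.
Qed.

(** In the ball of radius r the layer lies in a slab of half-width K r^2 about a hyperplane, of
    volume r^(n-1) r^2 up to constants. The lower bound c on one coordinate of l makes the constant
    uniform in l. *)
Lemma layer_measure (i : 'I_n) (l : 'rV[R]_n) (K c r : R) :
  0 < K -> 0 < c -> c <= `|l ord0 i| -> 0 < r ->
  (lebesgueRn R n (layer l K `&` eball 0%R r) <= (2 ^+ n * K / c * r `^ (n%:R + 1))%:E)%E.
Proof.
move=> K0 c0 cl r0.
have li0 : 0 < `|l ord0 i| by exact: lt_le_trans cl.
have w0 : 0 <= K * r ^+ 2 by rewrite mulr_ge0 ?exprn_ge0// ltW.
have li : l ord0 i != 0 by rewrite -normr_gt0.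
have S := lebesgueRn_slab_le (ltW r0) w0 li.
apply: (@le_trans _ _ ((2 * r) ^+ n.-1 * (2 * (K * r ^+ 2) / `|l ord0 i|))%:E).
  apply: le_trans S; apply: le_measure; rewrite ?inE.
  - by apply: measurableI; [exact: measurable_layer|exact: measurable_eball0].
  - exact: measurable_slab.
  move=> x [Wx]; rewrite eball0E /= => xr; split => [j|].
    by rewrite (le_trans (coord_le_enorm x j))// ltW.
  apply: (le_trans Wx); rewrite ler_wpM2l ?(ltW K0)//.
  by rewrite lerXn2r ?nnegrE ?enorm_ge0 ?ltW.
rewrite lee_fin.
have n1 : n = n.-1.+1 by case: (n) i {li S cl li0} l => [[]|].
have -> : r `^ (n%:R + 1) = r ^+ n.-1 * r ^+ 2.
  by rewrite natr1 powR_mulrn ?ltW// -exprD addn2 -n1.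
have -> : 2 ^+ n * K / c * (r ^+ n.-1 * r ^+ 2) = (2 * r) ^+ n.-1 * (2 * (K * r ^+ 2) / c).
  have -> : 2 ^+ n = 2 * 2 ^+ n.-1 :> R by rewrite -exprS -n1.
  rewrite exprMn; move: (2 ^+ n.-1) (r ^+ n.-1) (r ^+ 2) => u v w.
  by clear - c0; field; rewrite gt_eqF.
apply: ler_wpM2l; first by rewrite exprn_ge0// mulr_ge0// ltW.
by apply: ler_wpM2l; [rewrite mulr_ge0|rewrite lef_pV2].
Qed.

(** Off the layer the linear term decides the sign of [Phi], and it is odd; so exactly one of x and
    -x falls in the set. *)
Lemma layer_side (E : set 'rV[R]_n) p Phi D (r0 K : R) q x :
  0 < K -> defining_function E p Phi D r0 K -> `|q - p| <= r0 / 2 -> 0 < r0 ->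
  Phi q = 0 -> enorm x < r0 / 2 -> ~ layer (D q) K x ->
  side (centered E q) (- x) = - side (centered E q) x.
Proof.
move=> K0 [EP h2 _ _] qr r00 Pq xr nW.
have qr0 : `|q - p| <= r0 by apply: (le_trans qr); clear - r00; lra.
have nb y : enorm y < r0 / 2 -> `|y + q - p| <= r0.
  move=> yr; rewrite -addrA (le_trans (ler_normD _ _))//.
  by have := le_lt_trans (norm_le_enorm y) yr; clear - qr; lra.
have T y : enorm y = enorm x -> `|Phi (y + q) - dotp (D q) y| <= K * enorm x ^+ 2.
  move=> yx; have yr : enorm y < r0 / 2 by rewrite yx.
  have := h2 q (y + q) qr0 (nb y yr); rewrite Pq subr0 addrK => h.
  apply: (le_trans h); rewrite ler_wpM2l ?(ltW K0)// -yx.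
  by rewrite lerXn2r ?nnegrE ?enorm_ge0// norm_le_enorm.
have T1 := T x erefl; have T2 := T (- x) (enormN x).
have dN : dotp (D q) (- x) = - dotp (D q) x by rewrite dotpC dotpNl dotpC.
have xr' : enorm (- x) < r0 / 2 by rewrite enormN.
have P1 := EP _ (nb x xr); have P2 := EP _ (nb _ xr').
move/negP: nW; rewrite /layer /= -ltNge lter_normr dN in T2 * => /orP[h|h].
  have o1 : ~ E (x + q).
    by move/P1; move: T1; rewrite ler_norml; clear - h; lra.
  have i2 : E (- x + q).
    by apply/P2; move: T2; rewrite ler_norml; clear - h; lra.
  by rewrite side_in// side_out.
have i1 : E (x + q).
  by apply/P1; move: T1; rewrite ler_norml; clear - h; lra.
have o2 : ~ E (- x + q).
  by move/P2; move: T2; rewrite ler_norml; clear - h; lra.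
by rewrite side_out// side_in// opprK.
Qed.

End Layer.

(** * Subgraphs and the gap between E and its vertical translate *)

Section Subgraph.
Context {R : realType} {m : nat}.
Implicit Types (u : 'rV[R]_m -> R) (p q x : 'rV[R]_m.+1).

Lemma initc_delta_max : initc ('e_ord_max : 'rV[R]_m.+1) = 0.
Proof. by apply/rowP => j; rewrite !mxE lift_eqF. Qed.

Lemma subgraph_translate u t x : 0 <= t ->
  subgraph u (x + t *: 'e_ord_max) -> subgraph u x.
Proof.
move=> t0; rewrite /subgraph /= initcD lastcD initcZ lastcZ.
rewrite initc_delta_max scaler0 addr0 /lastc mxE !eqxx mulr1; apply: le_lt_trans.
by rewrite lerDl.
Qed.

(** A point of the subgraph that is not interior would be on the boundary, hence on the graph, where
    the strict inequality fails. *)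
Lemma subgraph_open u : boundary (subgraph u) = graph u -> open (subgraph u).
Proof.
move=> Bu; rewrite openE => x ux; apply: contrapT => nx.
have : boundary (subgraph u) x by split => //; exact: subset_closure.
by rewrite Bu /graph /= => xu; move: ux; rewrite /subgraph /= xu ltxx.
Qed.

(** The bounds come from topology, u itself not being assumed continuous: the point one unit below p
    is interior to E, the point one unit above is off its closure, and both properties persist over
    nearby base points. *)
Lemma subgraph_locally_bounded u p : boundary (subgraph u) = graph u ->
  boundary (subgraph u) p -> exists2 eta, 0 < eta &
  forall y, `|y - initc p| <= eta -> `|u y - lastc p| <= 1.
Proof.
move=> Bu Bp; have pu : lastc p = u (initc p) by move: Bp; rewrite Bu.
have oE := subgraph_open Bu.
have snoc_near y c : `|snoc (y, c) - snoc (initc p, c)| <= `|y - initc p|.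
  apply: norm_le_coord => // j; rewrite mxE [X in _ + X]mxE.
  case: (unliftP ord_max j) => [k|] ->; rewrite ?snoc_lift ?snoc_max/=.
    by have := coord_le_norm (y - initc p) k; rewrite !mxE.
  by rewrite subrr normr0.
have [e1 e10 h1] : exists2 e, 0 < e & forall y, `|y - initc p| < e -> lastc p - 1 < u y.
  have Ein : subgraph u (snoc (initc p, lastc p - 1)).
    by rewrite /subgraph /= lastc_snoc initc_snoc /= -pu ltrBlDr ltrDl.
  have /nbhs_row_norm[e e0 he] := open_nbhs_nbhs (conj oE Ein).
  exists e => // y ye; have := he (snoc (y, lastc p - 1)).
  rewrite /subgraph /= lastc_snoc initc_snoc /=; apply.
  exact: le_lt_trans (snoc_near _ _) ye.
have [e2 e20 h2] : exists2 e, 0 < e & forall y, `|y - initc p| < e -> u y <= lastc p + 1.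
  have Eout : ~ closure (subgraph u) (snoc (initc p, lastc p + 1)).
    move=> cl; have [inE|niE] := pselect (interior (subgraph u) (snoc (initc p, lastc p + 1))).
      have := interior_subset inE; rewrite /subgraph /= lastc_snoc initc_snoc /= -pu.
      by rewrite ltNge lerDl ler01.
    have : boundary (subgraph u) (snoc (initc p, lastc p + 1)) by split.
    rewrite Bu /graph /= lastc_snoc initc_snoc /= -pu => /eqP.
    by rewrite -subr_eq0 addrAC subrr add0r oner_eq0.
  have oC : open (~` closure (subgraph u)) by apply: closed_openC; exact: closed_closure.
  have /nbhs_row_norm[e e0 he] := open_nbhs_nbhs (conj oC Eout).
  exists e => // y ye; have := he (snoc (y, lastc p + 1)) (le_lt_trans (snoc_near _ _) ye).
  move=> nc; rewrite leNgt; apply/negP => uy; apply: nc; apply: subset_closure.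
  by rewrite /subgraph /= lastc_snoc initc_snoc.
exists (Num.min e1 e2 / 2); first by rewrite divr_gt0// lt_min e10.
move=> y ye.
have yl : `|y - initc p| < Num.min e1 e2.
  by apply: (le_lt_trans ye); rewrite ltr_pdivrMr// ltr_pMr ?ltr1n// lt_min e10.
move: yl; rewrite lt_min => /andP[/h1 l1 /h2 l2].
by rewrite ler_norml; clear - l1 l2; lra.
Qed.

(* The part of E outside E - t e_n has vertical fibres of length t. *)
Lemma gap_measure u (B : set 'rV[R]_m) (b : R) t : 0 <= t -> measurable B ->
  lebesgueRn R m B = b%:E ->
  lebesgueRn R m.+1 [set x | [/\ B (initc x), subgraph u x &
     ~ subgraph u (x + t *: 'e_ord_max)]] = (t * b)%:E.
Proof.
move=> t0 mB Bb; rewrite lebesgueRnS1.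
rewrite (eq_integral (fun y => t%:E * (\1_B y)%:E)%E).
  rewrite ge0_integralZl//; last first.
    by apply/measurable_EFinP; exact: measurable_indic.
  rewrite integral_indic// setIT.
  by transitivity (t%:E * b%:E)%E; first by congr (_ * _)%E; exact: Bb.
move=> y _; rewrite indicE.
have iE c : initc (snoc (y, c) + t *: 'e_ord_max) = y.
  by rewrite initcD initcZ initc_snoc /= initc_delta_max scaler0 addr0.
have lE c : lastc (snoc (y, c) + t *: 'e_ord_max) = c + t.
  by rewrite lastcD lastcZ lastc_snoc /lastc mxE !eqxx mulr1.
case: (boolP (y \in B)) => [/set_mem|/negP] yB.
  rewrite mule1 (_ : (fun c => _) = `[u y - t, u y[%classic).
    rewrite lebesgue_measure_itv/= lte_fin ltrBlDr ltrDl.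
    case: ltP => [_|t0']; first by rewrite -EFinB opprB addrC subrK.
    by congr EFin; apply/eqP; rewrite eq_le t0 t0'.
  apply/seteqP; split => c /=; rewrite in_itv/= /subgraph/= iE lE lastc_snoc initc_snoc /=.
    by move=> [_ -> /negP]; rewrite -leNgt lerBlDr andbT.
  by move=> /andP[h1 h2]; split => //; apply/negP; rewrite -leNgt -lerBlDr.
rewrite mule0 (_ : (fun c => _) = set0) ?measure0//.
by apply/seteqP; split => c //= -[]; rewrite initc_snoc => h; case: yB; rewrite inE.
Qed.

(** Over a fixed box around the projection of p the gap has measure t b, and it stays at bounded
    distance from q, where the kernel is at least f0. The factor 2 is the jump of [side] from -1 to
    1; elsewhere the integrand is nonnegative as E - t e_n is contained in E. *)
Lemma gap_lower_bound u p (a d r : R) : m.+1%:R < a -> 0 < d -> 0 <= r ->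
  boundary (subgraph u) = graph u -> boundary (subgraph u) p ->
  exists2 c0, 0 < c0 & forall t q, 0 < t -> t <= 1 -> `|q - p| <= r ->
    c0 * t <= \int[lebesgueRn R m.+1]_x
      ((side (centered (subgraph u) (t *: 'e_ord_max)) x - side (subgraph u) x) * kern a d (x - q)).
Proof.
move=> na d0 r0 Bu Bp; set E := subgraph u.
have a0 : 0 <= a by rewrite (le_trans _ (ltW na)).
have oE : open E := subgraph_open Bu.
have mE : measurable E := measurable_open oE.
have [eta eta0 ueta] := subgraph_locally_bounded Bu Bp.
pose B := [set y : 'rV[R]_m | forall j : 'I_m, initc p ord0 j - eta <= y ord0 j <= initc p ord0 j + eta].
have mB : measurable B by exact: measurable_box.
pose b : R := \prod_(j < m) (initc p ord0 j + eta - (initc p ord0 j - eta)).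
have b0 : 0 < b by apply: prodr_gt0 => j _; clear - eta0; lra.
have Bb : lebesgueRn R m B = b%:E.
  by apply: (@lebesgueRn_box R m (fun j => initc p ord0 j - eta)) => j; clear - eta0; lra.
(* In sup norm a point of the gap is within eta + 2 of p: u varies by at most 1 over the box and t
   <= 1. The distance from p to q adds r. *)
pose rho1 := m.+1%:R * (eta + 2 + r).
pose f0 := Num.max rho1 d `^ (- a).
have f00 : 0 < f0 by rewrite powR_gt0// lt_max d0 orbT.
exists (2 * f0 * b); first by rewrite !mulr_gt0.
move=> t q t0 t1 qr.
pose E' := centered E (t *: 'e_ord_max).
have mE' : measurable E' by exact: measurable_centered.
pose P := [set x : 'rV[R]_m.+1 | [/\ B (initc x), E x & ~ E (x + t *: 'e_ord_max)]].
have mu_P : lebesgueRn R m.+1 P = (t * b)%:E by exact: (gap_measure u (ltW t0) mB Bb).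
have minit : measurable_fun setT (initc : 'rV[R]_m.+1 -> 'rV[R]_m).
  apply: measurable_rowP => j; under eq_fun do rewrite mxE.
  exact: measurable_coord.
have mP : measurable P.
  rewrite (_ : P = (initc @^-1` B) `&` (E `&` ~` E')).
    apply: measurableI; first exact: measurable_preimage.
    by apply: measurableI => //; exact: measurableC.
  by apply/seteqP; split => x; [move=> [h1 h2 h3]; split => //|move=> [h1 [h2 h3]]; split].
have pq := @preserving_translation R m.+1 (- q).
have ki := integ_preserving pq (kern_integrable na d0).
have intP : (\int[lebesgueRn R m.+1]_x (\1_P x)%:E)%E = (t * b)%:E.
  by rewrite integral_indic// setIT; exact: mu_P.
have iP : (lebesgueRn R m.+1).-integrable setT (EFin \o (\1_P : 'rV[R]_m.+1 -> R)).
  apply/integrableP; split; first by apply/measurable_EFinP; exact: measurable_indic.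
  rewrite (eq_integral (fun x => (\1_P x)%:E)); last by move=> x _; rewrite /= ger0_norm.
  by rewrite intP ltry.
have -> : 2 * f0 * b * t = \int[lebesgueRn R m.+1]_x (2 * f0 * \1_P x).
  rewrite (RintegralZl _ measurableT iP) /Rintegral intP /=.
  by rewrite (mulrC t) mulrA.
apply: le_Rint; [exact: integZ|exact: integ_sideB|move=> x].
have k0 := kern_ge0 a d (x - q).
have [Px|nPx] := pselect (P x); last first.
  rewrite indicE memNset// mulr0 mulr_ge0// subr_ge0.
  have [Ex|nEx] := pselect (E x).
    by rewrite (side_in Ex) lerNl (le_trans (ler_norm _))// normrN norm_side.
  have nE'x : ~ E' x by move=> h; apply: nEx; exact: (subgraph_translate (ltW t0) h).
  by rewrite !side_out.
rewrite indicE mem_set// mulr1; have [Bx Ex nE'] := Px.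
rewrite (side_in Ex) side_out// opprK -[leRHS]/((1 + 1) * _) ler_wpM2l//.
have xp : `|x - p| <= eta + 2.
  apply: norm_le_coord => [|j]; first by clear - eta0; lra.
  rewrite mxE [X in _ + X]mxE.
  case: (unliftP ord_max j) => [k|] ->.
    by have := Bx k; rewrite !mxE ler_norml; clear - eta0; lra.
  have Bn : `|initc x - initc p| <= eta.
    apply: norm_le_coord => [|k]; first exact: ltW.
    by have := Bx k; rewrite !mxE ler_norml; clear; lra.
  have := ueta _ Bn; rewrite ler_norml => /andP[h1 h2].
  have h3 : lastc x < u (initc x) by exact: Ex.
  have h4 : u (initc x) <= lastc x + t.
    rewrite leNgt; apply/negP => h; apply: nE'; rewrite /E /subgraph /= initcD lastcD initcZ lastcZ.
    by rewrite initc_delta_max scaler0 addr0 {2}/lastc mxE !eqxx mulr1.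
  rewrite -/(lastc x) -/(lastc p) ler_norml; clear - h1 h2 h3 h4 t1 eta0; lra.
apply: powRN_anti => //; first by rewrite lt_max d0 orbT.
rewrite ge_max !le_max lexx orbT andbT; apply/orP; left.
apply: (le_trans (enorm_le_norm _)); rewrite ler_wpM2l//.
rewrite -(subrKA p) (le_trans (ler_normD _ _))// lerD// distrC.
exact: qr.
Qed.

End Subgraph.

Section VerticalTangent.
Context {R : realType}.

(** Along v the function [Phi] grows at rate 1, while a zero gradient would leave only growth of
    order s^2. *)
Lemma defining_gradient_neq0 n (E : set 'rV[R]_n) p Phi D (r0 K : R) :
  0 < K -> 0 < r0 -> defining_function E p Phi D r0 K -> D p != 0.
Proof.
move=> K0 r00 [_ h2 _ [v Pv]]; apply/eqP => Dp0.
pose C := K * `|v| ^+ 2 + 1; have KC : 0 <= K * `|v| ^+ 2 by rewrite mulr_ge0 ?exprn_ge0 // ltW.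
have C0 : 0 < C by rewrite ltr_wpDl.
have v0 : 0 < `|v| + 1 by rewrite ltr_wpDl.
pose s := Num.min (r0 / (`|v| + 1)) (1 / C).
have s0 : 0 < s by rewrite lt_min divr_gt0// divr_gt0.
have pr : `|p - p| <= r0 by rewrite subrr normr0 ltW.
have pv : p + s *: v - p = s *: v by rewrite addrAC subrr add0r.
have sv : `|s *: v| <= r0.
  rewrite normrZ (gtr0_norm s0); apply: (@le_trans _ _ (s * (`|v| + 1))).
    by rewrite ler_wpM2l ?(ltW s0)// lerDl.
  by rewrite -ler_pdivlMr// ge_min lexx.
have pvr : `|p + s *: v - p| <= r0 by rewrite pv.
have d0 : dotp (0 : 'rV[R]_n) (s *: v) = 0 by rewrite -(scale0r 0) dotpZl mul0r.
have := h2 p (p + s *: v) pr pvr.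
rewrite (Pv p s pr pvr) pv Dp0 d0 subr0 addrAC subrr add0r normrZ (gtr0_norm s0) exprMn.
have sC : s * C <= 1 by rewrite -ler_pdivlMr// ge_min lexx orbT.
move=> h; have : s * 1 <= s * (s * (K * `|v| ^+ 2)).
  by rewrite mulr1; apply: (le_trans h); rewrite expr2 le_eqVlt; apply/orP; left; apply/eqP; ring.
rewrite ler_pM2l// => h'; have : s * C <= s * (K * `|v| ^+ 2) by exact: le_trans h'.
by rewrite ler_pM2l// /C gerDl ler10.
Qed.

(* A vector orthogonal to every tangent vector is a multiple of the gradient. *)
Lemma normal_horizontal m (N nu : 'rV[R]_m.+1) : enorm nu = 1 -> lastc nu = 0 ->
  (forall w, dotp N w = 0 -> dotp nu w = 0) -> lastc N = 0.
Proof.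
move=> nu1 nul h; apply/eqP; apply: contrapT => /negP Nl.
have nuj j : nu ord0 (lift ord_max j) = 0.
  pose w : 'rV[R]_m.+1 := 'e_(lift ord_max j) - (N ord0 (lift ord_max j) / lastc N) *: 'e_ord_max.
  have dw z : dotp z w = z ord0 (lift ord_max j) - N ord0 (lift ord_max j) / lastc N * lastc z.
    by rewrite /w dotpC dotpBl dotpZl !(dotpC _ z) !dotp_delta.
  have := h w; rewrite !dw divfK// subrr nul mulr0 subr0; exact.
have : nu = 0.
  apply/rowP => j; rewrite [RHS]mxE; case: (unliftP ord_max j) => [k|] -> //.
move=> nu0; move: nu1; rewrite nu0 /enorm.
have -> : dotp (0 : 'rV[R]_m.+1) 0 = 0 by rewrite -{1}(scale0r 0) dotpZl mul0r.
by rewrite sqrtr0 => /eqP; rewrite eq_sym oner_eq0.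
Qed.

Lemma near0_mul_le (M b : R) : 0 < b -> \forall t \near (0 : R)^'+, M * t <= b.
Proof.
move=> b0; have M0 : 0 < `|M| + 1 by rewrite ltr_wpDl.
near=> t; have t0 : 0 < t by near: t; exact: nbhs_right_gt.
have tb : t <= b / (`|M| + 1) by near: t; apply: nbhs_right_le; rewrite divr_gt0.
apply: (@le_trans _ _ ((`|M| + 1) * t)).
  by rewrite ler_wpM2r ?(ltW t0)// (le_trans (ler_norm _))// lerDl.
by rewrite mulrC -ler_pdivlMr.
Unshelve. all: end_near.
Qed.

Lemma norm_vert m : `|'e_ord_max : 'rV[R]_m.+1| <= 1.
Proof. by rewrite norm_delta. Qed.

(* The singular part of the kernel sees E from the two points q and q2, whereas
   in the tail the horizontal shift h is moved onto the kernel, so that no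
   perimeter estimate for E is needed. *)
Lemma kern_comparison n (E : set 'rV[R]_n) (i : 'I_n) (e : 'rV[R]_n) (a d h rho : R) q q2 :
  measurable E -> n%:R < a -> 0 < d -> 0 < rho -> rho <= d ->
  q2 = q + e - h *: 'e_i ->
  \int[lebesgueRn R n]_x (side (centered E q2) x * kern a rho x) -
  \int[lebesgueRn R n]_x (side (centered E q) x * kern a rho x) =
  \int[lebesgueRn R n]_x ((side (centered E q2) x - side (centered E q) x) * nkern a rho d x) +
  (\int[lebesgueRn R n]_x (side (centered E e) x *
       (kern a d (x - q + h *: 'e_i) - kern a d (x - q))) +
   \int[lebesgueRn R n]_x ((side (centered E e) x - side E x) * kern a d (x - q))).
Proof.
move=> mE na d0 r0 rd q2E.
have mA := @measurable_centered R n E q2 mE.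
have mB := @measurable_centered R n E q mE.
have mEt := @measurable_centered R n E e mE.
have kr := @kern_integrable R n a rho na r0.
have kd := @kern_integrable R n a d na d0.
have kn := @integ_nkern R n a rho d na r0 rd.
have p1 := @preserving_translation R n (- q).
have p2 := @preserving_translation R n (- q + h *: 'e_i).
have k1 := integ_preserving p1 kd.
have k2 : (lebesgueRn R n).-integrable setT (EFin \o (fun x : 'rV[R]_n => kern a d (x - q + h *: 'e_i))).
  rewrite (_ : (fun x => _) = (fun x => kern a d (x + (- q + h *: 'e_i)))).
    exact: integ_preserving p2 kd.
  by apply/funext => x; rewrite addrA.
have sA := integ_side mA kd; have sB := integ_side mB kd.
have eA : \int[lebesgueRn R n]_x (side (centered E q2) x * kern a d x) =
    \int[lebesgueRn R n]_x (side (centered E e) x * kern a d (x - q + h *: 'e_i)).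
  etransitivity; first by symmetry; exact: (Rintegral_preserving p2 sA).
  apply: eq_Rintegral => x _.
  have xE : x + (- q + h *: 'e_i) + q2 = x + e.
    by rewrite q2E -addrA addrACA addKr subrr addr0.
  have -> : side (centered E q2) (x + (- q + h *: 'e_i)) = side (centered E e) x.
    by rewrite (side_centered E q2) (side_centered E e) xE.
  by rewrite addrA.
have eB : \int[lebesgueRn R n]_x (side (centered E q) x * kern a d x) =
    \int[lebesgueRn R n]_x (side E x * kern a d (x - q)).
  etransitivity; first by symmetry; exact: (Rintegral_preserving p1 sB).
  by apply: eq_Rintegral => x _; rewrite (side_centered E q) subrK.
have i1 := integ_side mA kr; have i2 := integ_side mB kr.
have j1 := integ_sideB mA mB kn; have j2 := integ_sideB mA mB kd.
have alg1 (b1 b2 c1 c2 : R) : b1 * c1 - b2 * c1 = (b1 - b2) * (c1 - c2) + (b1 - b2) * c2.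
  by ring.
have alg2 (b1 b2 c1 c2 : R) : b1 * c1 - b2 * c2 = b1 * (c1 - c2) + (b1 - b2) * c2.
  by ring.
have l1 := integ_side mEt (integB k2 k1).
have l2 := integ_sideB mEt mE k1.
have m1 := integ_side mEt k2; have m2 := integ_side mE k1.
etransitivity; first by symmetry; exact: (RintegralB measurableT i1 i2).
transitivity (\int[lebesgueRn R n]_x ((side (centered E q2) x - side (centered E q) x) * nkern a rho d x) +
     \int[lebesgueRn R n]_x ((side (centered E q2) x - side (centered E q) x) * kern a d x)).
  etransitivity; last exact: (RintegralD measurableT j1 j2).
  by apply: eq_Rintegral => x _; exact: alg1.
congr (_ + _).
transitivity (\int[lebesgueRn R n]_x (side (centered E q2) x * kern a d x) - \int[lebesgueRn R n]_x (side (centered E q) x * kern a d x)).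
  etransitivity; last exact: (RintegralB measurableT sA sB).
  by apply: eq_Rintegral => x _; exact: mulrBl.
rewrite eA eB.
etransitivity; first by symmetry; exact: (RintegralB measurableT m1 m2).
etransitivity; last exact: (RintegralD measurableT l1 l2).
by apply: eq_Rintegral => x _; exact: alg2.
Qed.

End VerticalTangent.

(* The ambient dimension is n = m.+1 with m >= 1, i.e. n >= 2. *)
Theorem theoremC2 (R : realType) (m : nat) (s : R)
    (E : set 'rV[R]_m.+1) (u : 'rV[R]_m -> R) :
  (1 <= m)%N ->
  0 < s -> s < 1 / 2 ->
  E = subgraph u ->
  boundary E = graph u ->
  boundary_globally_C2 E ->
  (forall x, boundary E x -> has_nmc s E x 0) ->
  forall x nu, boundary E x -> exterior_unit_normal E x nu ->
    lastc nu != 0.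
Proof.
move=> _ s0 s12 EE BE [r [M [r0 M0 charts]]] nmc p nu Bp [nu1 nutan _].
apply/eqP => nul.
have Bu : boundary (subgraph u) = graph u by rewrite -EE.
have oE : open E by rewrite EE; exact: subgraph_open.
have mE : measurable E by exact: measurable_open.
have [Q [g [QQ gC2 gM Eg]]] := charts p Bp.
have [Phi [D [r0' [K [r00 K0 dPhi tang]]]]] := chart_defining_function r0 M0 QQ gC2 gM Eg.
have BP x : `|x - p| < r0' -> boundary E x <-> Phi x = 0.
  by move=> xr; exact: (boundary_definingP K0 r00 dPhi xr).
have pp : `|p - p| < r0' by rewrite subrr normr0.
have Pp : Phi p = 0 by apply/(BP p pp).
have tang' := tang (fun x xr Px => proj2 (BP x xr) Px) Pp.
have Dl : lastc (D p) = 0.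
  by apply: (normal_horizontal nu1 nul) => w Dw; apply: nutan; exact: tang'.
have Dn0 := defining_gradient_neq0 K0 r00 dPhi.
(* The sliding direction; by [Dl] it cannot be the last axis, so the slide is horizontal. *)
have [i Di] : exists i, D p ord0 i != 0.
  apply: contrapT => h; case/eqP: Dn0; apply/rowP => j; rewrite mxE.
  by apply: contrapT => hj; apply: h; exists j; apply/eqP.
have [sg [c [r1 [sg1 c0 /andP[r10 r1r] Dc mono]]]] := transversal_direction K0 r00 dPhi Di.
have [L L0 PL] := defining_lipschitz K0 r00 dPhi.
have [EP taylor _ _] := dPhi.
have r1r' : r1 <= r0' by exact: ltW.
pose e : 'rV[R]_m.+1 := 'e_ord_max.
have Et t x : 0 <= t -> E (x + t *: e) -> E x.
  by move=> t0; rewrite EE; exact: subgraph_translate.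
have [|||d [t0 [r4 [s1 [k0 [d0 t00 r40 s10 [k00 touch]]]]]]] :=
  @touching_point R _ E p Phi i sg c L r1 e sg1 c0 L0 r10 (@norm_vert R m) _ _ _ mono Et Pp.
- by move=> x xr; apply: EP; exact: le_trans r1r'.
- by move=> x xr; apply: BP; exact: le_lt_trans r1r.
- by move=> x y xr yr; apply: PL; exact: le_trans r1r'.
pose a := m.+1%:R + 2 * s.
have na : m.+1%:R < a by rewrite ltrDl mulr_gt0.
have an : a < m.+1%:R + 1 by rewrite ltrD2l; clear - s12; lra.
(* Radius d is where the touching inclusion holds; 2 dl <= r0'/2 is what [layer_side] requires on
   the doubled ball. *)
pose dl := Num.min d (r0' / 4).
have dl0 : 0 < dl by rewrite lt_min d0 divr_gt0.
have dld : dl <= d by rewrite ge_min lexx.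
have dlr : 2 * dl <= r0' / 2.
  have : dl <= r0' / 4 by rewrite ge_min lexx orbT.
  by clear; lra.
pose C := 2 ^+ m.+1 * K / c.
have C0 : 0 <= C by rewrite divr_ge0 ?(ltW c0)// mulr_ge0 ?(ltW K0)// exprn_ge0.
(* Lipschitz constant of the linear part 2 sg x'.(q - p)' of the shear, as |q - p| <= r1/4. *)
pose Lc := 2 * (m.+1%:R * (r1 / 4)).
have Lc0 : 0 <= Lc by rewrite !mulr_ge0// ltW.
have [H [H0 near_est]] := near_estimate i na an dl0 C0 Lc0.
have [H' [H'0 far_est]] := far_estimate i na dl0.
have r140 : 0 <= r1 / 4 by rewrite divr_ge0// ltW.
have Bp' : boundary (subgraph u) p by rewrite -EE.
have [c1 c10 gap] := gap_lower_bound na dl0 r140 Bu Bp'.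
(* At p + t e_n the function [Phi] is at most K t^2, and sliding lowers it at rate c: the slide is
   at most M1 t^2. With penalty coefficient k = M2 t^2, the requirement tau <= k r4^2 follows. *)
pose M1 := K / c; have M10 : 0 < M1 by rewrite divr_gt0.
pose M2 := M1 / r4 ^+ 2; have M20 : 0 < M2 by rewrite divr_gt0// exprn_gt0.
(* Besides staying inside the local charts, t must be so small that the errors of order t^2 fall
   below a quarter of the gain c1 t. *)
have [t [tp t1 tt0 tr1 [[tau_s1 tau_r1 tau_dl] [tk0 tk4 tfin]]]] : exists t : R,
  [/\ 0 < t, t <= 1, t <= t0, t <= r1 / 8 &
   [/\ M1 * t <= s1, M1 * t <= r1 / 8 & M1 * t <= dl / 2] /\
   [/\ M2 * t <= k0, M2 * (2 * dl + Lc) * t <= 4^-1 & (H' * M1 + H * M2) * t <= c1 / 4]].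
  have near1 (b : R) : 0 < b -> \forall t \near (0 : R)^'+, t <= b.
    by move=> b0; exact: nbhs_right_le.
  have F : ProperFilter (0 : R)^'+ by exact: at_right_proper_filter.
  apply: (@filter_ex _ (0 : R)^'+); near=> t.
  split; first by near: t; exact: nbhs_right_gt.
  - by near: t; exact: near1.
  - by near: t; exact: near1.
  - by near: t; apply: near1; rewrite divr_gt0.
  split; split; near: t; apply: near0_mul_le => //.
  - by rewrite divr_gt0.
  - by rewrite divr_gt0.
  - by rewrite divr_gt0.
have tt : t ^+ 2 <= t by rewrite expr2 ler_piMl// ltW.
(* Since e_n is tangent at p, the distance to slide is only quadratic in t. *)
have M1t : M1 * t ^+ 2 <= M1 * t by rewrite ler_pM2l.
have [tau [tau0 tauM Ptau]] : exists tau, [/\ 0 <= tau, tau <= M1 * t ^+ 2 &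
    Phi (p + t *: e - (tau * sg) *: 'e_i) = 0].
  pose S := M1 * t ^+ 2; have S0 : 0 <= S by rewrite mulr_ge0 ?exprn_ge0// ltW.
  have Sr : S <= r1 / 8 by exact: le_trans tau_r1.
  have cS : c * S = K * t ^+ 2 by rewrite /S /M1 mulrA (mulrC c) divfK ?gt_eqF.
  have slr (z : R) : 0 <= z <= S -> `|p + t *: e - (z * sg) *: 'e_i - p| <= r1.
    move=> /andP[z0 zS]; apply: (le_trans (norm_slide p p i t z sg1 (@norm_vert R m))).
    rewrite subrr normr0 (gtr0_norm tp) (ger0_norm z0); clear - zS Sr tr1 r10; lra.
  have ptr : `|p + t *: e - p| <= r1.
    by have := slr 0; rewrite mul0r scale0r subr0; apply; rewrite lexx.
  have pte : p + t *: e - p = t *: e by rewrite addrAC subrr add0r.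
  have Pt : Phi (p + t *: e) <= K * t ^+ 2.
    have := taylor p (p + t *: e) (ltW pp) (le_trans ptr r1r').
    have De : dotp (D p) (t *: e) = 0 by rewrite dotpZr dotp_delta [D p _ _]Dl mulr0.
    rewrite Pp pte De !subr0 normrZ norm_delta mulr1 (gtr0_norm tp).
    by apply: le_trans; exact: ler_norm.
  have Pt0 : 0 <= Phi (p + t *: e).
    rewrite leNgt; apply/negP => /(EP _ (le_trans ptr r1r'))/(Et _ _ (ltW tp)).
    by move=> /(EP _ (ltW pp)); rewrite Pp ltxx.
  have PL' x y : `|x - p| <= r1 -> `|y - p| <= r1 -> `|Phi y - Phi x| <= L * `|y - x|.
    by move=> xr yr; apply: PL; exact: le_trans r1r'.
  have conv (z : R) : p + t *: e + (z * sg) *: 'e_i = p + t *: e - (- z * sg) *: 'e_i.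
    by rewrite mulNr scaleNr opprK.
  have NS : - S <= 0 by rewrite oppr_le0.
  have [|||z /andP[z1 z2] Pz] := @slide_to_zero _ _ p Phi i sg L r1 (- S) 0 (p + t *: e) sg1 L0 PL' NS.
  - by move=> z /andP[z1 z2]; rewrite conv; apply: slr; rewrite oppr_ge0 z2 lerNl z1.
  - have back : p + t *: e + (- S * sg) *: 'e_i + (S * sg) *: 'e_i = p + t *: e.
      by rewrite mulNr scaleNr subrK.
    have hr : `|p + t *: e + (- S * sg) *: 'e_i - p| <= r1.
      by rewrite conv opprK; apply: slr; rewrite lexx S0.
    have := mono _ S S0 hr; rewrite back cS => /(_ ptr) hm.
    by clear - hm Pt; lra.
  - by rewrite mul0r scale0r addr0.
  rewrite conv in Pz; exists (- z); split => //; first by rewrite oppr_ge0.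
  by rewrite lerNl.
pose k := M2 * t ^+ 2; have kp : 0 < k by rewrite mulr_gt0// exprn_gt0.
have kM : k <= M2 * t by rewrite ler_pM2l.
have taus1 : tau <= s1 by apply: (le_trans tauM); exact: le_trans tau_s1.
have kk0 : k <= k0 by exact: le_trans tk0.
have tauk : tau <= k * r4 ^+ 2.
  by rewrite /k /M2 mulrAC divfK// gt_eqF// exprn_gt0.
have [q [h [qr /andP[h0 htau] Bq Bq2 incl]]] :=
  touch t tau k tp tt0 tau0 taus1 Ptau kp kk0 tauk.
set q2 := q + t *: e - (h * sg) *: 'e_i in Bq2 incl.
have hr1 : h <= r1 / 8 by apply: (le_trans htau); apply: (le_trans tauM); exact: le_trans tau_r1.
have q2r : `|q2 - p| <= r1 / 2.
  apply: (le_trans (norm_slide q p i t h sg1 (@norm_vert R m))).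
  rewrite (gtr0_norm tp) (ger0_norm h0); clear - qr tr1 hr1; lra.
have qr2 : `|q - p| <= r0' / 2 by apply: (le_trans qr); clear - r1r r10; lra.
have q2r2 : `|q2 - p| <= r0' / 2 by apply: (le_trans q2r); clear - r1r r10; lra.
have lt2 x : `|x - p| <= r0' / 2 -> `|x - p| < r0'.
  by move=> xr; apply: (le_lt_trans xr); clear - r00; lra.
have Pq : Phi q = 0 by apply/(BP q (lt2 q qr2)).
have Pq2 : Phi q2 = 0 by apply/(BP q2 (lt2 q2 q2r2)).
have Dq : c <= `|D q ord0 i| by apply: Dc; apply: (le_trans qr); clear - r10; lra.
have Dq2 : c <= `|D q2 ord0 i| by apply: Dc; apply: (le_trans q2r); clear - r10; lra.
have r02 : 0 < r0' / 2 by rewrite divr_gt0.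
have eps0 : 0 < c1 * t / 4 by rewrite divr_gt0// mulr_gt0.
(* The vanishing mean curvature, restated for the levelled-off kernel with tolerance c1 t / 4: used
   at both contact points, it costs half of the gain. *)
have small x : boundary E x -> Phi x = 0 -> `|x - p| <= r0' / 2 -> c <= `|D x ord0 i| ->
  \forall rho \near (0 : R)^'+, `|\int[lebesgueRn R m.+1]_y (side (centered E x) y * kern a rho y)| < c1 * t / 4.
  move=> Bx Px xr Dx.
  apply: (has_nmc_kern s0 s12 mE (measurable_layer (D x) K) C0 r02 (nmc x Bx) _ _ eps0).
  - by move=> r2 r20 _; exact: (layer_measure K0 c0 Dx r20).
  - by move=> y yr; exact: (layer_side K0 dPhi xr r00 Px yr).
have smq := small q Bq Pq qr2 Dq; have smq2 := small q2 Bq2 Pq2 q2r2 Dq2.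
(* The level rho is chosen after t, which is harmless since no constant above depends on it. *)
have [rho [rho0 rhodl Iq Iq2]] : exists rho : R, [/\ 0 < rho, rho <= dl,
    `|\int[lebesgueRn R m.+1]_y (side (centered E q) y * kern a rho y)| < c1 * t / 4 &
    `|\int[lebesgueRn R m.+1]_y (side (centered E q2) y * kern a rho y)| < c1 * t / 4].
  have F : ProperFilter (0 : R)^'+ by exact: at_right_proper_filter.
  apply: (@filter_ex _ (0 : R)^'+); near=> rho.
  split; [by near: rho; exact: nbhs_right_gt|by near: rho; exact: nbhs_right_le|by near: rho|by near: rho].
have q2E : q2 = q + t *: 'e_ord_max - (h * sg) *: 'e_i by [].
have comp := kern_comparison mE na dl0 rho0 rhodl q2E.
have hsg : `|h * sg| = h by rewrite normrM sg1 mulr1 ger0_norm.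
have hM : h <= M1 * t ^+ 2 by exact: le_trans tauM.
have F1 := far_est (centered E (t *: e)) q (h * sg) (measurable_centered _ mE) _.
have {}F1 := F1 ltac:(by rewrite hsg; apply: (le_trans hM); apply: (le_trans M1t)).
have G1 := gap t q tp t1 qr.
(* The quadratic and linear parts of the shear given by [touch], relative to the contact point q. *)
have N1 := near_est (centered E q2) (centered E q) (layer (D q) K) k
  (fun x => sg * dotp' i x x) (fun x => sg * 2 * dotp' i x (q - p)) rho.
have {}N1 : - (H * k) <= \int[lebesgueRn R m.+1]_x ((side (centered E q2) x - side (centered E q) x) * nkern a rho dl x).
  apply: N1.
  - exact: measurable_centered.
  - exact: measurable_centered.
  - exact: measurable_layer.
  - exact: ltW.
  - apply: le_trans tk4; apply: (@le_trans _ _ (M2 * t * (2 * dl + Lc))).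
      by apply: ler_wpM2r kM; rewrite addr_ge0// mulr_ge0// ltW.
    by rewrite mulrAC.
  - exact: rho0.
  - exact: rhodl.
  - by apply: measurable_funM; [exact: measurable_cst|exact: measurable_dotp'_sqr].
  - by apply: measurable_funM; [exact: measurable_cst|exact: measurable_dotp'].
  - by move=> x z; rewrite dotp'_delta dotp'C dotp'_delta.
  - by move=> x z; rewrite dotp'_delta.
  - by move=> x; rewrite dotp'N mulrN.
  - move=> x; rewrite !normrM sg1 mul1r (ger0_norm (ler0n _ 2)) /Lc -mulrA ler_wpM2l//.
    apply: (le_trans (dotp'_le _ _ _)).
    apply: (@le_trans _ _ (m.+1%:R * (enorm x * (r1 / 4)))).
      by rewrite ler_wpM2l//; apply: ler_pM => //; exact: norm_le_enorm.
    rewrite le_eqVlt; apply/orP; left; apply/eqP.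
    by move: (enorm x) (m.+1%:R) => z w; clear; ring.
  - move=> x; rewrite normrM sg1 mul1r ger0_norm ?dotp'_ge0//.
    exact: dotp'_le_enorm.
  - by move=> r2 r20 _; exact: (layer_measure K0 c0 Dq r20).
  - move=> x xr; apply: (layer_side K0 dPhi qr2 r00 Pq).
    exact: lt_le_trans dlr.
  - move=> x xr Ax; apply: incl => //.
    by rewrite (le_trans (norm_le_enorm x))// (le_trans (ltW xr)).
rewrite -EE in G1; rewrite hsg in F1.
rewrite /k in N1.
have HF : H' * h <= H' * (M1 * t ^+ 2) by rewrite ler_wpM2l.
have fin : (H' * M1 + H * M2) * t ^+ 2 <= c1 * t / 4.
  by rewrite expr2 mulrA (mulrAC c1) ler_wpM2r// ltW.
(* The gain c1 t is at most the near and far errors plus the two tolerances, that is at most three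
   quarters of itself by [fin]. *)
have M1M2 : c1 * t <= (H' * M1 + H * M2) * t ^+ 2 + c1 * t / 2.
  have lb (v w : R) : `|v| <= w -> - w <= v by rewrite ler_norml => /andP[].
  have ub (v w : R) : `|v| < w -> v < w by move/(le_lt_trans (ler_norm _)).
  have lb' (v w : R) : `|v| < w -> - w < v by rewrite ltr_norml => /andP[].
  have F1' := lb _ _ F1; have Iq2' := ub _ _ Iq2; have Iq' := lb' _ _ Iq.
  have tot : - (H * (M2 * t ^+ 2)) + (- (H' * h) + c1 * t) <= c1 * t / 4 + c1 * t / 4.
    apply: (le_trans (lerD N1 (lerD F1' G1))); rewrite -comp.
    by apply: lerD; [exact: ltW|rewrite lerNl ltW].
  by clear - tot HF; lra.
have c1t : 0 < c1 * t by rewrite mulr_gt0.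
by clear - M1M2 fin c1t; lra.
Unshelve. all: end_near.
Qed.
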